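(* If $\rho$ is a $2$-polymatroid, then $\chi(\rho;x)=s\cdot\chi(G;x)$ for some graph $G$ and some rational number $s$.
   Context: A polymatroid on a finite set $E$ is a function $\rho:2^E\to\mathbb{Z}$ that is normalized ($\rho(\emptyset)=0$), non-decreasing and submodular; it is a $2$-polymatroid if $\rho(\{e\})\le2$ for all $e\in E$. The chromatic polynomial $\chi(\rho;x)$ of $\rho$ is the polynomial in $x$ (it is a polynomial with rational coefficients) whose value at each positive integer $k$ is the number of $k$-tuples $(M_1,\dots,M_k)$ of matroids on $E$ with $\rho=r_{M_1}+\cdots+r_{M_k}$ (pointwise sum of rank functions). $\chi(G;x)$ is the usual chromatic polynomial of the graph $G$. *)

(* Defs.v *)
From mathcomp Require Import all_boot all_order all_algebra.
Set Implicit Arguments. Unset Strict Implicit. Unset Printing Implicit Defensive.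
Import Order.TTheory GRing.Theory Num.Theory.
Local Open Scope ring_scope.

Definition is_polymatroid (E : finType) (rho : {set E} -> int) : bool :=
  (rho set0 == 0) &&
  [forall X : {set E}, forall Y : {set E},
     ((X \subset Y) ==> (rho X <= rho Y)) &&
     (rho (X :|: Y) + rho (X :&: Y) <= rho X + rho Y)].

Definition is_2polymatroid (E : finType) (rho : {set E} -> int) : bool :=
  is_polymatroid rho && [forall e : E, rho [set e] <= 2].

Definition is_matroid_rank (E : finType) (r : {set E} -> int) : bool :=
  is_polymatroid r && [forall X : {set E}, r X <= (#|X|)%:Z].

(* A matroid on E is identified with its rank function; since r(X) <= |E|,
   every matroid rank function is encoded (bijectively) by a finite function
   {set E} -> 'I_(#|E|.+1). *)
Definition rankfun (E : finType) := {ffun {set E} -> 'I_(#|E|.+1)}.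

Definition rk (E : finType) (r : rankfun E) : {set E} -> int :=
  fun X => ((r X : nat))%:Z.

Definition matroid_decomp_count (E : finType) (rho : {set E} -> int) (k : nat)
  : nat :=
  #|[set t : {ffun 'I_k -> rankfun E} |
      [forall i : 'I_k, is_matroid_rank (rk (t i))] &&
      [forall X : {set E}, rho X == \sum_(i < k) rk (t i) X]]|.

Definition proper_colourings_count (n : nat) (adj : rel 'I_n) (k : nat) : nat :=
  #|[set c : {ffun 'I_n -> 'I_k} |
      [forall u : 'I_n, forall v : 'I_n, (adj u v) ==> (c u != c v)]]|.

Definition poly_counts (p : {poly rat}) (count : nat -> nat) : Prop :=
  forall k : nat, (0 < k)%N -> p.[k%:R] = (count k)%:R.

Definition simple_graph (n : nat) (adj : rel 'I_n) : Prop :=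
  irreflexive adj /\ symmetric adj.

(* Main.v *)
(* Split the matroids of a tuple into their nonloop components, the pieces. Since [rho] is a 2-polymatroid, every element lies in at most two pieces. Separators of [rho] multiply both counts, so let [rho] be connected. For elements [a], [b] and a set [Z], the number of pieces in which [a] and [b] are parallel after contracting [Z] depends only on [rho], and a connected matroid is determined by those of its parallel pairs that cross a given bipartition.
   If no two pieces are supported on all nonloops, the supports do not depend on the tuple, and the tuples are the proper colourings of the intersection graph of the supports, times the number of choices of matroids on the supports. If two pieces are supported on all nonloops, the tuple consists of two connected matroids put at two of the k positions; this gives a multiple of k(k-1).
   Both kinds of tuples coexist only when the intersection graph of the supports is a triangle or a path on three vertices. Then the matroids on the supports are unique, and so is the pair of connected matroids, up to order; so the count is k(k-1) + k(k-1)(k-2) = k(k-1)^2 or k(k-1) + k(k-1)^2 = k^2(k-1), the chromatic polynomial of a path or of an edge and an isolated vertex. *)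
Require Import Defs.
From mathcomp Require Import all_boot all_order all_algebra.
From mathcomp Require Import zify.
Set Implicit Arguments. Unset Strict Implicit. Unset Printing Implicit Defensive.

(** Parallel pairs are visible in [rho] because the local submodularity defect r(aZ) + r(bZ) -
    r(abZ) - r(Z) of a matroid is 1 for a parallel pair over Z and 0 otherwise, and it is additive
    in r. The obstacle is that the sum over all pieces does not tell which piece a parallel pair
    belongs to. The remedy is a labelling of the elements: in a given piece, label each element by
    the other piece that contains it. Two elements with different labels then share no piece but the
    given one, so the sum for such a crossing pair has a single term. Crossing pairs suffice since
    any two elements of a connected matroid are parallel in some contraction: they control
    connectivity ([conn_transfer]), separators ([conn_separates]) and all ranks
    ([cross_determined]). Two pieces supported on all nonloops cannot be told apart by labels. For
    them one follows the marginals of one element that lies in two overlapping pieces of another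
    decomposition: one of the two connected matroids takes the larger marginal, the other the
    smaller ([nested]). *)

Ltac set_bool z :=
  repeat match goal with
  | H : is_true (_ \in _) |- _ => move: H
  | H : is_true (_ \notin _) |- _ => move: H
  | H : is_true (_ != _) |- _ => move: H
  end;
  repeat match goal with
  | H : is_true (_ \subset _) |- _ => move: H => /subsetP/(_ z)/implyP
  | H : is_true [disjoint _ & _] |- _ =>
      move: H; rewrite disjoint_subset => /subsetP/(_ z)/implyP
  end;
  rewrite ?inE //=;
  repeat match goal with
  | |- context [@eq_op ?T ?u ?v] =>
      case: (@eqP T u v);
      [let h := fresh "h" in move=> h; rewrite ?h|move=> ?];
      rewrite /=; try done; try (exfalso; congruence)
  end;
  repeat match goal with
  | |- context [in_mem ?u ?M] => case: (in_mem u M) => //=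
  end.

Ltac by_setP := let z := fresh "z" in apply/setP => z; set_bool z.
Ltac by_subset := let z := fresh "z" in apply/subsetP => z; apply/implyP; set_bool z.

(** * Connectivity and parallel pairs *)

Section Matroid.
Variable E : finType.
Implicit Types (r s : {set E} -> nat) (A B C D F G K S T U V W X Y Z : {set E}).
Implicit Types (a b e w x y : E).

(** With submodularity, the bound on singletons is equivalent to [r X <= #|X|] (see [rk_card]). *)
Definition matroid r : Prop :=
  [/\ r set0 = 0, forall X Y, X \subset Y -> r X <= r Y,
      forall X Y, r (X :|: Y) + r (X :&: Y) <= r X + r Y
    & forall e, r [set e] <= 1].

(** The contraction remains a function on all subsets of [E]; the elements of [Z] become loops. *)
Definition ctr r Z : {set E} -> nat := fun X => r (X :|: Z) - r Z.

(* [a] and [b] are parallel nonloops of the contraction [r / Z]. *)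
Definition par r Z a b : bool :=
  [&& r (a |: Z) == (r Z).+1, r (b |: Z) == (r Z).+1
    & r (a |: (b |: Z)) == (r Z).+1].

(** The empty set is connected, which permits empty supports; a single loop is not. The notion is
    applied to [rho] as well as to matroids. *)
Definition conn r F : bool :=
  [forall e in F, 0 < r [set e]] &&
  [forall A : {set E}, [&& A \subset F, A != set0 & A != F] ==>
     (r F < r A + r (F :\: A))].

Section OneMatroid.
Variable r : {set E} -> nat.
Hypothesis rM : matroid r.

Lemma rk0 : r set0 = 0. Proof. by case: rM. Qed.

Lemma rk_mono X Y : X \subset Y -> r X <= r Y.
Proof. by case: rM => _ + _ _; apply. Qed.

Lemma rk_submod X Y : r (X :|: Y) + r (X :&: Y) <= r X + r Y.
Proof. by case: rM => _ _ + _; apply. Qed.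

Lemma rk1 e : r [set e] <= 1. Proof. by case: rM => _ _ _; apply. Qed.

Lemma rk_subadd X Y : r (X :|: Y) <= r X + r Y.
Proof. by have := rk_submod X Y; lia. Qed.

Lemma rk_submod_le U V X Y :
  U \subset X :|: Y -> V \subset X :&: Y -> r U + r V <= r X + r Y.
Proof. by move=> /rk_mono hU /rk_mono hV; have := rk_submod X Y; lia. Qed.

Lemma rk_setU1 e Z : r Z <= r (e |: Z) <= (r Z).+1.
Proof.
apply/andP; split; first by apply: rk_mono; apply: subsetUr.
by have := rk_subadd [set e] Z; have := rk1 e; lia.
Qed.

Lemma ctr_matroid Z : matroid (ctr r Z).
Proof.
split; rewrite /ctr.
- by rewrite set0U subnn.
- by move=> X Y sXY; apply: leq_sub2r; apply/rk_mono/setSU.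
- move=> X Y.
  have h : r (X :|: Y :|: Z) + r ((X :&: Y) :|: Z) <= r (X :|: Z) + r (Y :|: Z).
    by apply: rk_submod_le; by_subset.
  have := @rk_mono Z (X :|: Z); have := @rk_mono Z (Y :|: Z).
  have := @rk_mono Z (X :|: Y :|: Z); have := @rk_mono Z ((X :&: Y) :|: Z).
  by rewrite !subsetUr => /(_ isT) ? /(_ isT) ? /(_ isT) ? /(_ isT) ?; lia.
- by move=> e; have := rk_setU1 e Z; lia.
Qed.

Lemma ctrE Z X : ctr r Z X + r Z = r (X :|: Z).
Proof. by rewrite /ctr subnK //; apply/rk_mono/subsetUr. Qed.

(** Parallelism becomes an equation linear in [r], so that it can be summed over the pieces of a
    tuple. *)
Lemma par_count Z a b :
  par r Z a b + r (a |: (b |: Z)) + r Z = r (a |: Z) + r (b |: Z).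
Proof.
have sub : r (a |: (b |: Z)) + r Z <= r (a |: Z) + r (b |: Z).
  by apply: rk_submod_le; by_subset.
have := rk_setU1 a Z; have := rk_setU1 b Z; have := rk_setU1 a (b |: Z).
have : r (a |: Z) <= r (a |: (b |: Z)) by apply: rk_mono; by_subset.
by rewrite /par; case: eqP; case: eqP; case: eqP => /=; lia.
Qed.

Lemma parC Z a b : par r Z a b = par r Z b a.
Proof. by rewrite /par [a |: (b |: Z)]setUCA andbCA. Qed.

Lemma par_notin Z a b : par r Z a b -> (a \notin Z) && (b \notin Z).
Proof.
case/and3P => /eqP ha /eqP hb _; apply/andP; split.
- by apply: contra_eqN ha => aZ; rewrite (setUidPr _) ?sub1set //; lia.
- by apply: contra_eqN hb => bZ; rewrite (setUidPr _) ?sub1set //; lia.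
Qed.

Lemma par_nonloop Z a b : par r Z a b -> 0 < r [set a].
Proof. by case/and3P => /eqP ha _ _; have := rk_subadd [set a] Z; lia. Qed.

Lemma par_ctr W Z a b : par (ctr r W) Z a b = par r (Z :|: W) a b.
Proof.
have h (A : {set E}) : (ctr r W A == (ctr r W Z).+1) = (r (A :|: W) == (r (Z :|: W)).+1).
  by have := ctrE W A; have := ctrE W Z; lia.
by rewrite /par !h !setUA.
Qed.

Lemma connP F : reflect
  ((forall e, e \in F -> 0 < r [set e]) /\
   (forall A, A \subset F -> A != set0 -> A != F -> r F < r A + r (F :\: A)))
  (conn r F).
Proof.
apply: (iffP andP) => [[/forall_inP h1 /forallP h2]|[h1 h2]]; split => //.
- by move=> A a b c; have := h2 A; rewrite a b c.
- exact/forall_inP.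
- by apply/forallP => A; apply/implyP => /and3P[]; apply: h2.
Qed.

Lemma conn_sep F A : conn r F -> A \subset F -> r A + r (F :\: A) <= r F ->
  A = set0 \/ A = F.
Proof.
case/connP => _ h sAF hr; have [->|nA] := eqVneq A set0; first by left.
by have [->|nF] := eqVneq A F; [right | have := h A sAF nA nF; lia].
Qed.

Lemma sep_split F A : A \subset F -> r A + r (F :\: A) <= r F ->
  forall X, X \subset F -> r X = r (X :&: A) + r (X :\: A).
Proof.
move=> sAF hr X sXF.
have h1 : r X <= r (X :&: A) + r (X :\: A).
  by rewrite -{1}(setID X A); apply: rk_subadd.
have h2 : r (X :|: A) + r (X :&: A) <= r X + r A by apply: rk_submod.
have h3 : r F + r (X :\: A) <= r (X :|: A) + r (F :\: A).
  by apply: rk_submod_le; by_subset.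
lia.
Qed.

(** The rank is a sum over the two sides of a separator, so the marginals of [a] and [b] are
    independent and the defect in [par_count] vanishes. *)
Lemma sep_par F A Z a b : A \subset F -> r A + r (F :\: A) <= r F ->
  Z \subset F -> a \in A -> b \in F -> b \notin A -> par r Z a b = false.
Proof.
move=> sAF hr sZF aA bF bA.
have aF := subsetP sAF a aA.
have sp X : X \subset F -> r X = r (X :&: A) + r (X :\: A) by apply: sep_split hr X.
have e1 := sp _ sZF.
have e2 : r (a |: Z) = r (a |: (Z :&: A)) + r (Z :\: A).
  rewrite sp; last by by_subset.
  by congr (r _ + r _); by_setP.
have e3 : r (b |: Z) = r (Z :&: A) + r (b |: (Z :\: A)).
  rewrite sp; last by by_subset.
  by congr (r _ + r _); by_setP.
have e4 : r (a |: (b |: Z)) = r (a |: (Z :&: A)) + r (b |: (Z :\: A)).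
  rewrite sp; last by by_subset.
  by congr (r _ + r _); by_setP.
have := par_count Z a b; lia.
Qed.

(* Tutte: if both [r \ w] and [r / w] were disconnected, by separations (A, B) and (C, D), submodularity would make one of (A n C, B u D u w), (A u C u w, B n D) a separation, and likewise after swapping C and D. *)
Lemma conn_del_ctr F w : conn r F -> w \in F -> 1 < #|F| ->
  conn r (F :\ w) \/ conn (ctr r [set w]) (F :\ w).
Proof.
move=> cF wF F2; case/connP: (cF) => nl sep.
have [cd|ncd] := boolP (conn r (F :\ w)); [by left | right].
have rw : r [set w] = 1 by have := nl w wF; have := rk1 w; lia.
have [A [sA A0 AF hA]] : exists A, [/\ A \subset F :\ w, A != set0, A != F :\ w
    & r A + r (F :\ w :\: A) <= r (F :\ w)].
  move: ncd; rewrite negb_and => /orP[/forall_inPn[e]|].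
    by rewrite !inE => /andP[_ /nl ->].
  case/forallPn => A; rewrite negb_imply => /andP[/and3P[? ? ?]].
  by rewrite -leqNgt; exists A.
have key C : C \subset F :\ w -> C != set0 -> C != F :\ w ->
    ctr r [set w] (F :\ w) < ctr r [set w] C + ctr r [set w] (F :\ w :\: C).
  move=> sC C0 CF; rewrite ltnNge; apply/negP => hC.
  set B := F :\ w :\: A; set D := F :\ w :\: C.
  have eF : F :\ w :|: [set w] = F by by_setP.
  have := ctrE [set w] (F :\ w); have := ctrE [set w] C; have := ctrE [set w] D.
  rewrite eF rw => cD cC cFw.
  have hF : r (F :\ w) <= r F by apply/rk_mono/subsetDl.
  (* Otherwise both intersections give proper separations of [F], with [w] on the large side, of
     total rank at least 2 r(F) + 2; submodularity bounds the same total by the left-hand side. The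
     1 in the bound is the rank of [w], which occurs twice on the left. *)
  have cross P Q P' Q' : P :|: Q = F :\ w -> [disjoint P & Q] ->
      P' :|: Q' = F :\ w -> [disjoint P' & Q'] ->
      r P + r Q + r (P' :|: [set w]) + r (Q' :|: [set w]) <= (r F).*2.+1 ->
      P :&: P' = set0 \/ Q :&: Q' = set0.
    move=> PQ dPQ PQ' dPQ' hr.
    have [->|n1] := eqVneq (P :&: P') set0; [by left | right].
    apply/eqP; apply: contraT => n2.
    have memP z : z \in F = (z == w) || (z \in P) || (z \in Q).
      by move/setP/(_ z): PQ; rewrite !inE; case: eqP => [->|_] //=; rewrite ?wF.
    have memP' z : z \in F = (z == w) || (z \in P') || (z \in Q').
      by move/setP/(_ z): PQ'; rewrite !inE; case: eqP => [->|_] //=; rewrite ?wF.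
    have wP : w \notin P :|: Q by rewrite PQ !inE eqxx.
    have wP' : w \notin P' :|: Q' by rewrite PQ' !inE eqxx.
    have part X Y : X \subset F -> X != set0 -> Y != set0 -> F :\: X = Y ->
        r F < r X + r Y.
      move=> sX X0 Y0 eY; rewrite -eY; apply: sep => //.
      by apply: contra_neq Y0 => eX; rewrite -eY eX setDv.
    have p1 : r F < r (P :&: P') + r (w |: (Q :|: Q')).
      apply: part => //.
      - by apply/subsetP => z; rewrite inE memP => /andP[->]; rewrite orbT.
      - by apply/set0Pn; exists w; rewrite setU11.
      - apply/setP => z; move: (memP z) (memP' z) wP wP' dPQ dPQ'.
        rewrite !disjoint_subset => + + + + /subsetP/(_ z)/implyP + /subsetP/(_ z)/implyP.
        rewrite !inE; case: (eqVneq z w) => [->|_].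
          by rewrite wF /=; do 4 case: (w \in _).
        by do 5 case: (z \in _) => //=.
    have p2 : r F < r (Q :&: Q') + r (w |: (P :|: P')).
      apply: part => //.
      - by apply/subsetP => z; rewrite inE memP => /andP[->]; rewrite !orbT.
      - by apply/set0Pn; exists w; rewrite setU11.
      - apply/setP => z; move: (memP z) (memP' z) wP wP' dPQ dPQ'.
        rewrite !disjoint_subset => + + + + /subsetP/(_ z)/implyP + /subsetP/(_ z)/implyP.
        rewrite !inE; case: (eqVneq z w) => [->|_].
          by rewrite wF /=; do 4 case: (w \in _).
        by do 5 case: (z \in _) => //=.
    have s1 : r (w |: (P :|: P')) + r (P :&: P') <= r P + r (P' :|: [set w]).
      by apply: rk_submod_le; clear; by_subset.
    have s2 : r (w |: (Q :|: Q')) + r (Q :&: Q') <= r Q + r (Q' :|: [set w]).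
      by apply: rk_submod_le; clear; by_subset.
    move: hr p1 p2 s1 s2; clear; lia.
  have sAB : A :|: B = F :\ w by rewrite /B -{1}(setIidPr sA) setID.
  have sCD : C :|: D = F :\ w by rewrite /D -{1}(setIidPr sC) setID.
  have dAB : [disjoint A & B] by rewrite -setI_eq0; apply/eqP; by_setP.
  have dCD : [disjoint C & D] by rewrite -setI_eq0; apply/eqP; by_setP.
  have dDC : [disjoint D & C] by rewrite disjoint_sym.
  have B0 : B != set0.
    by apply: contra_neq AF => eB; rewrite -sAB eB setU0.
  have D0 : D != set0.
    by apply: contra_neq CF => eD; rewrite -sCD eD setU0.
  have split P Q R : P :|: Q = R -> forall X, X \subset R -> X :&: P = set0 -> X :&: Q = set0 -> X = set0.
    by move=> <- X /setIidPl eX e1 e2; rewrite -eX setIUr e1 e2 setU0.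
  have sB : B \subset C :|: D by rewrite sCD subsetDl.
  have sA' : A \subset C :|: D by rewrite sCD.
  have sD' : D \subset A :|: B by rewrite sAB subsetDl.
  have sC' : C \subset A :|: B by rewrite sAB.
  have := cross A B C D sAB dAB sCD dCD; have := cross A B D C sAB dAB.
  rewrite setUC => /(_ sCD dDC) h1 h2.
  have {}h1 : A :&: D = set0 \/ B :&: C = set0.
    by apply: h1; move: hA hC cD cC cFw hF; rewrite -/B -/D; clear; lia.
  have {}h2 : A :&: C = set0 \/ B :&: D = set0.
    by apply: h2; move: hA hC cD cC cFw hF; rewrite -/B -/D; clear; lia.
  case: h1 h2 => [e1|e1] [e2|e2].
  - by case/eqP: A0; apply: split (erefl _) _ sA' e2 e1.
  - by case/eqP: D0; apply: split (erefl _) _ sD' _ _; rewrite setIC.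
  - by case/eqP: C0; apply: split (erefl _) _ sC' _ _; rewrite setIC.
  - by case/eqP: B0; apply: split (erefl _) _ sB e1 e2.
apply/andP; split; last first.
  by apply/forallP => C; apply/implyP => /and3P[]; apply: key.
(* Absence of loops follows from the separator condition at {e}, a proper subset because [A] is a
   proper nonempty subset of [F :\ w]. *)
apply/forall_inP => e eF.
have : ctr r [set w] (F :\ w) < ctr r [set w] [set e] + ctr r [set w] (F :\ w :\: [set e]).
  apply: key; rewrite ?sub1set //; first by apply/set0Pn; exists e; rewrite set11.
  apply: contra_neq AF => eFw; move: sA; rewrite -eFw subset1 (negPf A0) orbF.
  by move/eqP.
have := @rk_mono (F :\ w :\: [set e] :|: [set w]) (F :\ w :|: [set w]).
rewrite /ctr setSU ?subsetDl // => /(_ isT); lia.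
Qed.

End OneMatroid.
End Matroid.

Section Matroid2.
Variable E : finType.
Implicit Types (r s : {set E} -> nat) (A B C D F G K S T U V W X Y Z : {set E}).
Implicit Types (a b e w x y : E).

Lemma set_ind (P : {set E} -> Prop) :
  P set0 -> (forall y Y, y \notin Y -> P Y -> P (y |: Y)) -> forall Y, P Y.
Proof.
move=> P0 PS Y; elim: {Y}#|Y| {-2}Y (leqnn #|Y|) => [|n IH] Y hY.
  by move: hY; rewrite leqn0 cards_eq0 => /eqP ->.
have [->|[y yY]] := set_0Vmem Y; first exact: P0.
rewrite -(setD1K yY); apply: PS; first by rewrite setD11.
by apply: IH; have := cardsD1 y Y; rewrite yY; lia.
Qed.

Lemma conn_ext r s F : r =1 s -> conn r F = conn s F.
Proof.
move=> rs; rewrite /conn; congr (_ && _).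
  by apply: eq_forallb => e; rewrite rs.
by apply: eq_forallb => A; rewrite !rs.
Qed.

Section One.
Variable r : {set E} -> nat.
Hypothesis rM : matroid r.

Lemma ctr_ctr V Z : ctr (ctr r V) Z =1 ctr r (Z :|: V).
Proof.
move=> X; rewrite {1}/ctr.
have := ctrE rM V (X :|: Z); have := ctrE rM V Z; have := ctrE rM (Z :|: V) X.
by rewrite !setUA; lia.
Qed.

Lemma ctr0 : ctr r set0 =1 r.
Proof. by move=> X; rewrite /ctr setU0 rk0 // subn0. Qed.

Lemma cl_mono e X Y : X \subset Y -> r (e |: X) = r X -> r (e |: Y) = r Y.
Proof.
move=> sXY h; have : r (e |: Y) + r X <= r (e |: X) + r Y.
  by apply: rk_submod_le => //; by_subset.
by have := rk_setU1 rM e Y; lia.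
Qed.

Lemma cl_setU X Y : (forall e, e \in Y -> r (e |: X) = r X) -> r (X :|: Y) = r X.
Proof.
elim/set_ind: Y => [|y Y yY IH] h; first by rewrite setU0.
rewrite setUCA -[RHS]IH; last by move=> e eY; apply: h; rewrite setU1r.
by apply: (@cl_mono _ X); [apply: subsetUl | apply: h; rewrite setU11].
Qed.

Lemma parP Z a b : reflect
  [/\ r (a |: Z) = (r Z).+1, r (b |: Z) = (r Z).+1 & r (a |: (b |: Z)) = (r Z).+1]
  (par r Z a b).
Proof. by apply: (iffP and3P) => -[h1 h2 h3]; split; apply/eqP. Qed.

Lemma rk_setU2 a b Z : r (a |: (b |: Z)) + r Z <= r (a |: Z) + r (b |: Z).
Proof. by have := par_count rM Z a b; case: par; lia. Qed.

(** In the contraction by [Z], the elements [w], [x], [z] form a three-element circuit, so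
    contracting any one of them makes the other two parallel. *)
Lemma par_exchange w x z Z : par r (w |: Z) x z -> ~~ par r Z x z ->
  par r (x |: Z) w z.
Proof.
move=> /parP[] + + + /parP np.
rewrite (setUCA [set x] [set w]) (setUCA [set z] [set w] Z).
rewrite (setUCA [set x] [set w] (_ :|: _)) => h1 h2 h3.
have := rk_setU1 rM w Z; have := rk_setU1 rM x Z; have := rk_setU1 rM z Z.
have := rk_setU2 w x Z; have := rk_setU2 w z Z.
have := rk_setU2 x z Z; have := rk_setU1 rM w (x |: (z |: Z)).
have := rk_setU1 rM x (z |: Z).
move=> *; suff e : r (x |: (z |: Z)) = (r Z).+2.
  by apply/parP; rewrite (setUCA [set z] [set x] Z); split; lia.
apply/eqP; apply: contraT => /eqP ne; case: np; split; lia.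
Qed.

(** A contraction keeps a parallel pair parallel unless it turns the pair into loops; a single
    element [z] does so only if it lies in the same parallel class. *)
Lemma par_contract_lost z w x Z : par r Z w x -> ~~ par r (z |: Z) w x ->
  par r Z z x.
Proof.
move=> /parP[h1 h2 h3] /parP np.
have c1 : w |: (z |: Z) = z |: (w |: Z) by rewrite setUCA.
have c2 : x |: (z |: Z) = z |: (x |: Z) by rewrite setUCA.
have c3 : w |: (x |: (z |: Z)) = z |: (w |: (x |: Z)).
  by rewrite (setUCA [set x]) setUCA.
have := rk_setU1 rM z Z; have := rk_setU1 rM z (w |: Z).
have := rk_setU1 rM z (x |: Z); have := rk_setU1 rM z (w |: (x |: Z)).
have := rk_setU2 z x Z; have := rk_setU2 z w Z.
have := rk_setU2 z w (x |: Z); have := rk_setU2 z x (w |: Z).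
have := rk_setU1 rM w (z |: (x |: Z)).
rewrite (setUCA [set x] [set w] Z) (setUCA [set w] [set z] (_ :|: _)).
move: np; rewrite c3 c1 c2 => np *; suff e : r (z |: (x |: Z)) = (r Z).+1.
  suff e' : r (z |: Z) = (r Z).+1 by apply/parP; split; lia.
  apply/eqP; apply: contraT => /eqP ne; case: np; split; lia.
apply/eqP; apply: contraT => /eqP ne; case: np; split; lia.
Qed.

End One.
End Matroid2.

Section Matroid3.
Variable E : finType.
Implicit Types (r s : {set E} -> nat) (A B C D F G K S T U V W X Y Z : {set E}).
Implicit Types (a b e w x y : E).

(** The elements of [F :\: K] are removed one at a time by [conn_del_ctr]; [Z] collects the
    contracted ones. *)
Lemma conn_minor r F K : matroid r -> conn r F -> K \subset F -> K != set0 ->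
  exists2 Z : {set E}, Z \subset F :\: K & conn (ctr r Z) K.
Proof.
elim: {F}#|F| {-2}F (leqnn #|F|) r => [|n IH] F hF r rM cF sKF K0.
  by move: hF K0; rewrite leqn0 cards_eq0 => /eqP F0; move: sKF; rewrite F0 subset0 => ->.
have [FK|] := boolP (F \subset K).
  have -> : K = F by apply/eqP; rewrite eqEsubset sKF.
  by exists set0; rewrite ?sub0set // (conn_ext _ (ctr0 rM)).
case/subsetPn => w wF wK.
have sKw : K \subset F :\ w by rewrite subsetD1 sKF.
have cw : #|F :\ w| <= n by have := cardsD1 w F; rewrite wF; lia.
have F2 : 1 < #|F|.
  by have := cardsD1 w F; rewrite wF; have := subset_leq_card sKw; move: K0; rewrite -card_gt0; lia.
have [c|c] := conn_del_ctr rM cF wF F2.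
  have [Z sZ cZ] := IH _ cw r rM c sKw K0.
  by exists Z => //; apply: subset_trans sZ _; apply/setSD/subsetDl.
have [Z sZ cZ] := IH _ cw _ (ctr_matroid rM [set w]) c sKw K0.
exists (Z :|: [set w]); last by rewrite -(conn_ext _ (ctr_ctr rM _ _)).
by move: sZ wF wK; clear => *; by_subset.
Qed.

Lemma conn2_par r a b : matroid r -> a != b -> conn r [set a; b] -> par r set0 a b.
Proof.
move=> rM ab /connP[nl sep].
have na := nl a; have nb := nl b; rewrite !inE eqxx /= in na.
rewrite !inE eqxx orbT in nb.
have := sep [set a]; rewrite sub1set !inE eqxx /=.
have -> : [set a; b] :\ a = [set b] by by_setP.
have a0 : [set a] != set0 by apply/set0Pn; exists a; rewrite set11.
have an : [set a] != [set a; b].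
  apply/eqP => /setP/(_ b); rewrite !inE eqxx orbT; by rewrite eq_sym (negPf ab).
move=> /(_ isT a0 an).
have := rk1 rM a; have := rk1 rM b; have := na isT; have := nb isT.
have := @rk_mono _ _ rM [set a] [set a; b]; rewrite subsetUl => /(_ isT).
move=> *; apply/parP; rewrite !setU0 rk0 //; split; lia.
Qed.

(** This is [conn_minor] for {a, b}. Parallel pairs of contractions thus serve as witnesses of
    connectivity throughout. *)
Lemma conn_par r F a b : matroid r -> conn r F -> a \in F -> b \in F -> a != b ->
  exists2 Z : {set E}, Z \subset F & par r Z a b.
Proof.
move=> rM cF aF bF ab.
have [||Z sZ cZ] := @conn_minor r F [set a; b] rM cF.
- by apply/subsetP => z; rewrite !inE => /orP[]/eqP->.
- by apply/set0Pn; exists a; rewrite !inE eqxx.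
exists Z; first exact: subset_trans sZ (subsetDl _ _).
by rewrite -[Z]set0U -par_ctr //; apply: conn2_par => //; apply: ctr_matroid.
Qed.

(** A smallest separator of [G] that contains [e] is connected. *)
Lemma component r G e : matroid r -> e \in G -> 0 < r [set e] ->
  exists K : {set E}, [/\ K \subset G, e \in K, conn r K & r K + r (G :\: K) <= r G].
Proof.
move=> rM eG re.
pose P (K : {set E}) := [&& K \subset G, e \in K & r K + r (G :\: K) <= r G].
have PG : P G by rewrite /P subxx eG setDv rk0 // addn0 leqnn.
case: (arg_minnP (fun K : {set E} => #|K|) PG) => K /and3P[sKG eK hK] minK.
exists K; split=> //.
have sep A : A \subset K -> A != K -> e \in A -> r K < r A + r (K :\: A).
  move=> sAK nAK eA; rewrite ltnNge; apply: contraNN nAK => hA.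
  rewrite eqEcard sAK minK // /P eA (subset_trans sAK sKG) /=.
  have : r (G :\: A) <= r (K :\: A) + r (G :\: K).
    apply: leq_trans (rk_subadd rM _ _).
    by apply: rk_mono => //; by_subset.
  lia.
have sep2 A : A \subset K -> A != set0 -> A != K -> r K < r A + r (K :\: A).
  move=> sAK A0 nAK; have [eA|eA] := boolP (e \in A); first exact: sep.
  have eKA : K :\: (K :\: A) = A by rewrite setDDr setDv set0U; apply/setIidPr.
  rewrite addnC -{2}eKA; apply: sep; rewrite ?subsetDl ?inE ?eA //.
  by apply: contra_neq A0 => h; rewrite -eKA h setDv.
apply/connP; split => [f fK|]; last exact: sep2.
have [->//|fe] := eqVneq f e.
have := sep2 [set f]; rewrite sub1set fK => /(_ isT).
have f0 : [set f] != set0 by apply/set0Pn; exists f; rewrite set11.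
have fK' : [set f] != K by apply: contraTneq eK => <-; rewrite inE eq_sym.
move=> /(_ f0 fK'); have := @rk_mono _ _ rM (K :\ f) K (subsetDl _ _); lia.
Qed.

(** * Labellings by blocks and crossing parallel pairs *)

Section Blocks.
Variables (T : eqType) (blk : E -> T).

(** A pair is crossing when its labels differ; [mixed] sets are those that contain a crossing
    pair. *)
Definition mixed F := exists e x, [/\ e \in F, x \in F & blk e != blk x].

Lemma mixed_partner F e : mixed F -> e \in F -> exists2 x, x \in F & blk e != blk x.
Proof.
move=> [a [b [aF bF ab]]] eF; have [ea|] := eqVneq (blk e) (blk a); last by exists a.
by exists b; rewrite // ea.
Qed.

Lemma neq_blk e x : blk e != blk x -> e != x.
Proof. by apply: contra_neq => ->. Qed.

(** A crossing pair is parallel in some contraction of [r], hence of [s], so no separator of [s]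
    splits it. Elements on different sides of a separator would then all have equal labels, which
    leaves only one block. *)
Lemma conn_transfer r s F : matroid r -> matroid s -> mixed F -> conn r F ->
  (forall Z e x, Z \subset F -> e \in F -> x \in F -> blk e != blk x ->
     par r Z e x -> par s Z e x) -> conn s F.
Proof.
move=> rM sM mF cF h; apply/connP; split => [e eF|A sAF A0 AF].
  have [x xF ex] := mixed_partner mF eF.
  have [Z sZ p] := conn_par rM cF eF xF (neq_blk ex).
  by apply: (par_nonloop sM (h Z e x sZ eF xF ex p)).
rewrite ltnNge; apply/negP => hA.
have mono a b : a \in A -> b \in F :\: A -> blk a = blk b.
  rewrite inE => aA /andP[bA bF]; apply/eqP; apply: contraT => ab.
  have aF := subsetP sAF a aA.
  have [Z sZ p] := conn_par rM cF aF bF (neq_blk ab).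
  by have := h Z a b sZ aF bF ab p; rewrite (sep_par sM sAF hA).
have [a aA] := set0Pn _ A0.
have [b bFA] : exists b, b \in F :\: A.
  by apply/set0Pn; rewrite setD_eq0; apply: contra AF => sFA; rewrite eqEsubset sAF.
have [c [d [cFF dFF /eqP[]]]] := mF.
have all z : z \in F -> blk z = blk a.
  move=> zF; have [zA|zA] := boolP (z \in A).
    by rewrite (mono z b) // (mono a b).
  by rewrite (mono a z) // inE zA.
by rewrite (all c) // (all d).
Qed.

Lemma mixed_del2 K : mixed K -> 2 < #|K| ->
  exists w1 w2, [/\ w1 \in K, w2 \in K, w1 != w2, mixed (K :\ w1) & mixed (K :\ w2)].
Proof.
move=> [e [x [eK xK ex]]] K3.
have nex := neq_blk ex.
have [z zK] : exists z, z \in K :\ e :\ x.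
  apply/card_gt0P; have := cardsD1 e K; have := cardsD1 x (K :\ e).
  by rewrite !inE eK xK eq_sym nex /=; lia.
move: zK; rewrite !inE => /and3P[zx ze zK].
have mz : mixed (K :\ z).
  by exists e, x; rewrite !inE eK xK ex eq_sym ze eq_sym zx.
have [be|be] := eqVneq (blk z) (blk e).
  exists z, e; split => //; exists z, x; rewrite !inE zK xK be ex ze.
  by rewrite eq_sym nex.
by exists z, x; split => //; exists z, e; rewrite !inE zK eK zx nex be.
Qed.

(* If every [w] whose removal keeps [K] mixed is such that deleting (contracting) it keeps [r] connected, then in [s] it makes [y] a coloop (a loop) without creating coloops (loops) in [K :\ w]; two such [w] are incompatible. *)
Lemma conn_separates1 r s K y : matroid r -> matroid s -> mixed K -> conn r K ->
  (forall S e x, S \subset K -> e \in K -> x \in K -> blk e != blk x ->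
     par r S e x -> par s S e x && par s (y |: S) e x) ->
  0 < s [set y] -> s (y |: K) = (s K).+1.
Proof.
elim: {K}#|K| {-2}K (leqnn #|K|) r s => [|n IH] K hK r s rM sM mK cK h sy.
  by move: hK mK; rewrite leqn0 cards_eq0 => /eqP-> [e [x []]]; rewrite inE.
have sy1 : s [set y] = 1 by have := rk1 sM y; lia.
apply/eqP; apply: contraT => /eqP ne.
have {ne}yK : s (y |: K) = s K by have := rk_setU1 sM y K; lia.
have [K2|K3] := leqP #|K| 2.
  have [e [x [eK xK ex]]] := mK; have nex := neq_blk ex.
  have eKex : K = [set e; x].
    apply/eqP; rewrite eq_sym eqEcard cards2 nex K2 andbT.
    by apply/subsetP => z; rewrite !inE => /orP[]/eqP->.
  have p : par r set0 e x by apply: conn2_par => //; rewrite -eKex.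
  have /andP[p1 p2] := h set0 e x (sub0set _) eK xK ex p.
  move: p1 p2 => /parP[] _ _ + /parP[] _ _.
  rewrite rk0 // !setU0 sy1 => h1 h2.
  have e1 : e |: (x |: [set y]) = y |: K by rewrite eKex; clear; by_setP.
  have e2 : e |: [set x] = K by rewrite eKex.
  by move: yK; rewrite -e1 h2 -e2 h1.
have nl w : w \in K -> s [set w] = 1.
  move=> wK; have [x xK wx] := mixed_partner mK wK.
  have [Z sZ p] := conn_par rM cK wK xK (neq_blk wx).
  have /andP[q _] := h Z w x sZ wK xK wx p.
  by have := par_nonloop sM q; have := rk1 sM w; clear; lia.
have claim w : w \in K -> mixed (K :\ w) ->
    (s (y |: [set w]) = 1 /\ forall v, v \in K :\ w -> s (v |: [set w]) = 2) \/
    (s (y |: (K :\ w)) = (s (K :\ w)).+1 /\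
     forall v, v \in K :\ w -> s (K :\ w :\ v) = s (K :\ w)).
  move=> wK mw.
  have cw : #|K :\ w| <= n by have := cardsD1 w K; rewrite wK; lia.
  have sKw : K :\ w \subset K := subsetDl _ _.
  have eKw : K :\ w :|: [set w] = K by rewrite setUC setD1K.
  have [c|c] := conn_del_ctr rM cK wK (ltnW K3).
    right; split.
      apply: (IH _ cw r s) => // S e x sS eK xK; apply: h.
      - exact: subset_trans sKw.
      - exact: (subsetP sKw).
      - exact: (subsetP sKw).
    move=> v vK; have [x xK vx] := mixed_partner mw vK.
    have [Z sZ p] := conn_par rM c vK xK (neq_blk vx).
    have /andP[/parP[q1 q2 q3] _] :=
      h Z v x (subset_trans sZ sKw) (subsetP sKw v vK) (subsetP sKw x xK) vx p.
    have /andP[vZ _] := par_notin p.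
    have e1 : v |: (K :\ w :\ v) = K :\ w by rewrite setD1K.
    rewrite -[in RHS]e1; apply/esym.
    apply: (cl_mono sM (X := x |: Z)); last by rewrite q3 q2.
    apply/subsetP => z; rewrite !inE => /orP[/eqP->|zZ].
      by move: xK; rewrite !inE => /andP[-> ->]; rewrite eq_sym (neq_blk vx).
    have := subsetP sZ z zZ; rewrite !inE => /andP[-> ->]; rewrite !andbT.
    by apply: contraNneq vZ => <-.
  have sw := nl w wK.
  left; split.
    apply/eqP; apply: contraT => /eqP ne.
    have hy := rk_setU1 sM y [set w]; rewrite sw in hy.
    have hs := ctrE sM [set w] (y |: (K :\ w)); have hs' := ctrE sM [set w] (K :\ w).
    rewrite -setUA eKw yK sw in hs; rewrite eKw sw in hs'.
    have : ctr s [set w] (y |: (K :\ w)) = (ctr s [set w] (K :\ w)).+1.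
      apply: (IH _ cw (ctr r [set w]) _ (ctr_matroid rM _) (ctr_matroid sM _) mw c).
        move=> S e x sS eK xK ex; rewrite !par_ctr // -setUA; apply: h => //.
        - by rewrite -eKw setSU.
        - exact: (subsetP sKw).
        - exact: (subsetP sKw).
      by rewrite /ctr sw; move: hy ne; clear; lia.
    by move: hs hs'; clear; lia.
  move=> v vK; have [x xK vx] := mixed_partner mw vK.
  have [Z sZ] := conn_par (ctr_matroid rM _) c vK xK (neq_blk vx).
  rewrite par_ctr // => p.
  have sZK : Z :|: [set w] \subset K by rewrite -eKw setSU.
  have /andP[/parP[q1 _ _] _] := h _ v x sZK (subsetP sKw v vK) (subsetP sKw x xK) vx p.
  have : s (v |: (Z :|: [set w])) + s [set w] <= s (v |: [set w]) + s (Z :|: [set w]).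
    by apply: (rk_submod_le sM); clear; by_subset.
  by have := rk_setU1 sM v [set w]; rewrite q1 sw; clear; lia.
have [w1 [w2 [w1K w2K w12 m1 m2]]] := mixed_del2 mK K3.
have i12 : w2 \in K :\ w1 by rewrite !inE w2K eq_sym w12.
have i21 : w1 \in K :\ w2 by rewrite !inE w1K w12.
have noConDel w v : s (y |: [set w]) = 1 -> s [set w] = 1 -> w \in K :\ v ->
    s (y |: (K :\ v)) = (s (K :\ v)).+1 -> False.
  move=> q1 q2 q3 q4; have : s (y |: (K :\ v)) = s (K :\ v); last by lia.
  by apply: (cl_mono sM (X := [set w])); rewrite ?sub1set // q1 q2.
(* Contracting both makes [y] parallel to [w1] and [w2], hence these to each other. In the mixed
   cases [y] is spanned by one of them but not by a set that contains it. Deleting both, [K :\ w2]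
   spans [K] and so [y], but [y] is outside its closure. *)
case: (claim w1 w1K m1) (claim w2 w2K m2) => -[p1 q1] [[p2 q2]|[p2 q2]].
- have := q1 w2 i12.
  have : s (w2 |: [set w1]) + s [set y] <= s (y |: [set w1]) + s (y |: [set w2]).
    by apply: (rk_submod_le sM); clear; by_subset.
  by rewrite p1 p2 sy1; clear; lia.
- by have := noConDel w1 w2 p1 (nl _ w1K) i21 p2.
- by have := noConDel w2 w1 p2 (nl _ w2K) i12 p1.
- have e1 : w2 |: (K :\ w1 :\ w2) = K :\ w1 by rewrite setD1K.
  have e2 : s (w2 |: (K :\ w2)) = s (K :\ w2).
    apply: (cl_mono sM (X := K :\ w1 :\ w2)); first by by_subset.
    by rewrite e1 q1.
  have := rk_mono sM (X := y |: (K :\ w2)) (Y := y |: K); rewrite setUS ?subsetDl //.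
  by move/(_ isT); rewrite setD1K // in e2; lia.
Qed.

End Blocks.
End Matroid3.

Section Matroid4.
Variable E : finType.
Implicit Types (r s : {set E} -> nat) (A B C D F G K R S U V W X Y Z : {set E}).
Implicit Types (a b e w x y : E).

Section Blocks.
Variables (T : eqType) (blk : E -> T).

(** The elements outside [K] are added one by one to [R]. By [conn_separates1] in the contraction of
    [s] by [R], an element that is not spanned by [R] is not spanned by [K :|: R] either. *)
Lemma conn_separates r s G K : matroid r -> matroid s -> K \subset G ->
  mixed blk K -> conn r K ->
  (forall S R e x, S \subset K -> R \subset G :\: K -> e \in K -> x \in K ->
     blk e != blk x -> par r S e x -> par s (S :|: R) e x) ->
  s K + s (G :\: K) <= s G.
Proof.
move=> rM sM sKG mK cK h.
suff H R : R \subset G :\: K -> s K + s R <= s (K :|: R).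
  have eG : K :|: (G :\: K) = G by move: sKG; clear => *; by_setP.
  by rewrite -[in s G]eG; apply: H.
elim/set_ind: R => [_|y R yR IH]; first by rewrite setU0 rk0 ?addn0.
rewrite subUset sub1set => /andP[yG sR].
have {IH}IH := IH sR.
have [e|ne] := eqVneq (s (y |: R)) (s R).
  rewrite e; apply: (leq_trans IH); apply: rk_mono => //.
  by rewrite setUS ?subsetUr.
have ey : s (y |: R) = (s R).+1 by have := rk_setU1 sM y R; move: ne; clear; lia.
have := conn_separates1 (y := y) rM (ctr_matroid sM R) mK cK _ _.
have c1 := ctrE sM R (y |: K); have c2 := ctrE sM R K; have c3 := ctrE sM R [set y].
have -> : K :|: (y |: R) = (y |: K) :|: R by rewrite -setUA (setUCA K).
move=> q; have {q} : ctr s R (y |: K) = (ctr s R K).+1.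
  apply: q; last by move: c3; rewrite ey; clear; lia.
  move=> S e x sS eK xK ex p; rewrite !par_ctr //; apply/andP; split.
    exact: h.
  rewrite -setUA setUCA; apply: h => //; by rewrite subUset sub1set yG.
by move: c1 c2 IH; rewrite ey; clear; lia.
Qed.

(* By [conn_separates], a component of [q] containing a crossing pair is a separator of [s]. *)
Lemma conn_or_split s p q G : matroid s -> matroid p -> matroid q ->
  mixed blk G -> conn p G ->
  (forall Z e x, Z \subset G -> e \in G -> x \in G -> blk e != blk x ->
     par s Z e x = par p Z e x + par q Z e x :> nat) ->
  conn q G \/
  (forall Z e x, Z \subset G -> e \in G -> x \in G -> blk e != blk x ->
     par q Z e x = false).
Proof.
move=> sM pM qM mG cp h.
have cs : conn s G.
  apply: conn_transfer pM sM mG cp _ => Z e x sZ eG xG ex pp.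
  by have := h Z e x sZ eG xG ex; rewrite pp; case: par.
have [cq|ncq] := boolP (conn q G); [by left | right] => Z e x sZ eG xG ex.
apply: contraNF ncq => pq.
have [K [sKG eK cK hK]] := component qM eG (par_nonloop qM pq).
have xK : x \in K.
  by apply: contraTT pq => xK; rewrite (sep_par qM sKG hK sZ eK xG xK).
suff : s K + s (G :\: K) <= s G.
  by case/(conn_sep cs sKG) => eqK; [move: eK; rewrite eqK inE | rewrite -eqK].
apply: (conn_separates qM sM sKG _ cK); first by exists e, x.
move=> S R f z sS sR fK zK fz pq'.
have sSR : S :|: R \subset G.
  by rewrite subUset (subset_trans sS) // (subset_trans sR) // subsetDl.
have fG := subsetP sKG f fK; have zG := subsetP sKG z zK.
suff pq2 : par q (S :|: R) f z.
  by have := h _ f z sSR fG zG fz; rewrite pq2; case: par; case: par.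
have sp X : X \subset G -> q X = q (X :&: K) + q (X :\: K).
  exact: (sep_split qM sKG hK).
have e1 A : A \subset K -> q (A :|: R) = q A + q R.
  move=> sA; rewrite sp; last first.
    by rewrite subUset (subset_trans sA) // (subset_trans sR) // subsetDl.
  by congr (q _ + q _); move: sA sR; clear => *; by_setP.
have fs : f |: S \subset K by rewrite subUset sub1set fK.
have zs : z |: S \subset K by rewrite subUset sub1set zK.
have fzs : f |: (z |: S) \subset K by rewrite subUset sub1set fK.
have := e1 _ fzs; have := e1 _ zs; have := e1 _ fs; have := e1 _ sS.
rewrite -!setUA => f1 f2 f3 f4; case/parP: pq' => h1 h2 h3.
by apply/parP; rewrite f1 f2 f3 f4 h1 h2 h3 !addSn.
Qed.

Definition blocks3 F := exists a b c,
  [/\ a \in F, b \in F & c \in F] /\ [/\ blk a != blk b, blk a != blk c & blk b != blk c].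

Lemma blocks3_mixed F : blocks3 F -> mixed blk F.
Proof. by move=> [a [b [c [[aF bF _] [ab _ _]]]]]; exists a, b. Qed.

Lemma blocks3_third F e x : blocks3 F -> exists2 z, z \in F & (blk z != blk e) && (blk z != blk x).
Proof.
move=> [a [b [c [[aF bF cF] [/eqP ab /eqP ac /eqP bc]]]]].
have [|/nandP na] := boolP ((blk a != blk e) && (blk a != blk x)); first by exists a.
have [|/nandP nb] := boolP ((blk b != blk e) && (blk b != blk x)); first by exists b.
exists c => //; apply/andP; split; apply/eqP => ce;
  case: na nb => /negPn/eqP ? [] /negPn/eqP ?; congruence.
Qed.

End Blocks.
End Matroid4.

(** * Two connected matroids whose sum is matroidal on crossing pairs *)

Section Matroid5.
Variable E : finType.
Implicit Types (r s p q : {set E} -> nat) (A B C D F G K R S U V W X Y Z : {set E}).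
Implicit Types (a b e w x y : E).

Section Blocks.
Variables (T : eqType) (blk : E -> T).

(** Among crossing pairs that avoid [w], those of [q] need [w] contracted and those of [p] need [w]
    not contracted. *)
Definition excl p q F w := forall Z e x, Z \subset F :\ w -> e \in F :\ w ->
  x \in F :\ w -> blk e != blk x -> ~~ par q Z e x /\ ~~ par p (w |: Z) e x.

(** Take [z] in a third block and make [x], [z] parallel in [q]. This needs [w] contracted;
    exchanging [w] and [x] gives a crossing pair [w], [z] of [q] with [x] contracted, which the
    exclusivity of [x] forbids. *)
Lemma excl_mixed p q F w x : matroid q -> conn q F -> blocks3 blk F ->
  w \in F -> x \in F -> blk w != blk x -> excl p q F w -> excl q p F x -> False.
Proof.
move=> qM cq F3 wF xF wx hw hx.
have [z zF /andP[zw zx]] := blocks3_third w x F3.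
have [[nwx nzw] nzx] := (neq_blk wx, neq_blk zw, neq_blk zx).
have [Z sZ pxz] : exists2 Z : {set E}, Z \subset F & par q Z x z.
  by apply: (conn_par qM cq xF zF); rewrite eq_sym.
have /andP[xZ zZ] := par_notin pxz.
have sZw : Z :\ w \subset F :\ w by apply: setSD.
have iw y : y \in F -> y != w -> y \in F :\ w by move=> yF yw; rewrite !inE yw.
have [np _] : ~~ par q (Z :\ w) x z /\ ~~ par p (w |: (Z :\ w)) x z.
  by apply: hw => //; [apply: iw; rewrite // eq_sym | apply: iw | rewrite eq_sym].
have wZ : w \in Z.
  by apply: contraNT np => wZ; rewrite (_ : Z :\ w = Z) //; apply/setDidPl; rewrite disjoint_sym disjoints1.
have pw : par q (x |: (Z :\ w)) w z.
  by apply: par_exchange => //; rewrite setD1K.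
have [_] : ~~ par p (Z :\ w) w z /\ ~~ par q (x |: (Z :\ w)) w z.
  apply: hx; rewrite ?inE ?wF ?zF ?nwx ?nzx //; last by rewrite eq_sym.
  apply/subsetP => y; rewrite !inE => /andP[yw yZ]; rewrite (subsetP sZ) // andbT.
  by apply: contraNneq xZ => <-.
by rewrite pw.
Qed.

(** Take a smallest [Z] for [p] and a largest one for [q]. An element [z] that obstructs the claim
    is, by [par_exchange] or [par_contract_lost], parallel to both [w] and [x] in a suitable
    contraction, and one of these two pairs is crossing and forbidden. If [z] is in the block of
    [x], it is the pair with [w]; this case is excluded when [x] is alone in its block. *)
Lemma excl_par p q F w x : matroid p -> matroid q -> conn p F -> conn q F ->
  w \in F -> x \in F -> blk w != blk x -> excl p q F w ->
  excl p q F x \/ (forall z, z \in F -> blk z = blk x -> z = x) ->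
  par p set0 w x /\ par q (F :\ w :\ x) w x.
Proof.
move=> pM qM cp cq wF xF wx hw hx; have nwx := neq_blk wx.
split.
- have [Z0 sZ0 p0] := conn_par pM cp wF xF nwx.
  pose P (Z : {set E}) := (Z \subset F) && par p Z w x.
  have PZ0 : P Z0 by rewrite /P sZ0.
  case: (arg_minnP (fun Z : {set E} => #|Z|) PZ0) => Z /andP[sZ pZ] minZ.
  have [<-//|[z zZ]] := set_0Vmem Z.
  have /andP[wZ xZ] := par_notin pZ.
  have zF := subsetP sZ z zZ.
  have [zw zx] : z != w /\ z != x by split; apply: contraTneq zZ => ->.
  have np : ~~ par p (Z :\ z) w x.
    apply/negP => pz; have := minZ (Z :\ z).
    rewrite /P pz (subset_trans (subsetDl _ _) sZ) => /(_ isT).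
    by have := cardsD1 z Z; rewrite zZ; clear; lia.
  have p1 : par p (w |: (Z :\ z)) z x by apply: par_exchange => //; rewrite setD1K.
  have p2 : par p (x |: (Z :\ z)) z w.
    by apply: par_exchange => //; rewrite ?setD1K // parC.
  have sub y : y \notin Z -> Z :\ z \subset F :\ y.
    move=> yZ; apply/subsetP => t; rewrite !inE => /andP[_ tZ].
    by rewrite (subsetP sZ) // andbT; apply: contraNneq yZ => <-.
  have [bzx|bzx] := eqVneq (blk z) (blk x).
    case: hx => [hx|/(_ z zF bzx) ezx]; last by rewrite ezx eqxx in zx.
    suff [_] : ~~ par q (Z :\ z) z w /\ ~~ par p (x |: (Z :\ z)) z w by rewrite p2.
    by apply: hx; rewrite ?inE ?zx ?nwx ?zF ?wF ?sub // bzx eq_sym.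
  suff [_] : ~~ par q (Z :\ z) z x /\ ~~ par p (w |: (Z :\ z)) z x by rewrite p1.
  by apply: hw; rewrite ?inE ?zw ?xF ?zF ?(eq_sym x) ?nwx ?sub //.
- have [Z0 sZ0 p0] := conn_par qM cq wF xF nwx.
  pose P (Z : {set E}) := (Z \subset F) && par q Z w x.
  have PZ0 : P Z0 by rewrite /P sZ0.
  case: (arg_maxnP (fun Z : {set E} => #|Z|) PZ0) => Z /andP[sZ pZ] maxZ.
  have /andP[wZ xZ] := par_notin pZ.
  have sub y : y \notin Z -> Z \subset F :\ y.
    by move=> yZ; rewrite subsetD1 sZ.
  have [<-//|] := eqVneq Z (F :\ w :\ x).
  rewrite eqEsubset !subsetD1 sZ wZ xZ /= => /subsetPn[z].
  rewrite !inE => /and3P[zx zw zF] zZ.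
  have np : ~~ par q (z |: Z) w x.
    apply/negP => pz; have := maxZ (z |: Z).
    rewrite /P pz subUset sub1set zF sZ => /(_ isT).
    by rewrite cardsU1 zZ; clear; lia.
  have p1 : par q Z z x by apply: (par_contract_lost qM (w := w)).
  have p2 : par q Z z w by apply: (par_contract_lost qM (w := x)); rewrite // parC.
  have [bzx|bzx] := eqVneq (blk z) (blk x).
    case: hx => [hx|/(_ z zF bzx) ezx]; last by rewrite ezx eqxx in zx.
    suff [] : ~~ par q Z z w /\ ~~ par p (x |: Z) z w by rewrite p2.
    by apply: hx; rewrite ?inE ?zx ?nwx ?zF ?wF ?sub // bzx eq_sym.
  suff [] : ~~ par q Z z x /\ ~~ par p (w |: Z) z x by rewrite p1.
  by apply: hw; rewrite ?inE ?zw ?xF ?zF ?(eq_sym x) ?nwx ?sub //.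
Qed.

(* Deleting or contracting a removable [w], [conn_or_split] and induction leave only the possibility that [w] is exclusive to [p] or to [q]; then a crossing pair [w], [x] is parallel both at [set0] and at [F :\ w :\ x], so it is a separator. *)
Lemma no_three_blocks F s p q : matroid s -> matroid p -> matroid q ->
  blocks3 blk F -> conn p F -> conn q F ->
  (forall Z e x, Z \subset F -> e \in F -> x \in F -> blk e != blk x ->
     par s Z e x = par p Z e x + par q Z e x :> nat) -> False.
Proof.
elim: {F}#|F| {-2}F (leqnn #|F|) s p q => [|n IH] F hF s p q sM pM qM F3 cp cq h.
  by move: hF F3; rewrite leqn0 cards_eq0 => /eqP-> [a [b [c [[]]]]]; rewrite inE.
have mF := blocks3_mixed F3.
have cs : conn s F.
  apply: conn_transfer pM sM mF cp _ => Z e x sZ eF xF ex pp.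
  by have := h Z e x sZ eF xF ex; rewrite pp; case: par.
have done_ w x : w \in F -> x \in F -> blk w != blk x ->
    par s set0 w x -> par s (F :\ w :\ x) w x -> False.
  move=> wF xF wx p0 p1; have nwx := neq_blk wx.
  have sub : [set w; x] \subset F by rewrite subUset !sub1set wF.
  have [z zF /andP[zw zx]] := blocks3_third w x F3.
  case: (conn_sep cs sub) => [|/setP/(_ w)|/setP/(_ z)].
  - case/parP: p0 => _ _; rewrite !setU0 rk0 // => ->.
    case/parP: p1 => _ _.
    have -> : w |: (x |: (F :\ w :\ x)) = F.
      by rewrite setD1K ?setD1K // !inE xF eq_sym nwx.
    by rewrite setDDl => ->; rewrite add1n.
  - by rewrite !inE eqxx.
  - by rewrite zF !inE (negPf (neq_blk zw)) (negPf (neq_blk zx)).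
have par_s1 Z e x : Z \subset F -> e \in F -> x \in F -> blk e != blk x ->
    par p Z e x -> par s Z e x.
  by move=> sZ eF xF ex pp; have := h Z e x sZ eF xF ex; rewrite pp; case: par.
have par_s2 Z e x : Z \subset F -> e \in F -> x \in F -> blk e != blk x ->
    par q Z e x -> par s Z e x.
  by move=> sZ eF xF ex pp; have := h Z e x sZ eF xF ex; rewrite pp addnC; case: par.
have nexcl w : w \in F -> blocks3 blk (F :\ w) -> excl p q F w \/ excl q p F w.
  move=> wF F3w.
  have cw : #|F :\ w| <= n by have := cardsD1 w F; rewrite wF; move: hF; clear; lia.
  have mw := blocks3_mixed F3w.
  have F2 : 1 < #|F|.
    have [a [b [aF bF ab]]] := mF.
    have := subset_leq_card (_ : [set a; b] \subset F).
    by rewrite cards2 (neq_blk ab) subUset !sub1set aF bF => /(_ isT).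
  have sw : F :\ w \subset F := subsetDl _ _.
  have hd Z e x : Z \subset F :\ w -> e \in F :\ w -> x \in F :\ w -> blk e != blk x ->
      par s Z e x = par p Z e x + par q Z e x :> nat.
    by move=> sZ /(subsetP sw) eF /(subsetP sw) xF; apply: h => //; apply: subset_trans sw.
  have sZw Z : Z \subset F :\ w -> Z :|: [set w] \subset F.
    by move=> sZ; rewrite subUset sub1set wF (subset_trans sZ sw).
  have hc Z e x : Z \subset F :\ w -> e \in F :\ w -> x \in F :\ w -> blk e != blk x ->
      par (ctr s [set w]) Z e x = par (ctr p [set w]) Z e x + par (ctr q [set w]) Z e x :> nat.
    move=> sZ /(subsetP sw) eF /(subsetP sw) xF; rewrite !par_ctr //.
    by apply: h => //; apply: sZw.
  have [[sC pC] qC] := (ctr_matroid sM [set w], ctr_matroid pM [set w], ctr_matroid qM [set w]).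
  have swap u v t (H : forall Z e x, Z \subset F :\ w -> e \in F :\ w -> x \in F :\ w -> blk e != blk x ->
      par u Z e x = par v Z e x + par t Z e x :> nat) Z e x : Z \subset F :\ w -> e \in F :\ w ->
      x \in F :\ w -> blk e != blk x -> par u Z e x = par t Z e x + par v Z e x :> nat.
    by move=> *; rewrite addnC; apply: H.
  have nd v t : matroid v -> matroid t -> forall u, matroid u -> conn v (F :\ w) ->
      (forall Z e x, Z \subset F :\ w -> e \in F :\ w -> x \in F :\ w -> blk e != blk x ->
        par u Z e x = par v Z e x + par t Z e x :> nat) ->
      (forall Z e x, Z \subset F :\ w -> e \in F :\ w -> x \in F :\ w -> blk e != blk x ->
        par t Z e x = false).
    move=> vM tM u uM cv H; case: (conn_or_split uM vM tM mw cv H) => // ct.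
    by case: (IH _ cw u v t).
  have ncon t : matroid t -> (forall Z e x, Z \subset F :\ w -> e \in F :\ w ->
      x \in F :\ w -> blk e != blk x -> par t Z e x = false) -> conn t (F :\ w) -> False.
    move=> tM H ct; have [a [b [aF bF ab]]] := mw.
    by have [Z sZ] := conn_par tM ct aF bF (neq_blk ab); rewrite H.
  have fin v t : (forall Z e x, Z \subset F :\ w -> e \in F :\ w ->
      x \in F :\ w -> blk e != blk x -> par t Z e x = false) -> matroid v ->
      (forall Z e x, Z \subset F :\ w -> e \in F :\ w ->
      x \in F :\ w -> blk e != blk x -> par (ctr v [set w]) Z e x = false) -> excl v t F w.
    move=> H1 vM H2 Z e x sZ eF xF ex; split; first by rewrite H1.
    by rewrite setUC -par_ctr // H2.
  (* If [p] stays connected after deleting [w], then [q] has no crossing pair there and is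
     disconnected, so [q] stays connected after contracting [w], which in turn leaves [p] without
     crossing pairs there. The other case swaps deletion and contraction. *)
  have [c|c] := conn_del_ctr pM cp wF F2.
    have H1 := nd _ _ pM qM _ sM c hd.
    have [/(ncon _ qM H1)//|c'] := conn_del_ctr qM cq wF F2.
    by left; apply: fin => //; apply: (nd _ _ qC pC _ sC c'); apply: swap.
  have H1 := nd _ _ pC qC _ sC c hc.
  have [c'|/(ncon _ qC H1)//] := conn_del_ctr qM cq wF F2.
  by right; apply: fin => //; apply: (nd _ _ qM pM _ sM c'); apply: swap.
have alone x : x \in F -> ~ blocks3 blk (F :\ x) -> forall z, z \in F -> blk z = blk x -> z = x.
  move=> xF nx z zF bzx; apply/eqP; apply: contraT => zx; case: nx.
  have rep a : a \in F -> exists2 a', a' \in F :\ x & blk a' = blk a.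
    move=> aF; have [->|ax] := eqVneq a x; last by exists a; rewrite // !inE ax.
    by exists z; rewrite // !inE zx.
  have [a [b [c [[aF bF cF] ne]]]] := F3.
  have [[[a' ? ea] [b' ? eb]] [c' ? ec]] := (rep a aF, rep b bF, rep c cF).
  by exists a', b', c'; rewrite ea eb ec.
have b3dec K : blocks3 blk K \/ ~ blocks3 blk K.
  pose P := [exists a in K, exists b in K, exists c in K,
    [&& blk a != blk b, blk a != blk c & blk b != blk c]].
  have [/exists_inP[a aK /exists_inP[b bK /exists_inP[c cK /and3P[*]]]]|nP] := boolP P.
    by left; exists a, b, c.
  right=> -[a [b [c [[aK bK cK] [ab ac bc]]]]]; case/negP: nP.
  apply/exists_inP; exists a => //; apply/exists_inP; exists b => //.
  by apply/exists_inP; exists c => //; rewrite ab ac.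
have main p' q' w : matroid p' -> matroid q' -> conn p' F -> conn q' F ->
    (forall Z e x, Z \subset F -> e \in F -> x \in F -> blk e != blk x ->
      par p' Z e x -> par s Z e x) ->
    (forall Z e x, Z \subset F -> e \in F -> x \in F -> blk e != blk x ->
      par q' Z e x -> par s Z e x) ->
    (forall x, x \in F -> blocks3 blk (F :\ x) -> excl p' q' F x \/ excl q' p' F x) ->
    w \in F -> excl p' q' F w -> False.
  move=> p'M q'M cp' cq' s1 s2 ex wF hw; have [x xF wx] := mixed_partner mF wF.
  have sF : F :\ w :\ x \subset F by rewrite setDDl subsetDl.
  have hx : excl p' q' F x \/ (forall z, z \in F -> blk z = blk x -> z = x).
    have [b3|nb3] := b3dec (F :\ x); last by right; apply: alone.
    by case: (ex x xF b3) => // hx; [left | case: (excl_mixed q'M cq' F3 wF xF wx hw hx)].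
  have [p0 p1] := excl_par p'M q'M cp' cq' wF xF wx hw hx.
  by apply: (done_ w x) => //; [apply: s1; rewrite ?sub0set | apply: s2].
(* An element that shares its block, or any fourth element, can be removed without losing the three
   blocks; otherwise [F] has exactly three elements. *)
have [/existsP[w /andP[wF /existsP[w' /andP[w'F /andP[ww' bw]]]]]|/existsPn nd] :=
    boolP [exists w, (w \in F) && [exists w', (w' \in F) && ((w != w') && (blk w == blk w'))]].
  have b3 : blocks3 blk (F :\ w).
    have [//|nb3] := b3dec (F :\ w).
    by have := alone w wF nb3 w' w'F (esym (eqP bw)); move/eqP; rewrite eq_sym (negPf ww').
  case: (nexcl w wF b3) => hw; first exact: (main p q w).
  by apply: (main q p w) => // x xF b3x; case: (nexcl x xF b3x); [right | left].
have inj x z : x \in F -> z \in F -> blk x = blk z -> x = z.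
  move=> xF zF xz; apply/eqP; apply: contraT => ne; case/negP: (nd x).
  by rewrite xF; apply/existsP; exists z; rewrite zF ne xz eqxx.
have [a [b [c [[aF bF cF] [ab ac bc]]]]] := F3.
have [/existsP[d /andP[dF /and3P[da db dc]]]|/existsPn nod] :=
    boolP [exists d, (d \in F) && [&& d != a, d != b & d != c]].
  have b3 : blocks3 blk (F :\ d).
    by exists a, b, c; rewrite !inE aF bF cF !(eq_sym _ d) da db dc.
  case: (nexcl d dF b3) => hd; first exact: (main p q d).
  by apply: (main q p d) => // x xF b3x; case: (nexcl x xF b3x); [right | left].
have FE z : z \in F -> [|| z == a, z == b | z == c].
  by move=> zF; have := nod z; rewrite zF /= -!negb_or negbK.
(* Now [F] is {a, b, c}, and [F :\ a :\ b] is {c}. Since [s] is a single matroid, [p] and [q] must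
   use different ones of the two sets. *)
have Zabc r Z : par r Z a b -> Z \subset F -> Z = set0 \/ Z = F :\ a :\ b.
  move=> pr sZ; have /andP[aZ bZ] := par_notin pr.
  have [nac nbc] := (neq_blk ac, neq_blk bc).
  have memZ z : z \in Z -> z = c.
    move=> zZ; have := FE z (subsetP sZ z zZ); case/or3P => /eqP e //.
      by rewrite -e zZ in aZ.
    by rewrite -e zZ in bZ.
  have [->|[z zZ]] := set_0Vmem Z; [by left | right].
  have cZ : c \in Z by rewrite -(memZ z zZ).
  apply/setP => t; rewrite !inE; apply/idP/idP => [/memZ->|/and3P[tb ta tF]].
    by rewrite cF !(eq_sym c) nac nbc.
  by have := FE t tF; rewrite (negPf ta) (negPf tb) /= => /eqP->.
have [Z1 s1 p1] := conn_par pM cp aF bF (neq_blk ab).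
have [Z2 s2 p2] := conn_par qM cq aF bF (neq_blk ab).
have ne : Z1 <> Z2.
  by move=> e; have := h Z1 a b s1 aF bF ab; rewrite p1 e p2; case: par.
case: (Zabc _ _ p1 s1) (Zabc _ _ p2 s2) => e1 [] e2; rewrite ?e1 ?e2 in p1 p2 s1 s2 ne => //.
- by apply: (done_ a b) => //; [apply: par_s1 | apply: par_s2].
- by apply: (done_ a b) => //; [apply: par_s2 | apply: par_s1].
Qed.

End Blocks.
End Matroid5.

(** * Crossing pairs determine a connected matroid *)

Section Matroid6.
Variable E : finType.
Implicit Types (r s p q B C : {set E} -> nat) (A D F G K R S T U V W X Y Z : {set E}).
Implicit Types (a b e w x y : E).
Variable blk : E -> bool.

Definition cross_eq B C F := forall Z e x, Z \subset F -> e \in F -> x \in F ->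
  blk e != blk x -> par B Z e x = par C Z e x.

Lemma cross_eq_sym B C F : cross_eq B C F -> cross_eq C B F.
Proof. by move=> h Z e x *; rewrite h. Qed.

(** The difference of [B] and [C] is additive over [S] and [T]: by [par_count] its second difference
    at each crossing pair vanishes, and these second differences add up to the defect. *)
Lemma cross_additive B C F S T : matroid B -> matroid C -> cross_eq B C F ->
  S \subset F -> T \subset F ->
  (forall a b, a \in S -> b \in T -> blk a != blk b) ->
  B (S :|: T) + C S + C T = C (S :|: T) + B S + B T.
Proof.
move=> BM CM h sS sT ne.
have step a Z : a \in F -> Z \subset F -> forall T, T \subset F ->
    (forall b, b \in T -> blk a != blk b) ->
    B (a |: (Z :|: T)) + B Z + C (Z :|: T) + C (a |: Z) =
    C (a |: (Z :|: T)) + C Z + B (Z :|: T) + B (a |: Z).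
  move=> aF sZ; elim/set_ind => [|b T0 bT IH] sT0 ne0; first by rewrite !setU0; lia.
  move: sT0; rewrite subUset sub1set => /andP[bF sT0].
  have {IH} := IH sT0 (fun b' bT' => ne0 b' (setU1r _ bT')).
  have sZT : Z :|: T0 \subset F by rewrite subUset sZ.
  have := par_count BM (Z :|: T0) a b; have := par_count CM (Z :|: T0) a b.
  rewrite (h _ a b sZT aF bF (ne0 b (setU11 _ _))) (setUCA Z) => *; lia.
elim/set_ind: S sS ne => [|a S aS IH] sS ne; first by rewrite !set0U !rk0 //; lia.
move: sS; rewrite subUset sub1set => /andP[aF sS].
have {IH} := IH sS (fun b c bS => ne b c (setU1r _ bS)).
have := step a S aF sS T sT (fun b => ne a b (setU11 _ _)).
by rewrite -setUA => *; lia.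
Qed.

(** For independent [S], intersecting the closures of the sets [S :\ w] gives the closure of the
    empty set, so [x] would be a loop. The induction removes the elements of [A] one by one. *)
Lemma not_forced B S x : matroid B -> B [set x] = 1 ->
  (forall w, w \in S -> B S = (B (S :\ w)).+1) ->
  (forall w, w \in S -> B (x |: (S :\ w)) = B (S :\ w)) ->
  B (x |: S) = B S -> False.
Proof.
move=> BM Bx ind cl cS.
have H A : A \subset S -> B (x |: (S :\: A)) = B (S :\: A).
  elim/set_ind: A => [|w A wA IH]; first by rewrite setD0.
  rewrite subUset sub1set => /andP[wS sA]; have {}IH := IH sA.
  have e1 : S :\: (w |: A) = S :\: A :\ w by by_setP.
  have : B (x |: S) + B (x |: (S :\: A :\ w)) <= B (x |: (S :\: A)) + B (x |: (S :\ w)).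
    by apply: (rk_submod_le BM); move: wA; clear => *; by_subset.
  have := rk_setU1 BM w (S :\: A :\ w); rewrite setD1K ?inE ?wA //.
  have := rk_setU1 BM x (S :\: A :\ w).
  by rewrite e1 cS IH (cl w wS) (ind w wS); clear; lia.
by have := H S (subxx _); rewrite setDv setU0 rk0 // Bx.
Qed.

Lemma cross_nonloop B C F e : matroid B -> matroid C -> mixed blk F -> conn B F ->
  cross_eq B C F -> e \in F -> B [set e] = 1 /\ C [set e] = 1.
Proof.
move=> BM CM mF cB h eF; have [x xF ex] := mixed_partner mF eF.
have [Z sZ p] := conn_par BM cB eF xF (neq_blk ex).
have p' : par C Z e x by rewrite -h.
split; [have := par_nonloop BM p; have := rk1 BM e
       | have := par_nonloop CM p'; have := rk1 CM e]; lia.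
Qed.

(** Elements outside [S] must satisfy the second alternative of the removal hypothesis, which puts
    them into the [C]-closure of [S]. Those inside must satisfy the first, which makes [S]
    independent in [C] and puts [x] into the closure of every [S :\ w], against [not_forced]. *)
Lemma cross_single_lt B C F S x : matroid B -> matroid C -> mixed blk F -> conn B F ->
  cross_eq B C F -> x \in F -> S \subset F :\ x ->
  (forall y, y \in F :\ x -> blk y != blk x) ->
  (forall w, w \in F :\ x -> 2 < #|F| ->
    (forall X, X \subset F :\ w -> B X = C X) \/
    (forall X, X \subset F -> w \in X -> B X = C X)) ->
  B S < C S -> False.
Proof.
move=> BM CM mF cB h xF sS blx rem lt.
have nl e : e \in F -> B [set e] = 1 /\ C [set e] = 1.
  exact: (cross_nonloop BM CM mF cB h).
have [/nl[Bx Cx]] := xF.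
have cC : conn C F by apply: (conn_transfer BM CM mF cB) => Z e y *; rewrite -h.
have sSF : S \subset F := subset_trans sS (subsetDl _ _).
have addx X : X \subset F :\ x -> B (x |: X) + C X = C (x |: X) + B X.
  move=> sX; have := @cross_additive B C F X [set x] BM CM h
    (subset_trans sX (subsetDl _ _)).
  rewrite sub1set setUC Bx Cx => /(_ xF); rewrite -!addnA.
  have ne a b : a \in X -> b \in [set x] -> blk a != blk b.
    by move=> aX; rewrite inE => /eqP->; apply: blx; apply: (subsetP sX).
  by move=> /(_ ne); lia.
have F3 : 2 < #|F|.
  have [S0|[a aS]] := set_0Vmem S; first by move: lt; rewrite S0 !rk0.
  have [S1|[b bS]] := set_0Vmem (S :\ a).
    have eS : S = [set a] by rewrite -(setD1K aS) S1 setU0.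
    by move: lt; rewrite eS; case: (nl a (subsetP sSF a aS)) => -> ->.
  have := cardsD1 x F; have := subset_leq_card sS; have := cardsD1 a S.
  by have := cardsD1 b (S :\ a); rewrite xF aS bS; lia.
have out w : w \in F :\ x -> w \notin S -> C (w |: S) = C S.
  move=> wF wS; case: (rem w wF F3) => H.
    by move: lt; rewrite H ?ltnn // subsetD1 wS sSF.
  have := H (w |: S); rewrite subUset sub1set sSF setU11 => /(_ _ isT).
  move: wF; rewrite !inE => /andP[_ ->] /(_ isT).
  by have := rk_setU1 BM w S; have := rk_setU1 CM w S; lia.
have inS w : w \in S -> forall X, X \subset F :\ w -> B X = C X.
  move=> wS; case: (rem w (subsetP sS w wS) F3) => // H.
  by move: lt; rewrite H ?ltnn.
have CFx : C (F :\ x) = C S.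
  rewrite -(setUidPr sS); apply: cl_setU => // w wF.
  have [wS|wS] := boolP (w \in S); last exact: out.
  by rewrite (setUidPr _) // sub1set.
have CF : C F = C (F :\ x).
  have sx : [set x] \subset F by rewrite sub1set.
  have := rk_setU1 CM x (F :\ x); rewrite setD1K // => hx.
  apply/eqP; apply: contraT => /eqP ne.
  case: (conn_sep cC sx) => [|/setP/(_ x)|eF]; rewrite ?inE ?eqxx //.
    by rewrite Cx; lia.
  by move: F3; rewrite -eF cards1.
have CxS : C (x |: S) = C S.
  have := rk_setU1 CM x S; have : C (x |: S) <= C F.
    by apply: rk_mono => //; rewrite subUset sub1set xF.
  by lia.
have BxS : B (x |: S) = B S by have := addx S sS; have := rk_setU1 BM x S; lia.
have BS w : w \in S -> B (S :\ w) = C (S :\ w) /\ B S = B (S :\ w) /\ C S = (C (S :\ w)).+1.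
  move=> wS; have e1 : B (S :\ w) = C (S :\ w).
    by apply: (inS w wS); apply: setSD.
  have := rk_setU1 BM w (S :\ w); have := rk_setU1 CM w (S :\ w); rewrite setD1K //.
  by lia.
apply: (@not_forced C S x) => // w wS; first by case: (BS w wS) => _ [].
have xw : x != w.
  by apply: contraTneq wS => <-; move: sS; rewrite subsetD1 => /andP[].
have : B (x |: (S :\ w)) = C (x |: (S :\ w)).
  apply: (inS w wS); rewrite subUset sub1set !inE xF xw /=; exact: setSD.
have : B (x |: (S :\ w)) <= B (x |: S) by apply: rk_mono; rewrite // setUS // subsetDl.
by have := rk_setU1 CM x (S :\ w); case: (BS w wS) => _ []; lia.
Qed.

(** With only two labels, any [X] splits into two parts all of whose mutual pairs are crossing, so
    [cross_additive] reduces the claim to sets [S] within one block. For [x] in the other block,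
    either [x] shares its block and induction applies to removing [x], or it is alone and
    [cross_single_lt] applies. *)
Lemma cross_determined B C F : matroid B -> matroid C -> mixed blk F -> conn B F ->
  cross_eq B C F -> forall X, X \subset F -> B X = C X.
Proof.
elim: {F}#|F| {-2}F (leqnn #|F|) B C => [|n IH] F hF B C BM CM mF cB h.
  by move: hF mF; rewrite leqn0 cards_eq0 => /eqP-> [e [x []]]; rewrite inE.
have nl e : e \in F -> B [set e] = 1 /\ C [set e] = 1.
  exact: (cross_nonloop BM CM mF cB h).
have cC : conn C F by apply: (conn_transfer BM CM mF cB) => Z e y *; rewrite -h.
have rem w : w \in F -> mixed blk (F :\ w) ->
    (forall X, X \subset F :\ w -> B X = C X) \/
    (forall X, X \subset F -> w \in X -> B X = C X).
  move=> wF mw; have cw : #|F :\ w| <= n by have := cardsD1 w F; rewrite wF; lia.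
  have F2 : 1 < #|F|.
    have [a [b [aF bF ab]]] := mF.
    have := subset_leq_card (_ : [set a; b] \subset F).
    by rewrite cards2 (neq_blk ab) subUset !sub1set aF bF => /(_ isT).
  have sw : F :\ w \subset F := subsetDl _ _.
  have [c|c] := conn_del_ctr BM cB wF F2; [left|right].
    apply: (IH _ cw) => // Z e x sZ /(subsetP sw) eF /(subsetP sw) xF; apply: h => //.
    exact: subset_trans sw.
  have H : cross_eq (ctr B [set w]) (ctr C [set w]) (F :\ w).
    move=> Z e x sZ /(subsetP sw) eF /(subsetP sw) xF ex; rewrite !par_ctr //.
    by apply: h => //; rewrite subUset sub1set wF (subset_trans sZ sw).
  have H2 := IH _ cw _ _ (ctr_matroid BM _) (ctr_matroid CM _) mw c H.
  move=> X sX wX; have := H2 (X :\ w) (setSD _ sX).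
  have := ctrE BM [set w] (X :\ w); have := ctrE CM [set w] (X :\ w).
  by rewrite setUC setD1K //; case: (nl w wF) => -> ->; lia.
suff mono S x : S \subset F -> x \in F -> (forall y, y \in S -> blk y != blk x) -> B S = C S.
  move=> X sX; have [a [b [aF bF ab]]] := mF.
  pose X1 := X :&: [set y | blk y != blk a]; pose X2 := X :&: [set y | blk y != blk b].
  have eX : X1 :|: X2 = X.
    apply/setP => y; rewrite !inE -andb_orr; case: (y \in X) => //=.
    by move: ab; case: (blk a); case: (blk b); case: (blk y).
  have s1 : X1 \subset F by apply: subset_trans (subsetIl _ _) sX.
  have s2 : X2 \subset F by apply: subset_trans (subsetIl _ _) sX.
  have e1 : B X1 = C X1 by apply: (mono _ a) => // y; rewrite !inE => /andP[].
  have e2 : B X2 = C X2 by apply: (mono _ b) => // y; rewrite !inE => /andP[].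
  have := @cross_additive B C F X1 X2 BM CM h s1 s2; rewrite eX e1 e2.
  have ne y z : y \in X1 -> z \in X2 -> blk y != blk z.
    by rewrite !inE => /andP[_ +] /andP[_]; move: ab; case: (blk a); case: (blk b); case: (blk y); case: (blk z).
  by move=> /(_ ne); lia.
move=> sS xF neS; apply/eqP; apply: contraT => /eqP ne.
have [S0|[y yS]] := set_0Vmem S; first by case: ne; rewrite S0 !rk0.
have yF := subsetP sS y yS; have yx := neS y yS.
have [/existsP[z /andP[zF /andP[zx bz]]]|/existsPn nz] :=
    boolP [exists z, (z \in F) && ((z != x) && (blk z == blk x))].
  have mx : mixed blk (F :\ x).
    by exists y, z; rewrite !inE yF zF (neq_blk yx) zx (eqP bz).
  have xS : x \notin S by apply: contraT => /negPn/neS; rewrite eqxx.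
  case: (rem x xF mx) => H; first by case: ne; apply: H; rewrite subsetD1 sS.
  have := @cross_additive B C F S [set x] BM CM h sS; rewrite sub1set => /(_ xF).
  have ne' a b : a \in S -> b \in [set x] -> blk a != blk b.
    by move=> aS; rewrite inE => /eqP->; apply: neS.
  move=> /(_ ne'); rewrite setUC H ?setU11 ?subUset ?sub1set ?xF //.
  by case: (nl x xF) => -> ->; lia.
have sSx : S \subset F :\ x.
  by rewrite subsetD1 sS; apply: contraT => /negPn/neS; rewrite eqxx.
have blx z : z \in F :\ x -> blk z != blk x.
  by rewrite !inE => /andP[zx zF]; have := nz z; rewrite zF zx.
have rem' w : w \in F :\ x -> 2 < #|F| -> (forall X, X \subset F :\ w -> B X = C X) \/
    (forall X, X \subset F -> w \in X -> B X = C X).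
  move=> wF F3; apply: rem; first by move: wF; rewrite inE => /andP[].
  have [z zF] : exists z, z \in F :\ x :\ w.
    by apply/card_gt0P; have := cardsD1 x F; have := cardsD1 w (F :\ x); rewrite xF wF; lia.
  exists z, x; move: zF wF; rewrite !inE => /and3P[-> zx zF] /andP[wx _].
  by rewrite zF xF eq_sym wx; split=> //; apply: blx; rewrite !inE zx.
case: (ltngtP (B S) (C S)) => // lt.
  by case: (cross_single_lt BM CM mF cB h xF sSx blx rem').
case: (cross_single_lt CM BM mF cC (cross_eq_sym h) xF sSx blx _ lt) => //.
by move=> w wF F3; case: (rem' w wF F3) => H; [left|right] => *; rewrite H.
Qed.

End Matroid6.

(** * Comparing two decompositions of a 2-polymatroid *)

Section Decomp.
Variable E : finType.
Implicit Types (A B D F G K R S T U V W X Y Z : {set E}).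
Implicit Types (a b e f g w x y z : E) (rho : {set E} -> nat).

(* The pieces of a tuple of matroids: [r i] is a component with support [C i]; empty supports are allowed. *)
Definition decomp (I : finType) (C : I -> {set E}) (r : I -> {set E} -> nat) rho :=
  [/\ forall i, matroid (r i), forall i, conn (r i) (C i),
      forall i X, r i X = r i (X :&: C i) & forall X, rho X = \sum_i r i X].

Definition nonloops rho : {set E} := [set e | 0 < rho [set e]].

Section OneDecomp.
Variables (I : finType) (C : I -> {set E}) (r : I -> {set E} -> nat).
Variable rho : {set E} -> nat.
Hypothesis dec : decomp C r rho.
Local Notation F := (nonloops rho).

Lemma dec_matroid i : matroid (r i). Proof. by case: dec. Qed.
Lemma dec_conn i : conn (r i) (C i). Proof. by case: dec. Qed.
Lemma dec_cap i X : r i X = r i (X :&: C i). Proof. by case: dec. Qed.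
Lemma dec_sum X : rho X = \sum_i r i X. Proof. by case: dec. Qed.

Lemma dec_cap_eq i X Y : X :&: C i = Y :&: C i -> r i X = r i Y.
Proof. by rewrite (dec_cap i X) (dec_cap i Y) => ->. Qed.

Lemma dec_rk1 i e : r i [set e] = (e \in C i).
Proof.
rewrite dec_cap; have [eC|eC] := boolP (e \in C i).
  rewrite (setIidPl _) ?sub1set //; case/connP: (dec_conn i) => /(_ e eC) + _.
  by have := rk1 (dec_matroid i) e; lia.
rewrite (_ : _ :&: _ = set0) ?rk0 //; first exact: dec_matroid.
by apply/setP => z; rewrite !inE; case: eqP => // ->; apply: negPf.
Qed.

Lemma dec_par_in i Z a b : par (r i) Z a b -> (a \in C i) && (b \in C i).
Proof.
move=> p; have q := p; rewrite parC in q.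
have := par_nonloop (dec_matroid i) p; have := par_nonloop (dec_matroid i) q.
by rewrite !dec_rk1; case: (a \in _); case: (b \in _).
Qed.

Lemma dec_par_cap i Z Z' a b : Z :&: C i = Z' :&: C i -> par (r i) Z a b = par (r i) Z' a b.
Proof.
move=> h; have H A : (A :|: Z) :&: C i = (A :|: Z') :&: C i by rewrite !setIUl h.
rewrite /par !setUA (dec_cap_eq (H [set a])) (dec_cap_eq (H [set b])).
by rewrite (dec_cap_eq (H ([set a] :|: [set b]))) (dec_cap_eq h).
Qed.

Lemma dec_count e : rho [set e] = #|[set i | e \in C i]|.
Proof. by rewrite dec_sum -sum1dep_card [RHS]big_mkcond; apply: eq_bigr => i _; rewrite dec_rk1; case: (_ \in _). Qed.

Lemma dec_cover e : (e \in F) = [exists i, e \in C i].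
Proof.
rewrite inE dec_count; apply/card_gt0P/existsP => [[i]|[i ei]]; first by rewrite inE; exists i.
by exists i; rewrite inE.
Qed.

Lemma dec_sub i : C i \subset F.
Proof. by apply/subsetP => e ei; rewrite dec_cover; apply/existsP; exists i. Qed.

Lemma dec_par_sum Z a b :
  \sum_i par (r i) Z a b + rho (a |: (b |: Z)) + rho Z = rho (a |: Z) + rho (b |: Z).
Proof.
rewrite !dec_sum -!big_split /=; apply: eq_bigr => i _.
by rewrite -(par_count (dec_matroid i)).
Qed.

(** If every support lies inside [U] or avoids it, then [U] cuts [rho] into a sum. Connectivity of
    [rho] is used only in this form: the supports form a connected hypergraph. *)
Lemma dec_closed U : conn rho F -> (forall i, C i \subset U \/ [disjoint C i & U]) ->
  forall e, e \in F -> e \in U -> F \subset U.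
Proof.
move=> cr hU e eF eU.
have : F :&: U = set0 \/ F :&: U = F.
  apply: (conn_sep cr); first exact: subsetIl.
  rewrite !dec_sum -big_split /=; apply: leq_sum => i _.
  case: (hU i) => h.
    rewrite (@dec_cap_eq i (F :&: U) F); last by move: (nonloops rho) h; clear => *; by_setP.
    rewrite (@dec_cap_eq i (F :\: (F :&: U)) set0) ?(rk0 (dec_matroid i)) ?addn0 //.
    by move: (nonloops rho) h; clear => *; by_setP.
  rewrite (@dec_cap_eq i (F :&: U) set0) ?(rk0 (dec_matroid i)); last by move: (nonloops rho) h; clear => *; by_setP.
  by rewrite add0n (rk_mono (dec_matroid i)) // subsetDl.
case=> [/setP/(_ e)|/setIidPl//].
by rewrite inE eF eU inE.
Qed.

Hypothesis two : forall e, rho [set e] <= 2.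

Lemma dec_two i j k e : e \in C i -> e \in C j -> e \in C k -> i != j -> k = i \/ k = j.
Proof.
move=> ei ej ek ij; have := two e; rewrite dec_count => h.
have [->|ki] := eqVneq k i; first by left.
have [->|kj] := eqVneq k j; first by right.
suff : 2 < #|[set i | e \in C i]| by rewrite ltnNge h.
have -> : 3 = #|k |: [set i; j]| by rewrite cardsU1 !inE cards2 negb_or ij ki kj.
by apply: subset_leq_card; apply/subsetP => l; rewrite !inE => /or3P[] /eqP->.
Qed.

End OneDecomp.

(** A connected matroid on three elements is uniform of rank 1 or 2; in the first case [a], [b] are
    parallel at once, in the second only after contracting [c]. *)
Lemma conn3_par s a b c : matroid s -> conn s [set a; b; c] ->
  a != b -> a != c -> b != c -> par s set0 a b != par s [set c] a b.
Proof.
move=> sM cs ab ac bc.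
have := cs => /connP[nl sep].
have [[na nb] nc] := (nl a, nl b, nl c); move: na nb nc; rewrite !inE !eqxx ?orbT.
move=> /(_ isT) na /(_ isT) nb /(_ isT) nc.
have H1 u : u \in [set a; b; c] -> s [set a; b; c] <= s ([set a; b; c] :\ u).
  move=> ui; have := sep [set u]; rewrite sub1set ui => /(_ isT).
  have u0 : [set u] != set0 by apply/set0Pn; exists u; rewrite set11.
  have uF : [set u] != [set a; b; c].
    apply/eqP => /setP h; have := h a; have := h b; rewrite !inE !eqxx orbT /=.
    by move=> /eqP eb /eqP ea; rewrite ea eb eqxx in ab.
  by move=> /(_ u0 uF); have := rk1 sM u; lia.
have := H1 a; have := H1 b; have := H1 c; rewrite !inE !eqxx ?orbT.
have -> : [set a; b; c] :\ a = [set b; c] by by_setP.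
have -> : [set a; b; c] :\ b = [set a; c] by by_setP.
have -> : [set a; b; c] :\ c = [set a; b] by by_setP.
move=> /(_ isT) h1 /(_ isT) h2 /(_ isT) h3.
have e1 : s [set a; b] <= s [set a; b; c] by apply: rk_mono => //; by_subset.
have e2 : s [set a; c] <= s [set a; b; c] by apply: rk_mono => //; by_subset.
have e3 : s [set b; c] <= s [set a; b; c] by apply: rk_mono => //; by_subset.
have ra := rk1 sM a; have rb := rk1 sM b; have rc := rk1 sM c.
have hab : s [set a; b] <= 2 by have := rk_subadd sM [set a] [set b]; lia.
have := par_count sM set0 a b; have := par_count sM [set c] a b.
rewrite !setU0 setUA rk0 //.
by case: par; case: par => //=; lia.
Qed.

Section TwoDecomps.
Variables (I : finType) (C : I -> {set E}) (r : I -> {set E} -> nat).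
Variables (I' : finType) (C' : I' -> {set E}) (r' : I' -> {set E} -> nat).
Variable rho : {set E} -> nat.
Hypotheses (dec : decomp C r rho) (dec' : decomp C' r' rho).
Local Notation F := (nonloops rho).

Lemma par_sum_eq Z a b : \sum_i par (r i) Z a b = \sum_j par (r' j) Z a b.
Proof. by have := dec_par_sum dec Z a b; have := dec_par_sum dec' Z a b; lia. Qed.

Lemma par_other j Z a b : par (r' j) Z a b -> exists i, par (r i) Z a b.
Proof.
move=> p; apply/existsP; apply: contraT; rewrite negb_exists => /forallP h.
have := par_sum_eq Z a b; rewrite big1 => [|i _]; last by rewrite (negPf (h i)).
by rewrite (bigD1 j) //= p.
Qed.

Lemma pair_other j a b : a \in C' j -> b \in C' j ->
  exists i, (a \in C i) && (b \in C i).
Proof.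
move=> aj bj; have [e|ab] := eqVneq a b.
  have : a \in F by rewrite (dec_cover dec'); apply/existsP; exists j.
  by rewrite (dec_cover dec) => /existsP[i ai]; exists i; rewrite -e ai.
have [Z _ p] := conn_par (dec_matroid dec' j) (dec_conn dec' j) aj bj ab.
by have [i pi] := par_other p; exists i; apply: (dec_par_in dec pi).
Qed.

Hypothesis two : forall e, rho [set e] <= 2.

(** In a connected minor of piece [j] on {a, b, c}, contracting [c] changes whether [a], [b] are
    parallel. No piece of the first decomposition that contains [a] and [b] sees [c], so the total
    count stays the same and another piece must compensate. *)
Lemma triple_other j a b c : a \in C' j -> b \in C' j -> c \in C' j ->
  a != b -> a != c -> b != c ->
  (forall i, ~~ [&& a \in C i, b \in C i & c \in C i]) ->
  exists2 j2, j2 != j & (a \in C' j2) && (b \in C' j2).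
Proof.
move=> aj bj cj ab ac bc no.
have [||Z sZ cZ] := conn_minor (K := [set a; b; c]) (dec_matroid dec' j) (dec_conn dec' j).
- by rewrite !subUset !sub1set aj bj cj.
- by apply/set0Pn; exists a; rewrite !inE eqxx.
have jM := dec_matroid dec' j.
have := conn3_par (ctr_matroid jM Z) cZ ab ac bc; rewrite !par_ctr // set0U => ne.
have H W W' : W :\ c = W' :\ c -> par (r' j) W a b -> ~~ par (r' j) W' a b ->
    exists2 j2, j2 != j & (a \in C' j2) && (b \in C' j2).
  move=> WW p np; have [i pi] := par_other p.
  have /andP[ai bi] := dec_par_in dec pi.
  have ci : c \notin C i by have := no i; rewrite ai bi.
  have pi' : par (r i) W' a b.
    rewrite -(dec_par_cap dec (Z := W)) //.
    apply/setP => z; rewrite !inE; have [->|zc] := eqVneq z c; first by rewrite (negPf ci) !andbF.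
    by move/setP/(_ z): WW; rewrite !inE zc /= => ->.
  have : 0 < \sum_j par (r' j) W' a b by rewrite -par_sum_eq (bigD1 i) //= pi'.
  rewrite lt0n sum_nat_eq0 negb_forall => /existsP[j2]; rewrite -lt0n lt0b => p2.
  exists j2; last exact: (dec_par_in dec' p2).
  by apply: contraNneq np => <-.
have eZ : Z :\ c = (c |: Z) :\ c by apply/setP => z; rewrite !inE; case: eqP.
by move: ne; case p1: (par _ Z a b); case p2: (par _ _ a b) => // _;
  [apply: (H Z (c |: Z)) | apply: (H (c |: Z) Z)]; rewrite ?p1 ?p2.
Qed.

Definition full2 (J : finType) (D : J -> {set E}) G := exists i j, [/\ i != j, D i = G & D j = G].

(** Every element of [G] lies in exactly two of the three supports. *)
Definition triangle (J : finType) (D : J -> {set E}) G := exists i j k,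
  [/\ i != j, i != k & j != k] /\
  [/\ D i :|: D j = G, D i :|: D k = G, D j :|: D k = G & D i :&: D j :&: D k = set0] /\
  [/\ D i != G, D j != G & D k != G].

End TwoDecomps.
End Decomp.

Section Structure.
Variable E : finType.
Implicit Types (A B D F G K R S T U V W X Y Z : {set E}).
Implicit Types (a b e f g u v w x y z : E) (rho : {set E} -> nat).

Section Two.
Variables (I : finType) (C : I -> {set E}) (r : I -> {set E} -> nat).
Variables (I' : finType) (C' : I' -> {set E}) (r' : I' -> {set E} -> nat).
Variable rho : {set E} -> nat.
Hypotheses (dec : decomp C r rho) (dec' : decomp C' r' rho).
Hypothesis two : forall e, rho [set e] <= 2.
Hypothesis cr : conn rho (nonloops rho).
Local Notation F := (nonloops rho).

(** The three pairs lie in three different supports of [C], and [triple_other] puts [e], [x], [y]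
    into a second common support of [C']. The claim [key] extends this to all elements of the three
    supports, which then cover all nonloops by [dec_closed]. *)
Lemma tri_struct j e x y : e \in C' j -> x \in C' j -> y \in C' j ->
  e != x -> e != y -> x != y ->
  (forall i, ~~ [&& e \in C i, x \in C i & y \in C i]) ->
  full2 C' F /\ triangle C F.
Proof.
move=> ej xj yj ex ey xy no.
have [i1 /andP[e1 x1]] := pair_other dec dec' ej xj.
have [i2 /andP[e2 y2]] := pair_other dec dec' ej yj.
have [i3 /andP[x3 y3]] := pair_other dec dec' xj yj.
have y1 : y \notin C i1 by have := no i1; rewrite e1 x1.
have x2 : x \notin C i2 by have := no i2; rewrite e2 y2 andbT.
have e3 : e \notin C i3 by have := no i3; rewrite x3 y3 !andbT.
have [j2 j2j /andP[ej2 xj2]] := triple_other dec dec' ej xj yj ex ey xy no.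
have [j2' j2j' /andP[ej2' yj2']] : exists2 j2, j2 != j & (e \in C' j2) && (y \in C' j2).
  apply: (triple_other dec dec' ej yj xj) => //; first by rewrite eq_sym.
  by move=> i; have := no i; rewrite [(x \in _) && _]andbC.
have two' := dec_two dec' two; have twoC := dec_two dec two.
have jj2 : j != j2 by rewrite eq_sym.
have ej' : j2' = j2.
  by case: (two' _ _ _ _ ej ej2 ej2' jj2) => // h; rewrite h eqxx in j2j'.
rewrite {}ej' in yj2'.
(* One of the two supports of [C'] through [u] contains [f], hence [f] and [w] share a support of
   [C], which is [k] or [l]. Then [f], [w] and one of [u], [v] have no common support in [C], and
   [triple_other] yields the second support of [C'] for [f]. *)
have key u v w i k l : u \in C' j -> v \in C' j -> w \in C' j -> u \in C' j2 ->
    v \in C' j2 -> w \in C' j2 -> u \in C i -> v \in C i -> w \notin C i ->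
    u \in C k -> w \in C k -> v \notin C k -> v \in C l -> w \in C l -> u \notin C l ->
    forall f, f \in C i -> [&& f \in C' j, f \in C' j2 & (f \in C k) || (f \in C l)].
  move=> uj vj wj uj2 vj2 wj2 ui vi wi uk wk vk vl wl ul f fi.
  have [->|fu] := eqVneq f u; first by rewrite uj uj2 uk.
  have [->|fv] := eqVneq f v; first by rewrite vj vj2 vl orbT.
  have fw : f != w by apply: contraTneq fi => ->.
  have kl : k != l by apply: contraTneq vl => <-.
  have ik : i != k by apply: contraTneq vi => ->.
  have il : i != l by apply: contraTneq ui => ->.
  have vw : v != w by apply: contraTneq vi => ->.
  have uw : u != w by apply: contraTneq ui => ->.
  have [j' /andP[fj' uj']] := pair_other dec' dec fi ui.
  have [j'' [jj' vj' wj' all]] : exists j'', [/\ j' != j'', v \in C' j', w \in C' j' &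
     (forall g, g \in C' j' -> g \in C' j'' -> (g \in C' j) && (g \in C' j2)) /\
     (forall h g, g \in C' j -> g \in C' j2 -> g \in C' h -> h != j' -> h = j'')].
    case: (two' _ _ _ _ uj uj2 uj' jj2) => ->; [exists j2|exists j]; split=> //; split=> [g -> ->//|h g gj gj2 gh].
      by case: (two' _ _ _ _ gj gj2 gh jj2) => [->|//]; rewrite eqxx.
    by case: (two' _ _ _ _ gj gj2 gh jj2) => [//|->]; rewrite eqxx.
  case: all => fin oth.
  have [m /andP[fm wm]] := pair_other dec dec' fj' wj'.
  case: (twoC _ _ _ _ wk wl wm kl) => em; rewrite {}em in fm.
    have [n nj' /andP[fn vn]] : exists2 j2, j2 != j' & (f \in C' j2) && (v \in C' j2).
      apply: (triple_other dec dec' fj' vj' wj') => // n; apply/negP => /and3P[fn vn wn].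
      by case: (twoC _ _ _ _ fi fm fn ik) => en; rewrite en in vn wn; rewrite ?vn ?wn in vk wi.
    have en := oth n v vj vj2 vn nj'; rewrite en in fn.
    by have /andP[-> ->] := fin f fj' fn; rewrite fm.
  have [n nj' /andP[fn un]] : exists2 j2, j2 != j' & (f \in C' j2) && (u \in C' j2).
    apply: (triple_other dec dec' fj' uj' wj') => // n; apply/negP => /and3P[fn un wn].
    by case: (twoC _ _ _ _ fi fm fn il) => en; rewrite en in un wn; rewrite ?un ?wn in ul wi.
  have en := oth n u uj uj2 un nj'; rewrite en in fn.
  by have /andP[-> ->] := fin f fj' fn; rewrite fm orbT.
have k1 := key e x y i1 i2 i3 ej xj yj ej2 xj2 yj2' e1 x1 y1 e2 y2 x2 x3 y3 e3.
have k2 := key e y x i2 i1 i3 ej yj xj ej2 yj2' xj2 e2 y2 x2 e1 x1 y1 y3 x3 e3.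
have k3 := key x y e i3 i1 i2 xj yj ej xj2 yj2' ej2 x3 y3 e3 x1 e1 y1 y2 e2 x2.
have i12 : i1 != i2 by apply: contraTneq x1 => ->.
have i13 : i1 != i3 by apply: contraTneq e1 => ->.
have i23 : i2 != i3 by apply: contraTneq e2 => ->.
have FU : F \subset C i1 :|: C i2 :|: C i3.
  have eF : e \in F by rewrite (dec_cover dec); apply/existsP; exists i1.
  apply: (dec_closed dec cr _ eF); last by rewrite !inE e1.
  move=> l; have [/eqP h|/set0Pn[f]] := boolP (C l :&: (C i1 :|: C i2 :|: C i3) == set0).
    by right; rewrite -setI_eq0 h.
  left; suff [->|[->|->]] : l = i1 \/ l = i2 \/ l = i3.
  - by rewrite -setUA subsetUl.
  - by rewrite setUAC subsetUr.
  - by rewrite subsetUr.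
  move: p; rewrite !inE => /andP[fl /orP[/orP[]|] h].
  - have /and3P[_ _ /orP[]h'] := k1 f h.
      by case: (twoC _ _ _ _ h h' fl i12) => ->; auto.
    by case: (twoC _ _ _ _ h h' fl i13) => ->; auto.
  - have /and3P[_ _ /orP[]h'] := k2 f h.
      by case: (twoC _ _ _ _ h' h fl i12) => ->; auto.
    by case: (twoC _ _ _ _ h h' fl i23) => ->; auto.
  - have /and3P[_ _ /orP[]h'] := k3 f h.
      by case: (twoC _ _ _ _ h' h fl i13) => ->; auto.
    by case: (twoC _ _ _ _ h' h fl i23) => ->; auto.
have sF i : C i \subset F := dec_sub dec i.
have FUP f : f \in F -> [|| f \in C i1, f \in C i2 | f \in C i3].
  by move/(subsetP FU); rewrite !inE orbA.
have [[eF xF] yF] : (e \in F /\ x \in F) /\ y \in F.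
  by rewrite (subsetP (sF i1) e) // (subsetP (sF i1) x) // (subsetP (sF i2) y).
split.
  have H f : f \in F -> (f \in C' j) && (f \in C' j2).
    by case/FUP/or3P => [/k1|/k2|/k3] /and3P[-> ->].
  exists j, j2; split=> //; apply/eqP; rewrite eqEsubset (dec_sub dec');
    by apply/subsetP => f /H /andP[].
exists i1, i2, i3; split; first by split.
split; first split.
- apply/eqP; rewrite eqEsubset subUset !sF; apply/subsetP => f /FUP.
  by rewrite inE; case/or3P => [->//|->|/k3/and3P[]//]; rewrite orbT.
- apply/eqP; rewrite eqEsubset subUset !sF; apply/subsetP => f /FUP.
  by rewrite inE; case/or3P => [->//|/k2/and3P[]//|->]; rewrite orbT.
- apply/eqP; rewrite eqEsubset subUset !sF; apply/subsetP => f /FUP.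
  by rewrite inE; case/or3P => [/k1/and3P[]//|->//|->]; rewrite orbT.
- apply/setP => f; rewrite !inE; apply/negP => /andP[/andP[f1 f2] f3].
  by case: (twoC _ _ _ _ f1 f2 f3 i12) => h; rewrite h eqxx in i13 i23.
split.
- by apply/eqP => h; rewrite h yF in y1.
- by apply/eqP => h; rewrite h xF in x2.
- by apply/eqP => h; rewrite h eF in e3.
Qed.

(** Only two supports of [C] can contain [e]. If each of them misses an element of [C' j], these two
    elements and [e] have no common support, and [tri_struct] applies. *)
Lemma piece_in_piece j e : e \in C' j ->
  (full2 C' F /\ triangle C F) \/ exists i, C' j \subset C i.
Proof.
move=> ej; have [i /andP[ei _]] := pair_other dec dec' ej ej.
have [h|] := boolP (C' j \subset C i); first by right; exists i.
case/subsetPn => x xj xi; have ex : e != x by apply: contraTneq ei => ->.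
have [k /andP[ek xk]] := pair_other dec dec' ej xj.
have ik : i != k by apply: contraTneq xk => <-.
have [h|] := boolP (C' j \subset C k); first by right; exists k.
case/subsetPn => y yj yk; left.
apply: (tri_struct ej xj yj) => //; try by apply: contraTneq ek => ->.
  by apply: contraTneq xk => ->.
move=> l; apply/negP => /and3P[el xl yl].
by case: (dec_two dec two ei ek el ik) => h; rewrite h in xl yl; rewrite ?xl ?yl in xi yk.
Qed.

Lemma piece_proper j (b i : I) e x : C' j \subset C b -> i != b ->
  e \in C' j -> x \in C' j -> e \in C i -> x \notin C i -> C' j = C b.
Proof.
move=> sjb ib ej xj ei xi.
(* The label is the other support through [f], unique because [f] lies in at most two; [b] marks
   elements that have no other support. *)
pose blk f := if [pick k | (k != b) && (f \in C k)] is Some k then k else b.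
have twoC := dec_two dec two.
have blkE f k : f \in C b -> k != b -> f \in C k -> blk f = k.
  move=> fb kb fk; rewrite /blk; case: pickP => [l /andP[lb fl]|/(_ k)].
    by case: (twoC _ _ _ _ fk fb fl kb) => // h; rewrite h eqxx in lb.
  by rewrite kb fk.
have be : blk e = i by apply: blkE => //; apply: (subsetP sjb).
have bx : blk x != i.
  rewrite /blk; case: pickP => [l /andP[lb xl]|_]; last by rewrite eq_sym.
  by apply: contraNneq xi => <-.
have := @conn_separates _ _ blk (r' j) (r b) (C b) (C' j) (dec_matroid dec' j)
  (dec_matroid dec b) sjb.
have mix : mixed blk (C' j) by exists e, x; rewrite ej xj be eq_sym bx.
move=> /(_ mix (dec_conn dec' j)) h.
have : r b (C' j) + r b (C b :\: C' j) <= r b (C b).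
  apply: h => S R f z sS sR fj zj fz p.
  have p' : par (r' j) (S :|: R) f z.
    rewrite -(dec_par_cap dec' (Z := S)) //.
    by move: sR; clear => *; by_setP.
  have [k pk] := par_other dec dec' p'; have /andP[fk zk] := dec_par_in dec pk.
  suff -> : b = k by [].
  apply/eqP; rewrite eq_sym; apply: contraNT fz => kb.
  by rewrite (blkE f k) ?(blkE z k) ?eqxx // (subsetP sjb).
case/(conn_sep (dec_conn dec b) sjb) => // h0.
by rewrite h0 inE in ej.
Qed.

End Two.

(** A largest support of [C] above [C' j] is itself a support of [C'], so [e] lies in two supports
    of [C'] and hence in a second one of [C]. By [piece_proper] this one also contains [C' j] and
    equals the first. Two equal supports admit no third one that meets them, so they are full by
    connectivity. *)
Lemma piece_lost (I I' : finType) (C : I -> {set E}) (r : I -> {set E} -> nat)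
  (C' : I' -> {set E}) (r' : I' -> {set E} -> nat) rho j :
  decomp C r rho -> decomp C' r' rho -> (forall e, rho [set e] <= 2) ->
  conn rho (nonloops rho) ->
  (forall i e, e \in C i -> exists k, C i \subset C' k) ->
  (forall i e, e \in C' i -> exists k, C' i \subset C k) ->
  C' j != set0 -> (forall i, C i != C' j) -> full2 C (nonloops rho).
Proof.
move=> dec dec' two cr into into' /set0Pn[e ej] lost.
have twoC := dec_two dec two; have twoC' := dec_two dec' two.
have [b0 sb0] := into' j e ej.
have [b sb maxb] := arg_maxnP (fun i => #|C i|) (sb0 : [pred i | C' j \subset C i] b0).
rewrite /= in sb maxb; have eb := subsetP sb e ej.
have [b' sbb'] := into b e eb.
have eb' := subsetP sbb' e eb.
have [l sbl] := into' b' e eb'.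
have CE : C b = C' b'.
  apply/eqP; rewrite eqEcard sbb' (leq_trans (subset_leq_card sbl)) //.
  by apply: maxb => /=; apply: subset_trans sb (subset_trans sbb' sbl).
have jb' : j != b' by apply/eqP => h; case/eqP: (lost b); rewrite CE h.
have [a [ab ea]] : exists a : I, a != b /\ e \in C a.
  have : rho [set e] = 2.
    have := two e; rewrite (dec_count dec') => h; apply/eqP; rewrite eqn_leq h.
    rewrite (_ : 2 = #|[set j; b']|); last by rewrite cards2 jb'.
    by apply: subset_leq_card; apply/subsetP => i; rewrite !inE => /orP[]/eqP->.
  rewrite (dec_count dec) => h.
  have : 0 < #|[set i | e \in C i] :\ b|.
    by have := cardsD1 b [set i | e \in C i]; rewrite h inE eb; lia.
  by case/card_gt0P => a; rewrite !inE => /andP[]; exists a.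
have sja : C' j \subset C a.
  apply/subsetP => x xj; apply: contraT => xa.
  by case/eqP: (lost b); rewrite (piece_proper dec dec' two sb ab ej xj ea xa).
have sab' : C a \subset C' b'.
  have [m sam] := into a e ea.
  case: (twoC' _ _ _ _ ej eb' (subsetP sam e ea) jb') => em; rewrite em in sam => //.
  by case/eqP: (lost a); apply/eqP; rewrite eqEsubset sam.
have CaE : C a = C' b'.
  have [h|] := boolP (C a \subset C' j).
    by case/eqP: (lost a); apply/eqP; rewrite eqEsubset h.
  by case/subsetPn => x xa xj; apply: (piece_proper dec' dec two sab' jb' ea xa ej xj).
have FE : nonloops rho \subset C b.
  have eF : e \in nonloops rho := subsetP (dec_sub dec b) e eb.
  apply: (dec_closed dec cr _ eF eb) => k.
  have [h|/set0Pn[f]] := eqVneq (C k :&: C b) set0.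
    by right; rewrite -setI_eq0 h.
  rewrite inE => /andP[fk fb]; left.
  have fa : f \in C a by rewrite CaE -CE.
  by case: (twoC _ _ _ _ fa fb fk ab) => ->; rewrite // CaE -CE.
have bF : C b = nonloops rho by apply/eqP; rewrite eqEsubset FE (dec_sub dec).
by exists a, b; rewrite ab bF CaE -CE.
Qed.

(** The index [i] is the middle vertex of the path. *)
Definition path3 (J : finType) (D : J -> {set E}) G := exists i j k,
  [/\ i != j, i != k & j != k] /\
  [/\ D i = G, D j :|: D k = G & D j :&: D k = set0] /\
  [/\ D i != set0, D j != set0 & D k != set0].

(** Nonempty supports are compared as sets, without multiplicities. *)
Definition same_pieces (I I' : finType) (C : I -> {set E}) (C' : I' -> {set E}) :=
  (forall i, C i != set0 -> exists j, C' j = C i) /\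
  (forall j, C' j != set0 -> exists i, C i = C' j).

(* With a full decomposition, the crossing pairs of a piece [F] of the other decomposition are split between the two full pieces, so [no_three_blocks] leaves room for only two further pieces. *)
Lemma full_path (I I' : finType) (C : I -> {set E}) (r : I -> {set E} -> nat)
  (C' : I' -> {set E}) (r' : I' -> {set E} -> nat) rho :
  decomp C r rho -> decomp C' r' rho -> (forall e, rho [set e] <= 2) ->
  nonloops rho != set0 -> full2 C' (nonloops rho) -> ~ full2 C (nonloops rho) ->
  (exists i, C i = nonloops rho) -> path3 C (nonloops rho).
Proof.
move=> dec dec' two F0 [p [q [pq Cp Cq]]] nfull [i Ci].
have twoC := dec_two dec two; have twoC' := dec_two dec' two.
set F := nonloops rho in F0 Cp Cq nfull Ci *.
have other e : e \in F -> exists2 j, j != i & e \in C j.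
  move=> eF; have : 0 < #|[set k | e \in C k] :\ i|.
    have := cardsD1 i [set k | e \in C k]; rewrite -(dec_count dec) inE Ci eF.
    rewrite (dec_count dec'); have : #|[set p; q]| <= #|[set k | e \in C' k]|.
      apply: subset_leq_card; apply/subsetP => k.
      by rewrite !inE => /orP[]/eqP->; rewrite ?Cp ?Cq.
    by rewrite cards2 pq; lia.
  by case/card_gt0P => j; rewrite !inE => /andP[]; exists j.
have ne j : j != i -> C j != F.
  by move=> ji; apply/eqP => h; case: nfull; exists i, j; rewrite eq_sym ji.
have [e eF] := set0Pn _ F0.
have [j ji ej] := other e eF.
have [x xF xj] : exists2 x, x \in F & x \notin C j.
  have : ~~ (F \subset C j).
    by apply: contra (ne j ji) => h; rewrite eqEsubset h (dec_sub dec).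
  by case/subsetPn => x; exists x.
have [k ki xk] := other x xF.
have jk : j != k by apply: contraTneq xk => <-.
have disj : C j :&: C k = set0.
  apply/setP => z; rewrite !inE; apply/negP => /andP[zj zk].
  have zi : z \in C i by rewrite Ci; apply: (subsetP (dec_sub dec j)).
  by case: (twoC _ _ _ _ zj zk zi jk) => h; rewrite h eqxx in ji ki.
exists i, j, k; split; first by rewrite ![i == _]eq_sym ji ki jk.
split; last by split; [rewrite Ci|apply/set0Pn; exists e|apply/set0Pn; exists x].
split => //; apply/eqP; rewrite eqEsubset subUset !(dec_sub dec) /=.
apply/subsetP => z zF; apply: contraT; rewrite inE negb_or => /andP[zj zk].
have [l li zl] := other z zF.
(* The full piece [i] contains every element, so each one is labelled by its second support; [e],
   [x], [z] then represent three blocks. *)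
pose blk f := odflt i [pick k | (k != i) && (f \in C k)].
have blkE f n : f \in F -> n != i -> f \in C n -> blk f = n.
  move=> fF ki' fk; rewrite /blk; case: pickP => [m /andP[mi fm]|/(_ n)] /=.
    have fi : f \in C i by rewrite Ci.
    by case: (twoC _ _ _ _ fk fi fm ki') => // h; rewrite h eqxx in mi.
  by rewrite ki' fk.
exfalso; apply: (@no_three_blocks _ _ blk F (r i) (r' p) (r' q) (dec_matroid dec i)
  (dec_matroid dec' p) (dec_matroid dec' q)).
- exists e, x, z; rewrite !(blkE e j) ?(blkE x k) ?(blkE z l) // jk.
  by split=> //; split=> //; [apply: contraTneq zl => <-|apply: contraTneq zl => <-].
- by rewrite -Cp; apply: (dec_conn dec').
- by rewrite -Cq; apply: (dec_conn dec').
move=> Z u v sZ uF vF uv.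
have := par_sum_eq dec dec' Z u v.
rewrite (bigD1 i) //= big1 ?addn0 => [->|m mi]; last first.
  case h : (par _ _ _ _) => //; have /andP[um vm] := dec_par_in dec h.
  by rewrite !(blkE _ m) ?eqxx in uv.
rewrite (bigD1 p) //= (bigD1 q) 1?eq_sym //= big1 ?addn0 // => m /andP[mp mq].
case h : (par _ _ _ _) => //; have /andP[um _] := dec_par_in dec' h.
have up : u \in C' p by rewrite Cp.
have uq : u \in C' q by rewrite Cq.
by case: (twoC' _ _ _ _ up uq um pq) => hm; rewrite hm eqxx in mp mq.
Qed.

Lemma decomp_compare (I I' : finType) (C : I -> {set E}) (r : I -> {set E} -> nat)
  (C' : I' -> {set E}) (r' : I' -> {set E} -> nat) rho :
  decomp C r rho -> decomp C' r' rho -> (forall e, rho [set e] <= 2) ->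
  conn rho (nonloops rho) -> nonloops rho != set0 -> ~ full2 C (nonloops rho) ->
  same_pieces C C' \/
  full2 C' (nonloops rho) /\ (triangle C (nonloops rho) \/ path3 C (nonloops rho)).
Proof.
move=> dec dec' two cr F0 nfull.
have dec_tri : (full2 C' (nonloops rho) /\ triangle C (nonloops rho)) \/
    forall i e, e \in C' i -> exists k, C' i \subset C k.
  have [/existsP[i /existsP[e /andP[ei /existsPn h]]]|/existsPn h] :=
      boolP [exists i, exists e, (e \in C' i) && ~~ [exists k, C' i \subset C k]].
    case: (piece_in_piece dec dec' two cr ei) => [|[k sk]]; first by left.
    by case/negP: (h k).
  right=> i e ei; have := h i => /existsPn/(_ e); rewrite ei /= negbK.
  by move/existsP.
case: dec_tri => [[h1 h2]|into']; first by right; split=> //; left.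
have into i e : e \in C i -> exists k, C i \subset C' k.
  move=> ei; case: (piece_in_piece dec' dec two cr ei) => [[]|] //.
have in1 j : C' j != set0 -> exists i, C i = C' j.
  move=> j0; have [/existsP[i /eqP]|/existsPn h] := boolP [exists i, C i == C' j]; first by exists i.
  by case: nfull; apply: (piece_lost dec dec' two cr into into' j0 h).
have [/existsP[i /andP[i0 /existsPn h]]|/existsPn h] :=
    boolP [exists i, (C i != set0) && ~~ [exists j, C' j == C i]]; last first.
  left; split => // i i0; have := h i; rewrite i0 negbK => /existsP[j /eqP].
  by exists j.
have full' : full2 C' (nonloops rho) := piece_lost dec' dec two cr into' into i0 h.
right; split=> //; right; apply: (full_path dec dec' two F0 full' nfull).
by case: full' => p [q [_ Cp _]]; rewrite -Cp; apply: in1; rewrite Cp.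
Qed.

End Structure.

(** * Decompositions into two connected matroids *)

Section Marginal.
Variable E : finType.
Implicit Types (A B D F G K R S T U V W X Y Z : {set E}).
Implicit Types (a b e f g u v w x y z : E) (rho r s : {set E} -> nat).

(* [e] is not in the closure of [X]. *)
Definition dl r e X : bool := r (e |: X) != r X.

Lemma dlE r e X : matroid r -> r (e |: X) = r X + dl r e X.
Proof. by move=> rM; have := rk_setU1 rM e X; rewrite /dl; case: eqP; lia. Qed.

Lemma dl_mono r e X Y : matroid r -> X \subset Y -> dl r e Y -> dl r e X.
Proof. by move=> rM sXY; apply: contraNN => /eqP h; apply/eqP/(cl_mono rM sXY). Qed.

(** The marginals of [e] thus determine all parallel pairs that contain [e], which is the input of
    [cross_determined] for the bipartition into {e} and the rest. *)
Lemma par_dl r Z e y : matroid r -> par r Z e y = dl r e Z && ~~ dl r e (y |: Z).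
Proof.
move=> rM; have := par_count rM Z e y; have := dlE e Z rM; have := dlE e (y |: Z) rM.
have := dl_mono rM (subsetUr [set y] Z) (e := e).
by case: par; case: dl; case: dl => //= h; try (by have := h isT); lia.
Qed.

Lemma comp_sub r G K K' z : matroid r -> conn r K' -> K \subset G -> K' \subset G ->
  r K + r (G :\: K) <= r G -> z \in K -> z \in K' -> K' \subset K.
Proof.
move=> rM cK sK sK' h zK zK'.
have sp := sep_split rM sK h sK'.
have hK : r (K' :&: K) + r (K' :\: (K' :&: K)) <= r K'.
  have -> : K' :\: (K' :&: K) = K' :\: K by clear; by_setP.
  by rewrite -sp.
case: (conn_sep cK (subsetIl _ _) hK) => [/setP/(_ z)|<-]; last exact: subsetIr.
by rewrite !inE zK zK'.
Qed.


End Marginal.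

Section Agree.
Variable E : finType.
Implicit Types (G K S T U V W X Y Z : {set E}).
Implicit Types (a b e f g u v w x y z : E) (rho r s : {set E} -> nat).

(** By [cross_determined], [r] and [s] agree on the component [K] of [x] in [r], and by symmetry [K]
    is also the component in [s]. It contains [e], so the marginals of [e] depend only on the part
    of [S] inside [K]. *)
Lemma component_agree r s G x e S0 : matroid r -> matroid s -> x \in G -> e \in G ->
  S0 \subset G -> e != x -> cross_eq (fun z => z == x) r s G -> par r S0 e x ->
  forall S, S \subset G -> r (e |: S) + s S = s (e |: S) + r S.
Proof.
move=> rM sM xG eG sS0 nex h p.
have comp (u v : {set E} -> nat) (uM : matroid u) (vM : matroid v) : cross_eq (fun z => z == x) u v G -> par u S0 e x ->
    exists K : {set E}, [/\ K \subset G, x \in K, e \in K & [/\ conn u K, u K + u (G :\: K) <= u G,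
      conn v K & forall X, X \subset K -> u X = v X]].
  move=> H pu; have pu' := pu; rewrite parC in pu'.
  have [K [sK xK cK hK]] := component uM xG (par_nonloop uM pu').
  have eK : e \in K.
    by apply: contraTT pu' => eK; rewrite (sep_par uM sK hK sS0 xK eG eK).
  have mK : mixed (fun z => z == x) K by exists e, x; rewrite eK xK eqxx (negPf nex).
  have HK : cross_eq (fun z => z == x) u v K.
    by move=> Z a b sZ aK bK; apply: H; [apply: subset_trans sK|apply: (subsetP sK)..].
  exists K; split=> //; split=> //; last exact: (cross_determined uM vM mK cK HK).
  by apply: (conn_transfer uM vM mK cK) => Z a b sZ aK bK ab; rewrite HK.
have ps : par s S0 e x by rewrite -h // eqxx (negPf nex).
have [K [sK xK eK [crK hK csK eqK]]] := comp r s rM sM h p.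
have [L [sL xL eL [csL hL crL eqL]]] := comp s r sM rM (cross_eq_sym h) ps.
have KL : K = L.
  apply/eqP; rewrite eqEsubset (comp_sub sM csK sL sK hL xL xK).
  by rewrite (comp_sub rM crL sK sL hK xK xL).
move=> S sS; rewrite -KL in hL.
have seS : e |: S \subset G by rewrite subUset sub1set eG.
rewrite (sep_split rM sK hK seS) (sep_split sM sK hL sS) (sep_split sM sK hL seS).
rewrite (sep_split rM sK hK sS) !(eqK (_ :&: _)) ?subsetIr //.
have -> : (e |: S) :\: K = S :\: K by move: eK; clear => *; by_setP.
by clear; lia.
Qed.

Definition fullpair r s rho := [/\ matroid r, matroid s, conn r (nonloops rho),
  conn s (nonloops rho) & forall X, rho X = r X + s X].

Section Pair.
Variables (I : finType) (C : I -> {set E}) (r : I -> {set E} -> nat).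
Variable rho : {set E} -> nat.
Hypothesis dec : decomp C r rho.
Hypothesis two : forall e, rho [set e] <= 2.
Variables p q : I.
Hypotheses (pq : p != q) (npq : ~~ (C p \subset C q)).
Local Notation T := (C p :&: C q).
Local Notation F := (nonloops rho).

Lemma dec_dl_out i e X : e \notin C i -> dl (r i) e X = false.
Proof.
move=> ei; apply/negbTE; rewrite negbK; apply/eqP/(dec_cap_eq dec).
by move: ei; clear => *; by_setP.
Qed.

Lemma dec_dl_cap i e X Y : X :&: C i = Y :&: C i -> dl (r i) e X = dl (r i) e Y.
Proof.
move=> h; rewrite /dl (dec_cap_eq dec h) (@dec_cap_eq _ _ _ _ _ dec i (e |: X) (e |: Y)) //.
by rewrite !setIUl h.
Qed.

Lemma dec_dl_sum M1 M2 e X : fullpair M1 M2 rho ->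
  \sum_i dl (r i) e X = dl M1 e X + dl M2 e X.
Proof.
move=> [M1M M2M _ _ sumE].
have := sumE (e |: X); have := sumE X.
rewrite !(dec_sum dec) (dlE e X M1M) (dlE e X M2M).
have -> : \sum_i r i (e |: X) = \sum_i r i X + \sum_i dl (r i) e X.
  by rewrite -big_split; apply: eq_bigr => i _; rewrite dlE //; apply: (dec_matroid dec).
by clear; lia.
Qed.

Lemma dec_dl_two M1 M2 e X : fullpair M1 M2 rho -> e \in T ->
  dl M1 e X + dl M2 e X = dl (r p) e X + dl (r q) e X.
Proof.
rewrite inE => fp /andP[ep eq']; rewrite -(dec_dl_sum _ _ fp).
rewrite (bigD1 p) //= (bigD1 q) 1?eq_sym //= big1 ?addn0 // => i /andP[ip iq].
rewrite dec_dl_out //; apply/negP => ei.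
by case: (dec_two dec two ep eq' ei pq) => h; rewrite h eqxx in ip iq.
Qed.

(* The marginal [r p (x |: X) - r p X] drops by at most 1 as [X] grows, so [x] interacts with [T] in only one of the two matroids; there the marginals of [x] agree with those in [r p], and [component_agree] transfers this to [e]. *)
Lemma star1 M1 M2 e x V S0 : fullpair M1 M2 rho -> e \in T -> x \in C p ->
  x \notin C q -> S0 \subset T -> par (r p) (S0 :|: V) e x -> par M1 (S0 :|: V) e x ->
  forall S, S \subset x |: T -> dl M1 e (S :|: V) = dl (r p) e (S :|: V).
Proof.
move=> fp eT xp xq sS0 pp pM; have [M1M M2M _ _ _] := fp.
have pM' := dec_matroid dec p.
have TV : e |: (S0 :|: V) \subset T :|: V.
  by rewrite setUA setSU // subUset sub1set eT.
have dpM : dl M1 x V /\ ~~ dl M1 x (T :|: V).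
  move: pM; rewrite parC par_dl // => /andP[h1 h2]; split.
    exact: (dl_mono M1M (subsetUr _ _) h1).
  by apply: contra h2; apply: dl_mono.
have dpp : dl (r p) x V /\ ~~ dl (r p) x (T :|: V).
  move: pp; rewrite parC par_dl // => /andP[h1 h2]; split.
    exact: (dl_mono pM' (subsetUr _ _) h1).
  by apply: contra h2; apply: dl_mono.
(* No piece other than [p] contains [x] and meets [T], so the other pieces contribute a constant. *)
have sum S : S \subset T -> dl M1 x (S :|: V) + dl M2 x (S :|: V) =
    dl (r p) x (S :|: V) + \sum_(i | i != p) dl (r i) x V.
  move=> sS; rewrite -(dec_dl_sum _ _ fp) (bigD1 p) //=; congr (_ + _).
  apply: eq_bigr => i ip; have [xi|xi] := boolP (x \in C i); last by rewrite !dec_dl_out.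
  congr (nat_of_bool _); apply: dec_dl_cap; apply/setP => z; rewrite !inE.
  case: (boolP (z \in S)) => //= zS; have := subsetP sS z zS; rewrite inE => /andP[zp zq].
  have [zi|] := boolP (z \in C i); rewrite ?andbF //.
  case: (dec_two dec two zp zq zi pq) => h; first by rewrite h eqxx in ip.
  by rewrite h (negPf xq) in xi.
(* From the empty set to [T], the marginals in [M1] and in [r p] both drop from 1 to 0, so that of
   [M2] does not change in total and, being monotone, is constant. *)
have Mx S : S \subset T -> dl M1 x (S :|: V) = dl (r p) x (S :|: V).
  move=> sS; have := sum _ (sub0set T); have := sum _ (subxx T); have := sum _ sS.
  rewrite !set0U; case: dpM => -> /negPf ->; case: dpp => -> /negPf ->.
  have := dl_mono M2M (subsetUr S V) (e := x).
  have := dl_mono M2M (setSU V sS) (e := x).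
  move: (\sum_(i | _) _) (dl M1 _ _) (dl M2 _ _) (dl M2 _ _) (dl M2 _ _) (dl (r p) _ _).
  clear => c [] [] [] [] [] //= h1 h2; try (by have := h1 isT); try (by have := h2 isT); lia.
have cross : cross_eq (fun z => z == x) (ctr M1 V) (ctr (r p) V) (x |: T).
  have H Z a : Z \subset x |: T -> a \in x |: T -> a != x ->
      par (ctr M1 V) Z x a = par (ctr (r p) V) Z x a.
    move=> sZ aT ax; rewrite !par_ctr // !par_dl //.
    have aT' : a \in T by move: aT; rewrite in_setU1 (negPf ax).
    have [xZ|xZ] := boolP (x \in Z).
      by rewrite /dl [x |: (Z :|: V)](setUidPr _) ?eqxx // sub1set inE xZ.
    have sZT : Z \subset T.
      apply/subsetP => z zZ; have := subsetP sZ z zZ; rewrite in_setU1.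
      by case: eqP => // zx; rewrite zx (negPf xZ) in zZ.
    by rewrite setUA !Mx // subUset sub1set aT'.
  move=> Z a b sZ aG bG; case: (eqVneq a x) => [->|ax]; case: (eqVneq b x) => [->|bx] // _.
    exact: H.
  by rewrite parC [RHS]parC; apply: H.
move=> S sS.
have := @component_agree (ctr M1 V) (ctr (r p) V) (x |: T) x e S0
  (ctr_matroid M1M V) (ctr_matroid pM' V).
rewrite setU11 in_setU1 eT orbT par_ctr // pM (subset_trans sS0 (subsetUr _ _)).
have ex : e != x by apply: contraNneq xq => <-; move: eT; rewrite inE => /andP[].
move=> /(_ isT isT isT ex cross isT S sS).
have := ctrE M1M V (e |: S); have := ctrE M1M V S.
have := ctrE pM' V (e |: S); have := ctrE pM' V S.
rewrite -!setUA (dlE _ _ M1M) (dlE _ _ pM').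
by case: (dl M1 _ _); case: (dl _ _ _) => //=; clear; lia.
Qed.

(** One of the two matroids copies the marginals of [e] from piece [p] over the context [V]. *)
Definition orient M1 M2 e V :=
  (forall S, S \subset T -> dl M1 e (S :|: V) = dl (r p) e (S :|: V)) \/
  (forall S, S \subset T -> dl M2 e (S :|: V) = dl (r p) e (S :|: V)).

Lemma fullpair_sym M1 M2 : fullpair M1 M2 rho -> fullpair M2 M1 rho.
Proof. by move=> [? ? ? ? h]; split=> // X; rewrite h addnC. Qed.

Lemma star M1 M2 e x V S0 : fullpair M1 M2 rho -> e \in T -> x \in C p ->
  x \notin C q -> S0 \subset T -> par (r p) (S0 :|: V) e x ->
  orient M1 M2 e V /\ orient M1 M2 e (x |: V).
Proof.
move=> fp eT xp xq sS0 pp.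
have [M1M M2M _ _ _] := fp.
have fin M : (forall S, S \subset x |: T -> dl M e (S :|: V) = dl (r p) e (S :|: V)) ->
   (forall S, S \subset T -> dl M e (S :|: V) = dl (r p) e (S :|: V)) /\
   (forall S, S \subset T -> dl M e (S :|: (x |: V)) = dl (r p) e (S :|: (x |: V))).
  move=> H; split=> S sS; first by rewrite H // (subset_trans sS) // subsetUr.
  by rewrite setUCA setUA H // setUS.
have xT : x \notin T by rewrite inE xp.
(* Adding [x] lowers the marginal of [e] in [r p] and leaves that in [r q] unchanged, so it lowers
   the one in [M1] or the one in [M2]. *)
have : par M1 (S0 :|: V) e x || par M2 (S0 :|: V) e x.
  have pM := dec_matroid dec p; move: pp; rewrite !par_dl // => /andP[p1 p2].
  have := dec_dl_two (S0 :|: V) fp eT; have := dec_dl_two (x |: (S0 :|: V)) fp eT.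
  rewrite p1 (negPf p2).
  have -> : dl (r q) e (x |: (S0 :|: V)) = dl (r q) e (S0 :|: V).
    by apply: dec_dl_cap; move: xq; clear => *; by_setP.
  by do 5 case: (dl _ _ _).
case/orP => pM.
  by have [h1 h2] := fin _ (star1 fp eT xp xq sS0 pp pM); split; left.
by have [h1 h2] := fin _ (star1 (fullpair_sym fp) eT xp xq sS0 pp pM); split; right.
Qed.

(** Here exactly one of the two pieces has marginal 1, and [c] tells whether it is [p]. Only on such
    sets do [M1] and [M2] have different marginals of [e]. *)
Definition region e c X := (dl (r p) e X == c) && (dl (r q) e X == ~~ c).

(** The marginals in [M1] and [M2] sum to 1 at both sets and neither increases, so the 1 cannot move
    from one matroid to the other. *)
Lemma region_comparable M1 M2 e c X Y : fullpair M1 M2 rho -> e \in T ->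
  region e c X -> region e c Y -> X \subset Y -> dl M1 e X = dl M1 e Y.
Proof.
move=> fp eT /andP[/eqP x1 /eqP x2] /andP[/eqP y1 /eqP y2] sXY.
have [M1M M2M _ _ _] := fp.
have := dec_dl_two X fp eT; have := dec_dl_two Y fp eT.
have := dl_mono M1M sXY (e := e); have := dl_mono M2M sXY (e := e).
rewrite x1 x2 y1 y2.
case: (dl M1 e X); case: (dl M1 e Y); case: (dl M2 e X); case: (dl M2 e Y); case: c {x1 x2 y1 y2} => //= h1 h2;
 try (by have := h1 isT); by have := h2 isT.
Qed.

(* If [dl M1 e] took different values at two sets of the region, it would do so at [S :|: (W :|: V0)] and [S' :|: (W :|: V0)] for every [W] inside [C p :\: C q], because a [W] where this stops gives a pair as in [star]; but such a pair exists, since [r p] is connected. *)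
Lemma region_label M1 M2 e c X X' : fullpair M1 M2 rho -> e \in T ->
  region e c X -> region e c X' -> dl M1 e X = dl M1 e X'.
Proof.
move=> fp eT RX RX'; case: (eqVneq (dl M1 e X) (dl M1 e X')) => // ne; exfalso.
have pM := dec_matroid dec p; have qM := dec_matroid dec q.
(* The complement of [C p] does not affect [r p], and [U] does not affect [r q]. Adding the one that
   spares the marginal 1 stays in the region, so every set of the region has, via the superset [Y1],
   a normal form that depends only on its trace on [T]. *)
pose U := C p :\: C q; pose V0 := if c then ~: C p else set0; pose W1 := if c then set0 else U.
have eTp : e \in C p by move: eT; rewrite inE => /andP[].
have eTq : e \in C q by move: eT; rewrite inE => /andP[].
have qU Y W : W \subset U -> dl (r q) e (Y :|: W) = dl (r q) e Y.
  by move=> sW; apply: dec_dl_cap; move: sW; rewrite /U; clear => *; by_setP.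
have pV Y : dl (r p) e (Y :|: ~: C p) = dl (r p) e Y.
  by apply: dec_dl_cap; clear; by_setP.
have norm Y : region e c Y -> region e c ((Y :&: T) :|: (W1 :|: V0)) /\
    dl M1 e ((Y :&: T) :|: (W1 :|: V0)) = dl M1 e Y.
  move=> RY.
  pose Y1 := if c then Y :|: ~: C p else Y :|: U.
  have sY : Y \subset Y1 by rewrite /Y1; case: (c); rewrite subsetUl.
  have sY1 : (Y :&: T) :|: (W1 :|: V0) \subset Y1.
    by rewrite /Y1 /W1 /V0 /U; case: (c); clear; by_subset.
  have RY1 : region e c Y1.
    move: RY sY; rewrite /region /Y1; case: (c) => /andP[/eqP h1 /eqP h2] sY.
      rewrite pV h1 eqxx /=; apply/eqP/negbTE; apply: contraFN h2.
      by apply: dl_mono => //.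
    rewrite qU // h2 eqxx andbT; apply/eqP/negbTE; apply: contraFN h1.
    by apply: dl_mono => //.
  have RYn : region e c ((Y :&: T) :|: (W1 :|: V0)).
    move: RY1 sY1; rewrite /region /Y1 /W1 /V0; case: (c) => /andP[/eqP h1 /eqP h2] sY1.
      rewrite (dl_mono pM sY1 h1) (@dec_dl_cap q e _ (Y :|: ~: C p)) ?h2 //.
      by clear; by_setP.
    rewrite (dl_mono qM sY1 h2) (@dec_dl_cap p e _ (Y :|: U)) ?h1 //.
    by rewrite /U; clear; by_setP.
  by split=> //; rewrite (region_comparable fp eT RYn RY1 sY1) (region_comparable fp eT RY RY1 sY).
have [RS eS] := norm X RX; have [RS' eS'] := norm X' RX'.
set S := X :&: T in RS eS; set S' := X' :&: T in RS' eS'.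
have sST : S \subset T by apply: subsetIr.
have sS'T : S' \subset T by apply: subsetIr.
pose inv W := [&& region e c (S :|: (W :|: V0)), region e c (S' :|: (W :|: V0)) &
  dl M1 e (S :|: (W :|: V0)) != dl M1 e (S' :|: (W :|: V0))].
have invW1 : inv W1 by rewrite /inv RS RS' eS eS'.
have inv_orient W : inv W -> ~ orient M1 M2 e (W :|: V0).
  move=> /and3P[/andP[/eqP r1 /eqP r2] /andP[/eqP r1' /eqP r2'] /eqP dM] [] H; case: dM.
    by rewrite !H // r1 r1'.
  have := dec_dl_two (S :|: (W :|: V0)) fp eT; have := dec_dl_two (S' :|: (W :|: V0)) fp eT.
  rewrite !H // r1 r1' r2 r2'.
  by case: (dl M1 _ _); case: (dl M1 _ _); case: (c).
(* If [e] and [y] were parallel in [r p] here, [star] would orient the context both with and without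
   [y], contradicting the disagreement. So [y] changes no marginal of [e] in the two pieces, and
   [region_comparable] preserves the values of [M1]. *)
have tog W y : y \in U -> inv W = inv (y |: W).
  rewrite inE => /andP[yq yp].
  have [/orP h|] := boolP (inv W || inv (y |: W)); last by case: (inv W); case: (inv _).
  have eyS R : R :|: (y |: W :|: V0) = y |: (R :|: (W :|: V0)) by rewrite -!setUA setUCA.
  have nopar (R : {set E}) : R \subset T -> ~~ par (r p) (R :|: (W :|: V0)) e y.
    move=> sR; apply/negP => pr; have [o1 o2] := star fp eT yp yq sR pr.
    by case: h => h; [apply: (inv_orient _ h)|apply: (inv_orient _ h); rewrite -setUA].
  have same (R : {set E}) : R \subset T -> region e c (R :|: (y |: W :|: V0)) = region e c (R :|: (W :|: V0)).
    move=> sR; have := nopar R sR; rewrite par_dl // /region !eyS.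
    have -> : dl (r q) e (y |: (R :|: (W :|: V0))) = dl (r q) e (R :|: (W :|: V0)).
      by apply: dec_dl_cap; move: yq; clear; move: V0 W => V W *; by_setP.
    have := dl_mono pM (subsetUr [set y] (R :|: (W :|: V0))) (e := e).
    by case: (dl (r p) _ _); case: (dl (r p) _ _) => // /(_ isT).
  rewrite /inv !same //; case RR: (region e c (S :|: _)) => //=.
  case RR': (region e c (S' :|: _)) => //=.
  have sub R : R :|: (W :|: V0) \subset R :|: (y |: W :|: V0) by rewrite eyS subsetUr.
  rewrite (region_comparable fp eT RR _ (sub S)) ?same //.
  by rewrite (region_comparable fp eT RR' _ (sub S')) ?same.
have toempty W : W \subset U -> inv W = inv set0.
  elim/set_ind: W => // y W yW IH; rewrite subUset sub1set => /andP[yU sW].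
  by rewrite -tog // IH.
have [y yp yq] := subsetPn npq.
have ey : e != y by apply: contraNneq yq => <-.
have [Z sZ pZ] := conn_par pM (dec_conn dec p) eTp yp ey.
have sZU : Z :\: C q \subset U by apply: setSD.
have : inv (Z :\: C q).
  by rewrite toempty // -(toempty W1) // /W1; case: (c); rewrite ?sub0set.
move/inv_orient; case; suff [] : orient M1 M2 e (Z :\: C q :|: V0) /\
  orient M1 M2 e (y |: (Z :\: C q :|: V0)) by [].
apply: (star (S0 := Z :&: T)) => //; first exact: subsetIr.
rewrite -(dec_par_cap dec (Z := Z)) //.
by rewrite /V0; case: (c); move: sZ; clear; move=> *; by_setP.
Qed.

(** By [region_label], [M1] is constant on each of the two regions. If the constants differ, one of
    [M1], [M2] has the marginals of [e] of [r q], so no [y] outside [C q] is ever parallel to [e] in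
    it, although it is connected. Equal constants give the maximum and the minimum. *)
Lemma nested M1 M2 e : fullpair M1 M2 rho -> e \in T ->
  (forall X, dl M1 e X = dl (r p) e X || dl (r q) e X /\
     dl M2 e X = dl (r p) e X && dl (r q) e X) \/
  (forall X, dl M2 e X = dl (r p) e X || dl (r q) e X /\
     dl M1 e X = dl (r p) e X && dl (r q) e X).
Proof.
move=> fp eT; have [M1M M2M c1 c2 _] := fp.
have sum X := dec_dl_two X fp eT.
pose bad (b : bool) := [exists X : {set E}, (dl (r p) e X != dl (r q) e X) && (dl M1 e X == b)].
have [/existsP[X0 /andP[n0 /eqP m0]]|/existsPn nb] := boolP (bad false); last first.
  left=> X; have := nb X; have := sum X.
  by case: (dl _ _ _); case: (dl _ _ _); case: (dl _ _ _); case: (dl _ _ _).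
have [/existsP[X1 /andP[n1 /eqP m1]]|/existsPn nb] := boolP (bad true); last first.
  right=> X; have := nb X; have := sum X.
  by case: (dl _ _ _); case: (dl _ _ _); case: (dl _ _ _); case: (dl _ _ _).
exfalso; have [y yp yq] := subsetPn npq.
move: (eT); rewrite inE => /andP[ep eq'].
have ey : e != y by apply: contraNneq yq => <-.
have eF := subsetP (dec_sub dec p) e ep; have yF := subsetP (dec_sub dec p) y yp.
have fin M : matroid M -> conn M F -> (forall X, dl M e X = dl (r q) e X) -> False.
  move=> MM cM H; have [Z _] := conn_par MM cM eF yF ey.
  rewrite par_dl // !H (@dec_dl_cap q e (y |: Z) Z); first by case: dl.
  by move: yq; clear => *; by_setP.
have lab (c : bool) X Y := @region_label M1 M2 e c X Y fp eT; rewrite /region in lab.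
case p1: (dl (r p) e X1) in n1 *.
  have q1 : dl (r q) e X1 = false by case: dl n1.
  have p0 : dl (r p) e X0 = false.
    case p0 : (dl (r p) e X0) => //; have := lab true X0 X1.
    by rewrite p1 q1 m0 m1 p0 /=; rewrite p0 in n0; case: dl n0 => // _ /(_ isT isT).
  have q0 : dl (r q) e X0 by move: n0; rewrite p0; case: dl.
  apply: (fin M2 M2M c2) => X; have := sum X; have := lab true X X1; have := lab false X X0.
  rewrite p1 q1 p0 q0 m0 m1.
  case: (dl (r p) e X); case: (dl (r q) e X); case: (dl M1 e X); case: (dl M2 e X) => //= h1 h2;
   try (by have := h1 isT isT); by have := h2 isT isT.
have q1 : dl (r q) e X1 by case: dl n1.
have p0 : dl (r p) e X0.
  case p0 : (dl (r p) e X0) => //; have := lab false X0 X1.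
  by rewrite p1 q1 m0 m1 p0 /=; rewrite p0 in n0; case: dl n0 => // _ /(_ isT isT).
have q0 : dl (r q) e X0 = false by move: n0; rewrite p0; case: dl.
apply: (fin M1 M1M c1) => X; have := sum X; have := lab true X X0; have := lab false X X1.
rewrite p1 q1 p0 q0 m0 m1.
case: (dl (r p) e X); case: (dl (r q) e X); case: (dl M1 e X); case: (dl M2 e X) => //= h1 h2;
 try (by have := h1 isT isT); by have := h2 isT isT.
Qed.

Lemma dl_determined M N e y : matroid M -> matroid N -> conn M F -> e \in F -> y \in F ->
  e != y -> (forall X, dl M e X = dl N e X) -> forall X, X \subset F -> M X = N X.
Proof.
move=> MM NM cM eF yF ey h.
apply: (@cross_determined _ (fun z => z == e)) => //.
  by exists e, y; rewrite eqxx [y == e]eq_sym (negPf ey).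
move=> Z a b _ _ _; case: (eqVneq a e) => [->|ae]; case: (eqVneq b e) => [->|be] // _.
  by rewrite !par_dl // !h.
by rewrite parC [RHS]parC !par_dl // !h.
Qed.

(** By [nested], the marginals of [e] in every full pair are the same maximum and minimum up to
    order, and [dl_determined] recovers connected matroids from them. *)
Lemma fullpair_unique M1 M2 N1 N2 : T != set0 -> fullpair M1 M2 rho -> fullpair N1 N2 rho ->
  (forall X, X \subset F -> M1 X = N1 X /\ M2 X = N2 X) \/
  (forall X, X \subset F -> M1 X = N2 X /\ M2 X = N1 X).
Proof.
move=> /set0Pn[e eT] fM fN; have [y yp yq] := subsetPn npq.
move: (eT); rewrite inE => /andP[ep eq'].
have ey : e != y by apply: contraNneq yq => <-.
have eF := subsetP (dec_sub dec p) e ep; have yF := subsetP (dec_sub dec p) y yp.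
have [M1M M2M c1 c2 _] := fM; have [N1M N2M _ _ _] := fN.
have D M N MM NM cM := @dl_determined M N e y MM NM cM eF yF ey.
by case: (nested fM eT) => hM; case: (nested fN eT) => hN; [left|right|right|left] => X sX;
  split; apply: D sX => // Y; case: (hM Y) => h1 h2; case: (hN Y) => h3 h4; rewrite ?h1 ?h2 ?h3 ?h4.
Qed.

End Pair.
End Agree.

(** * Decompositions whose supports form a triangle or a path *)

Section Thin.
Variable E : finType.
Implicit Types (G K S T U V W X Y Z : {set E}).
Implicit Types (a b e f g u v w x y z : E) (rho : {set E} -> nat).

(** A crossing pair inside [C b] lies in no other support, so the common count of parallel pieces is
    the contribution of piece [b] alone. *)
Lemma piece_unique (I : finType) (C : I -> {set E}) (r r' : I -> {set E} -> nat) rho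
  (b : I) (blk : E -> bool) : decomp C r rho -> decomp C r' rho -> mixed blk (C b) ->
  (forall i e x, i != b -> e \in C i -> x \in C i -> e \in C b -> x \in C b -> blk e = blk x) ->
  forall X, r b X = r' b X.
Proof.
move=> dec dec' mix h X; rewrite (dec_cap dec) (dec_cap dec').
apply: (cross_determined (dec_matroid dec b) (dec_matroid dec' b) mix (dec_conn dec b)); last exact: subsetIr.
move=> Z e x sZ eb xb ex; have := par_sum_eq dec dec' Z e x.
rewrite (bigD1 b) //= [in RHS](bigD1 b) //= !big1 ?addn0; last 2 first.
- move=> i ib; case p : par => //; have /andP[ei xi] := dec_par_in dec' p.
  by rewrite (h i e x) ?eqxx in ex.
- move=> i ib; case p : par => //; have /andP[ei xi] := dec_par_in dec p.
  by rewrite (h i e x) ?eqxx in ex.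
by case: par; case: par.
Qed.

Section One.
Variables (I : finType) (C : I -> {set E}).
Implicit Types r : I -> {set E} -> nat.
Variable rho : {set E} -> nat.
Hypothesis two : forall e, rho [set e] <= 2.
Local Notation F := (nonloops rho).

Definition thin := triangle C F \/ path3 C F.

Definition single_pair (b : I) e x := [/\ e != x, e \in C b, x \in C b &
  forall i, i != b -> ~~ ((e \in C i) && (x \in C i))].

Lemma triangle_meet i j k (G : {set E}) : C i :|: C k = G -> C j :|: C k = G -> C k != G ->
  C k \subset G -> exists2 e, e \in C i & e \in C j.
Proof.
move=> ik jk kG sk; have : ~~ (G \subset C k) by apply: contra kG => h; rewrite eqEsubset sk.
case/subsetPn => e; rewrite -{1}ik inE => /orP[ei|->] // ek.
exists e => //; have : e \in G by rewrite -ik inE ei.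
by rewrite -jk inE (negPf ek) orbF.
Qed.

Lemma thin_pieces r : decomp C r rho -> thin -> exists p q,
  [/\ p != q, C p :&: C q != set0 & ~~ (C p \subset C q)].
Proof.
move=> dec [[i [j [k [[ij ik jk] [[h1 h2 h3 h4] [n1 n2 n3]]]]]]|
           [i [j [k [[ij ik jk] [[h1 h2 h3] [n1 n2 n3]]]]]]]; exists i, j; split => //.
- have [e ei ej] := triangle_meet h2 h3 n3 (dec_sub dec k).
  by apply/set0Pn; exists e; rewrite inE ei.
- by apply: contra n2 => h; rewrite -h1 (setUidPr h).
- by rewrite h1 (setIidPr (dec_sub dec j)).
- rewrite h1; apply: contra n3 => h; apply/eqP/setP => z; rewrite inE; apply/negP => zk.
  by move/setP/(_ z): h3; rewrite !inE zk (subsetP h z) // (subsetP (dec_sub dec k)).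
Qed.

Lemma thin_single r : decomp C r rho -> thin -> exists (b : I) e x, single_pair b e x.
Proof.
move=> dec [[i [j [k [[ij ik jk] [[h1 h2 h3 h4] [n1 n2 n3]]]]]]|
           [i [j [k [[ij ik jk] [[h1 h2 h3] [/set0Pn[z zi] /set0Pn[e ej] /set0Pn[x xk]]]]]]]].
- have [e ei ej] := triangle_meet h2 h3 n3 (dec_sub dec k).
  have [x xi xk] := triangle_meet h1 (etrans (setUC (C k) (C j)) h3) n2 (dec_sub dec j).
  have nek : e \notin C k by apply/negP => ek; move/setP/(_ e): h4; rewrite !inE ei ej ek.
  exists i, e, x; split=> //; first by apply: contraNneq nek => ->.
  move=> l li; apply/negP => /andP[el xl].
  case: (dec_two dec two ei ej el ij) => hl; first by rewrite hl eqxx in li.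
  by move/setP/(_ x): h4; rewrite !inE xi xk -hl xl.
have nek : e \notin C k by apply/negP => ek; move/setP/(_ e): h3; rewrite !inE ej ek.
have [ei xi] : e \in C i /\ x \in C i.
  by rewrite h1 (subsetP (dec_sub dec j)) // (subsetP (dec_sub dec k)).
exists i, e, x; split=> //; first by apply: contraNneq nek => ->.
move=> l li; apply/negP => /andP[el xl].
case: (dec_two dec two ei ej el ij) => hl; first by rewrite hl eqxx in li.
by move/setP/(_ x): h3; rewrite !inE xk -hl xl.
Qed.

(** Inside [C i] the label tells whether the second support of an element is [C k] or [C j]. *)
Lemma triangle_unique1 r r' i j k : decomp C r rho -> decomp C r' rho ->
  i != j -> i != k -> j != k -> C i :|: C j = F -> C i :|: C k = F -> C j :|: C k = F ->
  C i :&: C j :&: C k = set0 -> C j != F -> C k != F -> forall X, r i X = r' i X.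
Proof.
move=> dec dec' ij ik jk h1 h2 h3 h4 n2 n3.
have [e ei ej] := triangle_meet h2 h3 n3 (dec_sub dec k).
have [x xi xk] := triangle_meet h1 (etrans (setUC (C k) (C j)) h3) n2 (dec_sub dec j).
have nek : e \notin C k by apply/negP => ek; move/setP/(_ e): h4; rewrite !inE ei ej ek.
apply: (piece_unique (blk := fun z => z \in C k) dec dec').
  by exists e, x; rewrite ei xi xk (negPf nek).
move=> l u v li ul vl ui vi; case: (boolP (u \in C k)) => uk; case: (boolP (v \in C k)) => vk //; exfalso.
  have vj : v \in C j.
    by have : v \in F := subsetP (dec_sub dec i) v vi; rewrite -h3 inE (negPf vk) orbF.
  case: (dec_two dec two ui uk ul ik) => hl; first by rewrite hl eqxx in li.
  by rewrite hl (negPf vk) in vl.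
have uj : u \in C j.
  by have : u \in F := subsetP (dec_sub dec i) u ui; rewrite -h3 inE (negPf uk) orbF.
case: (dec_two dec two vi vk vl ik) => hl; first by rewrite hl eqxx in li.
by rewrite hl (negPf uk) in ul.
Qed.

Lemma dec_empty r i X : decomp C r rho -> C i = set0 -> r i X = 0.
Proof. by move=> dec h; rewrite (dec_cap dec) h setI0 (rk0 (dec_matroid dec i)). Qed.

Lemma triangle_cover r i j k l : decomp C r rho -> i != j -> i != k -> j != k ->
  C i :|: C j = F -> C i :|: C k = F -> C j :|: C k = F -> C l != set0 ->
  [|| l == i, l == j | l == k].
Proof.
move=> dec ij ik jk h1 h2 h3 /set0Pn[z zl].
have zF := subsetP (dec_sub dec l) z zl.
have [zi|zi] := boolP (z \in C i); last first.
  have zj : z \in C j by move: zF; rewrite -h1 inE (negPf zi).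
  have zk : z \in C k by move: zF; rewrite -h2 inE (negPf zi).
  by case: (dec_two dec two zj zk zl jk) => ->; rewrite eqxx ?orbT.
move: zF; rewrite -h3 inE => /orP[zj|zk].
  by case: (dec_two dec two zi zj zl ij) => ->; rewrite eqxx ?orbT.
by case: (dec_two dec two zi zk zl ik) => ->; rewrite eqxx ?orbT.
Qed.

Lemma path_cover r i j k l : decomp C r rho -> i != j -> i != k ->
  C i = F -> C j :|: C k = F -> C l != set0 -> [|| l == i, l == j | l == k].
Proof.
move=> dec ij ik h1 h2 /set0Pn[z zl].
have zF := subsetP (dec_sub dec l) z zl; have zi : z \in C i by rewrite h1.
move: zF; rewrite -h2 inE => /orP[zj|zk].
  by case: (dec_two dec two zi zj zl ij) => ->; rewrite eqxx ?orbT.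
by case: (dec_two dec two zi zk zl ik) => ->; rewrite eqxx ?orbT.
Qed.

(** In a path, the middle piece is determined by [piece_unique]; the two others have disjoint
    supports and are then determined by the remainder of [rho]. *)
Lemma thin_unique r r' : decomp C r rho -> decomp C r' rho -> thin ->
  forall i X, r i X = r' i X.
Proof.
move=> dec dec' [[i [j [k [[ij ik jk] [[h1 h2 h3 h4] [n1 n2 n3]]]]]]|
           [i [j [k [[ij ik jk] [[h1 h2 h3] [n1 n2 n3]]]]]]] l X.
- have [l0|l0] := eqVneq (C l) set0; first by rewrite (dec_empty _ dec) // (dec_empty _ dec').
  case/or3P: (triangle_cover dec ij ik jk h1 h2 h3 l0) => /eqP->.
  + exact: (triangle_unique1 (j := j) (k := k) dec dec').
  + apply: (triangle_unique1 (j := i) (k := k) dec dec') => //; first by rewrite eq_sym.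
      by rewrite setUC.
    by rewrite (setIC (C j)).
  + apply: (triangle_unique1 (j := i) (k := j) dec dec'); rewrite // 1?eq_sym // 1?setUC //.
    by rewrite -setIA setIC.
have disj z : z \in C j -> z \in C k -> False.
  by move=> zj zk; move/setP/(_ z): h3; rewrite !inE zj zk.
have iF z : z \in F -> z \in C i by rewrite h1.
have other m z : z \in C m -> [|| m == i, m == j | m == k].
  by move=> zm; apply: (path_cover dec ij ik h1 h2); apply/set0Pn; exists z.
have ri Y : r i Y = r' i Y.
  have [[e ej] [x xk]] := (set0Pn _ n2, set0Pn _ n3).
  apply: (piece_unique (blk := fun z => z \in C j) dec dec').
    exists e, x; rewrite !iF ?(subsetP (dec_sub dec j) e) ?(subsetP (dec_sub dec k) x) //.
    by split=> //; rewrite ej; apply/eqP => xj; apply: (disj x).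
  move=> m u v mi um vm _ _; have := other m u um; rewrite (negPf mi) /=.
  case/orP => /eqP em; rewrite em in um vm; first by rewrite um vm.
  have nj z : z \in C k -> (z \in C j) = false by move=> zk; apply/negP => zj; apply: (disj z).
  by rewrite !nj.
have rest Y : \sum_(m | m != i) r m Y = \sum_(m | m != i) r' m Y.
  have := dec_sum dec Y; rewrite (dec_sum dec' Y) (bigD1 i) //= [in RHS](bigD1 i) //= ri.
  by move/addnI.
have one m : m != i -> r m X = r' m X.
  move=> mi; rewrite (dec_cap dec) (dec_cap dec').
  have := rest (X :&: C m); rewrite (bigD1 m) //= [in RHS](bigD1 m) //=.
  have zero m' : m' != i -> m' != m -> X :&: C m :&: C m' = set0.
    move=> m'i m'm; apply/setP => z; rewrite !inE; apply/negP => /andP[/andP[_ zm] zm'].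
    have := other _ _ zm; have := other _ _ zm'; rewrite (negPf mi) (negPf m'i) /=.
    by case/orP => /eqP e1; case/orP => /eqP e2; rewrite e1 e2 ?eqxx // in zm zm' m'm; case: (disj z).
  rewrite big1 => [|m' /andP[m'i m'm]]; last first.
    by rewrite (dec_cap dec) zero ?(rk0 (dec_matroid dec m')).
  rewrite big1 ?addn0 // => m' /andP[m'i m'm].
  by rewrite (dec_cap dec') zero ?(rk0 (dec_matroid dec' m')).
by have [->|li] := eqVneq l i; [exact: ri | exact: one].
Qed.

(** Over a suitable [Z] the pair is parallel in exactly one piece, whereas two equal matroids would
    contribute an even number. *)
Lemma single_neq r M1 M2 (b : I) e x : decomp C r rho -> fullpair M1 M2 rho ->
  single_pair b e x -> ~ (forall X, M1 X = M2 X).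
Proof.
move=> dec [M1M M2M _ _ sumE] [ex eb xb h] eM.
have [Z sZ p] := conn_par (dec_matroid dec b) (dec_conn dec b) eb xb ex.
have := dec_par_sum dec Z e x; have := par_count M1M Z e x.
rewrite !sumE -!eM (bigD1 b) //= p big1 ?addn0 => [|i ib]; last first.
  by case q : par => //; have := dec_par_in dec q; rewrite (negPf (h i ib)).
by case: par => /=; clear; lia.
Qed.

Lemma same_pieces_full (I' : finType) (C' : I' -> {set E}) r (r' : I' -> {set E} -> nat) :
  decomp C r rho -> decomp C' r' rho -> F != set0 -> same_pieces C C' -> full2 C' F ->
  full2 C F.
Proof.
move=> dec dec' /set0Pn[e eF] [sp _] [p [q [pq Cp Cq]]].
have CF i : e \in C i -> C i = F.
  move=> ei; have [|l hl] := sp i; first by apply/set0Pn; exists e.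
  rewrite -hl in ei *; have ep : e \in C' p by rewrite Cp.
  have eq : e \in C' q by rewrite Cq.
  by case: (dec_two dec' two ep eq ei pq) => ->.
have : 1 < #|[set i | e \in C i]|.
  rewrite -(dec_count dec) (dec_count dec').
  have -> : 2 = #|[set p; q]| by rewrite cards2 pq.
  by apply: subset_leq_card; apply/subsetP => i; rewrite !inE => /orP[]/eqP->; rewrite ?Cp ?Cq.
case/card_gt1P => i [j [ei ej ij]]; rewrite !inE in ei ej.
by exists i, j; split=> //; apply: CF.
Qed.

End One.
End Thin.

(** * Colourings of graphs *)

Definition colset (V : finType) (adj : rel V) k : {set {ffun V -> 'I_k}} :=
  [set c : {ffun V -> 'I_k} | [forall u, forall v, adj u v ==> (c u != c v)]].

Definition col (V : finType) (adj : rel V) k := #|colset adj k|.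

Lemma colsetP (V : finType) (adj : rel V) k (c : {ffun V -> 'I_k}) :
  reflect (forall u v, adj u v -> c u != c v) (c \in colset adj k).
Proof.
rewrite inE; apply: (iffP forallP) => [h u v|h u].
  by have /forallP/(_ v)/implyP := h u.
by apply/forallP => v; apply/implyP; apply: h.
Qed.

Lemma col_relabel (V V' : finType) (adj : rel V) (adj' : rel V') (f : V -> V') k :
  bijective f -> (forall u v, adj u v = adj' (f u) (f v)) -> col adj k = col adj' k.
Proof.
move=> [g fK gK] h.
pose phi (c : {ffun V' -> 'I_k}) : {ffun V -> 'I_k} := [ffun v => c (f v)].
have phi_bij : bijective phi.
  exists (fun c : {ffun V -> 'I_k} => [ffun v => c (g v)]) => c; apply/ffunP => v;
    by rewrite !ffunE ?fK ?gK.
rewrite /col -(on_card_preimset (f := phi)); last exact: onW_bij.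
congr #|pred_of_set _|; apply/setP => c; rewrite inE.
apply/colsetP/colsetP => H u v uv.
  by have := H (g u) (g v); rewrite h !gK !ffunE !gK; apply.
by rewrite !ffunE; apply: H; rewrite -h.
Qed.

Definition adj_sum (V W : finType) (a : rel V) (b : rel W) : rel (V + W) := fun x y =>
  match x, y with inl u, inl v => a u v | inr u, inr v => b u v | _, _ => false end.

Lemma col_sum (V W : finType) (a : rel V) (b : rel W) k :
  col (adj_sum a b) k = col a k * col b k.
Proof.
pose phi (c : {ffun V + W -> 'I_k}) : {ffun V -> 'I_k} * {ffun W -> 'I_k} :=
  ([ffun v => c (inl v)], [ffun w => c (inr w)]).
have phi_bij : bijective phi.
  exists (fun c : {ffun V -> 'I_k} * {ffun W -> 'I_k} =>
    [ffun x => match x with inl v => c.1 v | inr w => c.2 w end]).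
    by move=> c; apply/ffunP => -[v|w]; rewrite !ffunE.
  by move=> [c d]; congr (_, _); apply/ffunP => v; rewrite !ffunE.
rewrite /col -cardsX -(on_card_preimset (f := phi)); last exact: onW_bij.
congr #|pred_of_set _|; apply/setP => c; rewrite [in RHS]inE in_setX.
apply/colsetP/andP => [H|[/colsetP h1 /colsetP h2] [u|u] [v|v] //= uv].
- by split; apply/colsetP => u v uv; rewrite !ffunE; apply: H.
- by have := h1 u v uv; rewrite !ffunE.
- by have := h2 u v uv; rewrite !ffunE.
Qed.

Lemma card_dep_pairs (A B : finType) (P : pred A) (Q : A -> pred B) :
  #|[set x : A * B | P x.1 && Q x.1 x.2]| = \sum_(a | P a) #|[set b | Q a b]|.
Proof.
rewrite -sum1_card (eq_bigl (fun x : A * B => P x.1 && Q x.1 x.2)); last by move=> x; rewrite inE.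
rewrite -(pair_big_dep P Q (fun _ _ => 1)) /=.
by apply: eq_bigr => a _; rewrite sum1_card; apply: eq_card => b; rewrite inE.
Qed.

(** The vertex [None] is simplicial: its neighbours form a clique, so a colouring of the rest uses
    pairwise different colours on them. *)
Lemma col_simplicial (T : finType) (adj : rel (option T)) k :
  irreflexive adj -> symmetric adj ->
  (forall x y, adj None (Some x) -> adj None (Some y) -> x != y -> adj (Some x) (Some y)) ->
  col adj k = col (fun x y => adj (Some x) (Some y)) k * (k - #|[set x | adj None (Some x)]|).
Proof.
move=> irr sym clique; set N := [set x | _]; set adj' := fun x y => _.
pose ext (p : {ffun T -> 'I_k} * 'I_k) : {ffun option T -> 'I_k} :=
  [ffun o => if o is Some x then p.1 x else p.2].
have ext_inj : injective ext.
  move=> [c a] [d b] /ffunP e; congr (_, _); last by have := e None; rewrite !ffunE.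
  by apply/ffunP => x; have := e (Some x); rewrite !ffunE.
pose S := [set p : {ffun T -> 'I_k} * 'I_k | (p.1 \in colset adj' k) && (p.2 \notin p.1 @: N)].
have -> : col adj k = #|S|.
  rewrite -(card_imset _ ext_inj); apply: eq_card => c.
  apply/colsetP/imsetP => [H|[[d a]]].
    exists ([ffun x => c (Some x)], c None); last by apply/ffunP => -[x|]; rewrite !ffunE.
    rewrite inE /=; apply/andP; split.
      by apply/colsetP => x y xy; rewrite !ffunE; apply: H.
    by apply/imsetP => -[x]; rewrite inE ffunE => /H/eqP.
  rewrite inE /= => /andP[/colsetP hd ha] -> [x|] [y|]; rewrite ?irr // !ffunE /=.
  - exact: hd.
  - rewrite sym => ax; apply: contraNneq ha => <-; apply: imset_f; by rewrite inE.
  - by move=> ay; apply: contraNneq ha => ->; apply: imset_f; rewrite inE.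
rewrite (@card_dep_pairs _ _ (fun c => c \in colset adj' k) (fun c a => a \notin c @: N)).
rewrite (eq_bigr (fun _ => k - #|N|)) ?sum_nat_const // => c /colsetP hc.
have -> : [set b | b \notin c @: N] = ~: (c @: N) by apply/setP => b; rewrite !inE.
rewrite cardsCs setCK card_ord; congr (_ - _); apply: card_in_imset => x y.
rewrite !inE => xN yN /eqP; apply: contraTeq => xy.
by apply: hc; apply: clique.
Qed.

(* Grouping the colourings by their image expresses their number as a combination of binomial coefficients. *)
Lemma col_binomial (V : finType) (adj : rel V) :
  exists f : nat -> nat, forall k, col adj k = \sum_(m < #|V|.+1) 'C(k, m) * f m.
Proof.
pose f m := #|[set c in colset adj m | c @: setT == setT]|.
exists f => k.
have f0 m : #|V| < m -> f m = 0.
  move=> Vm; apply/eqP; rewrite cards_eq0; apply/eqP/setP => c; rewrite !inE.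
  apply/negP => /andP[_ /eqP h]; have := leq_imset_card c setT.
  by rewrite h !cardsT card_ord leqNgt Vm.
(* Colourings with image [B] correspond to surjective colourings with [#|B|] colours, whose number
   depends only on the size of [B]. *)
have step (B : {set 'I_k}) : #|[set c in colset adj k | c @: setT == B]| = f #|B|.
  pose h (c : {ffun V -> 'I_#|B|}) : {ffun V -> 'I_k} := [ffun v => enum_val (c v)].
  have h_inj : injective h.
    move=> c d /ffunP e; apply/ffunP => v; have := e v; rewrite !ffunE.
    exact: enum_val_inj.
  rewrite /f -(card_imset _ h_inj); apply: eq_card => c; rewrite !inE.
  apply/andP/imsetP => [[/forallP hc /eqP hB]|[d]].
    have cB v : c v \in B by rewrite -hB; apply: imset_f.
    exists [ffun v => enum_rank_in (cB v) (c v)]; last first.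
      by apply/ffunP => v; rewrite !ffunE enum_rankK_in.
    rewrite !inE; apply/andP; split.
      apply/forallP => u; apply/forallP => v; apply/implyP => uv; rewrite !ffunE.
      have /forallP/(_ v) := hc u; rewrite uv; apply: contraNneq => e.
      by rewrite -(enum_rankK_in (cB u) (cB u)) e enum_rankK_in.
    rewrite eqEsubset subsetT; apply/subsetP => i _.
    have := enum_valP i; rewrite -{2}hB => /imsetP[v _ e].
    apply/imsetP; exists v => //; rewrite ffunE; apply: enum_val_inj.
    by rewrite enum_rankK_in.
  rewrite !inE => /andP[/forallP hd /eqP dT] ->; split.
    apply/forallP => u; apply/forallP => v; apply/implyP => uv; rewrite !ffunE.
    have /forallP/(_ v) := hd u; rewrite uv /=.
    by apply: contra_neq => /enum_val_inj.
  rewrite eqEsubset; apply/andP; split; apply/subsetP => b.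
    by case/imsetP => v _ ->; rewrite ffunE enum_valP.
  move=> bB; have := in_setT (enum_rank_in bB b); rewrite -dT => /imsetP[v _ e].
  by apply/imsetP; exists v; rewrite // ffunE -e enum_rankK_in.
have -> : col adj k = \sum_(B : {set 'I_k}) f #|B|.
  rewrite /col -sum1_card (partition_big (fun c : {ffun V -> 'I_k} => c @: setT) predT) //=.
  apply: eq_bigr => B _; rewrite -step -sum1_card; apply: eq_bigl => c.
  by rewrite [in RHS]inE.
have cardB (B : {set 'I_k}) : #|B| < k.+1 by rewrite ltnS -[k in _ <= k]card_ord max_card.
rewrite (partition_big (fun B : {set 'I_k} => Ordinal (cardB B)) predT) //=.
have H (m : 'I_k.+1) : \sum_(B : {set 'I_k} | Ordinal (cardB B) == m) f #|B| = 'C(k, m) * f m.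
  rewrite (eq_bigr (fun _ => f m)) => [|B /eqP <-] //.
  rewrite sum_nat_const; congr (_ * _); rewrite -[k in 'C(k, _)]card_ord -card_draws.
  by apply: eq_card => B; rewrite !inE.
rewrite (eq_bigr _ (fun m _ => H m)).
(* The sum runs up to [k] so far. Beyond [k] the binomial coefficient vanishes and beyond [#|V|] the
   factor [f m], so both ranges extend to their maximum. *)
have wide N n : (forall m, n < m -> 'C(k, m) * f m = 0) -> n <= N ->
    \sum_(m < n.+1) 'C(k, m) * f m = \sum_(m < N.+1) 'C(k, m) * f m.
  move=> z nN; rewrite -!(big_mkord xpredT (fun m => 'C(k, m) * f m)).
  rewrite [RHS](big_cat_nat _ (n := n.+1)) //=.
  rewrite [X in _ + X]big_nat_cond [X in _ + X]big1 ?addn0 // => m /andP[/andP[nm _] _].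
  exact: z.
rewrite (@wide (maxn k #|V|)) ?leq_maxl //; last by move=> m km; rewrite bin_small.
by rewrite -(@wide (maxn k #|V|) #|V|) ?leq_maxr // => m /f0 ->; rewrite muln0.
Qed.

Section ChromaticPolynomial.
Import GRing.Theory Num.Theory.
Local Open Scope ring_scope.

Lemma binomial_poly m : exists p : {poly rat}, forall k : nat, p.[k%:R] = 'C(k, m)%:R.
Proof.
exists ((m`!%:R)^-1 *: \prod_(i < m) ('X - (i%:R)%:P)) => k.
rewrite hornerZ horner_prod.
have -> : \prod_(i < m) ('X - (i%:R)%:P).[k%:R] = (k ^_ m)%:R :> rat.
  have [km|mk] := ltnP k m.
    rewrite ffact_small // (bigD1 (Ordinal km)) //= !hornerE subrr mul0r //.
  rewrite ffact_prod natr_prod; apply: eq_bigr => i _.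
  by rewrite !hornerE natrB // (leq_trans (ltnW (ltn_ord i))).
by rewrite -bin_ffact natrM mulrC mulfK // pnatr_eq0 -lt0n fact_gt0.
Qed.

Lemma col_poly (V : finType) (adj : rel V) :
  exists p : {poly rat}, forall k : nat, p.[k%:R] = (col adj k)%:R.
Proof.
have [f hf] := col_binomial adj.
have [P hP] : exists P : 'I_#|V|.+1 -> {poly rat}, forall m k, (P m).[k%:R] = 'C(k, m)%:R.
  have h (m : 'I_#|V|.+1) := binomial_poly m.
  by have [P hP] := fin_all_exists h; exists P.
exists (\sum_(m < #|V|.+1) (f m)%:R *: P m) => k.
rewrite hf horner_sum natr_sum; apply: eq_bigr => m _.
by rewrite hornerZ hP natrM mulrC.
Qed.

End ChromaticPolynomial.

(** * Counting tuples *)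

Section Tuples.
Variable E : finType.
Implicit Types (A B F G K S T U V W X Y Z : {set E}).
Implicit Types (a b e f g u v w x y z : E) (rho r s : {set E} -> nat).

Definition matroidb r := [&& r set0 == 0,
  [forall X : {set E}, forall Y : {set E}, (X \subset Y) ==> (r X <= r Y)],
  [forall X : {set E}, forall Y : {set E}, r (X :|: Y) + r (X :&: Y) <= r X + r Y]
  & [forall e, r [set e] <= 1]].

Lemma matroidP r : reflect (matroid r) (matroidb r).
Proof.
apply: (iffP and4P) => [[/eqP h0 h1 h2 /forallP h3]|[h0 h1 h2 h3]]; split=> //.
- by move=> X Y; have /forallP/(_ Y)/implyP := forallP h1 X.
- by move=> X Y; have /forallP := forallP h2 X.
- exact/eqP.
- by apply/forallP => X; apply/forallP => Y; apply/implyP; apply: h1.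
- by apply/forallP => X; apply/forallP => Y; apply: h2.
- exact/forallP.
Qed.

Lemma rk_card r X : matroid r -> r X <= #|X|.
Proof.
move=> rM; elim/set_ind: X => [|x X xX IH]; first by rewrite rk0.
by rewrite cardsU1 xX; have := rk_setU1 rM x X; lia.
Qed.

Lemma rk_loops r X : matroid r -> (forall e, e \in X -> r [set e] = 0) -> r X = 0.
Proof.
move=> rM h; rewrite -[X]set0U -[RHS](rk0 rM); apply: cl_setU => // e eX.
by rewrite setU0 rk0 // h.
Qed.

Lemma rk_capl r F X : matroid r -> (forall e, e \notin F -> r [set e] = 0) -> r (X :&: F) = r X.
Proof.
move=> rM h; rewrite -[in RHS](setID X F); apply/esym; apply: cl_setU => // e.
rewrite inE => /andP[/h e0 _]; apply: (cl_mono rM (sub0set _)).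
by rewrite setU0 rk0.
Qed.

Lemma restr_matroid r A : matroid r -> matroid (fun X => r (X :&: A)).
Proof.
move=> rM; split.
- by rewrite set0I rk0.
- by move=> X Y sXY; apply: rk_mono; rewrite // setSI.
- move=> X Y; rewrite setIUl setIIl; exact: rk_submod.
- move=> e; apply: leq_trans (rk1 rM e); apply: rk_mono => //; exact: subsetIl.
Qed.

Lemma conn_restr r s A : (forall X, X \subset A -> r X = s X) -> conn r A -> conn s A.
Proof.
move=> h /connP[nl sep]; apply/connP; split=> [e eA|B sB B0 BA].
  by rewrite -h ?nl // sub1set.
by rewrite -!h ?sep // subsetDl.
Qed.

(** Direct sum: disjoint supports keep the ranks of singletons at most 1. *)
Lemma sum_matroid (I : finType) (P : pred I) (r : I -> {set E} -> nat) (C : I -> {set E}) :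
  (forall i, P i -> matroid (r i)) -> (forall i e, P i -> e \notin C i -> r i [set e] = 0) ->
  (forall i j e, P i -> P j -> e \in C i -> e \in C j -> i = j) ->
  matroid (fun X => \sum_(i | P i) r i X).
Proof.
move=> rM out disj; split.
- by rewrite big1 // => i /rM; apply: rk0.
- by move=> X Y sXY; apply: leq_sum => i /rM iM; apply: rk_mono.
- move=> X Y; rewrite -!big_split /=; apply: leq_sum => i /rM iM; exact: rk_submod.
move=> e; have [/existsP[i /andP[Pi ei]]|/existsPn h] := boolP [exists i, P i && (e \in C i)].
  rewrite (bigD1 i) //= big1 ?addn0 ?(rk1 (rM i Pi)) // => j /andP[Pj ji].
  by apply: out => //; apply: contra ji => ej; apply/eqP/(disj j i e).
by rewrite big1 // => i Pi; apply: out => //; have := h i; rewrite Pi.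
Qed.

Definition is_comp r A := [&& A != set0, conn r A & r A + r (~: A) <= r setT].

Lemma comp_eq r A B e : matroid r -> is_comp r A -> is_comp r B -> e \in A -> e \in B -> A = B.
Proof.
move=> rM /and3P[_ cA hA] /and3P[_ cB hB] eA eB; rewrite -!setTD in hA hB.
apply/eqP; rewrite eqEsubset (comp_sub rM cA (subsetT B) (subsetT A) hB eB eA).
exact: (comp_sub rM cB (subsetT A) (subsetT B) hA eA eB).
Qed.

Lemma comp_exists r e : matroid r -> 0 < r [set e] -> exists2 A : {set E}, is_comp r A & e \in A.
Proof.
move=> rM re; have [A [_ eA cA hA]] := component rM (in_setT e) re.
exists A => //; rewrite /is_comp cA -setTD hA !andbT; by apply/set0Pn; exists e.
Qed.

Lemma comp_split r A X : matroid r -> is_comp r A -> r X = r (X :&: A) + r (X :\: A).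
Proof.
by move=> rM /and3P[_ _]; rewrite -setTD => h; apply: (sep_split rM (subsetT A) h (subsetT X)).
Qed.

(** Components are split off one at a time; what remains consists of loops. *)
Lemma comp_sum r X : matroid r -> r X = \sum_(A : {set E} | is_comp r A) r (X :&: A).
Proof.
move=> rM; pose Q := [set A : {set E} | is_comp r A].
have H (P : {set {set E}}) : P \subset Q ->
    r X = \sum_(A in P) r (X :&: A) + r (X :\: \bigcup_(A in P) A).
  elim/set_ind: P => [|A P AP IH]; first by rewrite !big_set0 setD0.
  rewrite subUset sub1set inE => /andP[cA sP]; rewrite {1}IH // !big_setU1 //=.
  rewrite (comp_split (X :\: _) rM cA) addnA (addnC (r (X :&: A))); congr (_ + r _ + r _).
    apply/setP => z; rewrite !inE; case zA: (z \in A); rewrite ?andbF // !andbT.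
    suff -> : z \in \bigcup_(A in P) A = false by [].
    apply/negP => /bigcupP[B BP zB]; have := subsetP sP B BP; rewrite inE => cB.
    by case/negP: AP; rewrite (comp_eq rM cA cB zA zB).
  by rewrite setDDl setUC.
rewrite (H Q) // (@rk_loops r (X :\: _)) ?addn0 //.
  by apply: eq_bigl => A; rewrite inE.
move=> e; rewrite inE => /andP[/bigcupP no _]; apply/eqP; rewrite -leqn0 leqNgt.
by apply/negP => /(comp_exists rM)[A cA eA]; apply: no; exists A; rewrite ?inE.
Qed.

Definition rkn (f : rankfun E) : {set E} -> nat := fun X => f X.
(** The default value of [inord] never occurs for a matroid, because its ranks are at most
    [#|E|]. *)
Definition mkrk r : rankfun E := [ffun X => inord (r X)].

Lemma mkrkE r X : matroid r -> rkn (mkrk r) X = r X.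
Proof.
move=> rM; rewrite /rkn ffunE inordK // ltnS (leq_trans (rk_card X rM)) //; exact: max_card.
Qed.

Lemma rkn_inj (f g : rankfun E) : rkn f =1 rkn g -> f = g.
Proof. by move=> h; apply/ffunP => X; apply/val_inj/h. Qed.

Definition decs rho k := [set t : {ffun 'I_k -> rankfun E} |
  [forall i, matroidb (rkn (t i))] && [forall X, rho X == \sum_i rkn (t i) X]].

Lemma decsP rho k (t : {ffun 'I_k -> rankfun E}) : reflect
  ((forall i, matroid (rkn (t i))) /\ forall X, rho X = \sum_i rkn (t i) X)
  (t \in decs rho k).
Proof.
rewrite inE; apply: (iffP andP) => [[/forallP h1 /forallP h2]|[h1 h2]]; split.
- by move=> i; apply/matroidP.
- by move=> X; apply/eqP.
- by apply/forallP => i; apply/matroidP.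
- by apply/forallP => X; apply/eqP.
Qed.

Section OneTuple.
Variables (rho : {set E} -> nat) (k : nat) (t : {ffun 'I_k -> rankfun E}).
Hypothesis tD : t \in decs rho k.

Lemma decs_matroid i : matroid (rkn (t i)). Proof. by case/decsP: tD. Qed.
Lemma decs_sum X : rho X = \sum_i rkn (t i) X. Proof. by case/decsP: tD. Qed.

Lemma decs_le i X : rkn (t i) X <= rho X.
Proof. by rewrite decs_sum (bigD1 i) //= leq_addr. Qed.

Lemma decs_cap i X : rkn (t i) (X :&: nonloops rho) = rkn (t i) X.
Proof.
apply: rk_capl; first exact: decs_matroid.
move=> e; rewrite inE -eqn0Ngt => /eqP e0; apply/eqP; rewrite -leqn0 -e0.
exact: decs_le.
Qed.

(** All pairs of a position and a set serve as indices, with empty support for sets that are not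
    components; the index type is then independent of the tuple. *)
Definition Ct (x : 'I_k * {set E}) : {set E} := if is_comp (rkn (t x.1)) x.2 then x.2 else set0.
Definition rt (x : 'I_k * {set E}) : {set E} -> nat := fun X => rkn (t x.1) (X :&: Ct x).

Lemma tuple_decomp : decomp Ct rt rho.
Proof.
split.
- by move=> i; apply: restr_matroid; apply: decs_matroid.
- move=> [i A]; apply: (@conn_restr (rkn (t i))) => [X sX|].
    by rewrite /rt /= (setIidPl _).
  rewrite /Ct /=; case h: (is_comp _ A); first by case/and3P: h.
  apply/connP; split=> [e|B]; first by rewrite inE.
  by rewrite subset0 => ->.
- by move=> i X; rewrite /rt -setIA setIid.
move=> X; rewrite decs_sum -(pair_bigA _ (fun i A => rt (i, A) X)) /=.
apply: eq_bigr => i _; rewrite (comp_sum _ (decs_matroid i)) big_mkcond /=.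
apply: eq_bigr => A _; rewrite /rt /Ct /=; case: (is_comp _ A) => //.
by rewrite setI0 (rk0 (decs_matroid i)).
Qed.

Lemma decs_comp i : nonloops rho != set0 -> is_comp (rkn (t i)) (nonloops rho) = conn (rkn (t i)) (nonloops rho).
Proof.
move=> F0; rewrite /is_comp F0 /= andbC; case: conn; rewrite ?andbF // andbT.
rewrite -(decs_cap i (~: _)) setIC setICr (rk0 (decs_matroid i)) addn0.
by apply: rk_mono (decs_matroid i) _ _ (subsetT _).
Qed.

Definition fullb := [exists i, exists j, [&& i != j, conn (rkn (t i)) (nonloops rho)
  & conn (rkn (t j)) (nonloops rho)]].

Lemma fullP : nonloops rho != set0 -> reflect (full2 Ct (nonloops rho)) fullb.
Proof.
move=> F0; apply: (iffP existsP) => [[i /existsP[j /and3P[ij ci cj]]]|].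
  exists (i, nonloops rho), (j, nonloops rho); rewrite /Ct /= !decs_comp // ci cj; split=> //.
  by apply: contra ij => /eqP[->].
move=> [[i A] [[j B] [ij + +]]]; rewrite /Ct /=.
case hA: (is_comp _ A) => eA; last by rewrite -eA eqxx in F0.
case hB: (is_comp _ B) => eB; last by rewrite -eB eqxx in F0.
exists i; apply/existsP; exists j; rewrite -!decs_comp // -{1}eA -eB hA hB !andbT.
by apply: contra ij => /eqP ->; rewrite eA eB.
Qed.

End OneTuple.
End Tuples.

Lemma card_lt_pairs k : 2 * #|[set x : 'I_k * 'I_k | x.1 < x.2]| = k * (k - 1).
Proof.
pose A := [set x : 'I_k * 'I_k | x.1 < x.2]; pose B := [set x : 'I_k * 'I_k | x.2 < x.1].
pose D := [set x : 'I_k * 'I_k | x.1 == x.2].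
have cB : #|B| = #|A|.
  rewrite -(card_imset _ (f := fun x : 'I_k * 'I_k => (x.2, x.1))) => [|[i j] [i' j'] [-> ->]] //; apply: eq_card => -[i j].
  apply/imsetP/idP => [[[i' j']]|]; first by rewrite !inE /= => h [-> ->].
  by rewrite inE /= => h; exists (j, i); rewrite ?inE.
have cD : #|D| = k.
  rewrite -[RHS]card_ord -(card_imset _ (f := fun i : 'I_k => (i, i))); last by move=> i j [].
  apply: eq_card => -[i j]; rewrite !inE /=; apply/eqP/imsetP => [->|[l _ [-> ->//]]].
  by exists j.
have : #|A :|: B :|: D| = k * k.
  transitivity #|[set: 'I_k * 'I_k]|; last by rewrite cardsT card_prod !card_ord.
  congr #|pred_of_set _|; apply/setP => -[i j]; rewrite !inE /=.
  by case: ltngtP => //= /val_inj ->; rewrite eqxx.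
rewrite !cardsU cB cD.
have -> : A :&: B = set0 by apply/setP => -[i j]; rewrite !inE /=; apply/negP; lia.
have -> : (A :|: B) :&: D = set0.
  apply/setP => -[i j]; rewrite !inE /=; apply/negP => /andP[/orP[]h /eqP e0];
   by rewrite e0 ltnn in h.
by rewrite cards0 -/A mulnBr muln1; move: (k * k) #|A| => a b; clear; lia.
Qed.

Section Counts.
Variable E : finType.
Implicit Types (A B F G K S T U V W X Y Z : {set E}).
Implicit Types (a b e f g u v w x y z : E) (r s : {set E} -> nat).
Variable rho : {set E} -> nat.
Hypothesis two : forall e, rho [set e] <= 2.
Local Notation F := (nonloops rho).
Hypothesis F0 : F != set0.

Definition fullpairs := [set p : rankfun E * rankfun E |
  [&& matroidb (rkn p.1), matroidb (rkn p.2), conn (rkn p.1) F, conn (rkn p.2) F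
    & [forall X, rho X == rkn p.1 X + rkn p.2 X]]].

Lemma fullpairsP (p : rankfun E * rankfun E) :
  reflect (fullpair (rkn p.1) (rkn p.2) rho) (p \in fullpairs).
Proof.
rewrite inE; apply: (iffP and5P) => -[h1 h2 h3 h4 h5]; split=> //; try exact/matroidP.
  by move=> X; apply/eqP/(forallP h5).
by apply/forallP => X; apply/eqP.
Qed.

Lemma conn_nonzero r G e : conn r G -> e \in G -> 0 < r [set e].
Proof. by case/connP => h _; apply: h. Qed.

(** Ordered pairs of matroids are combined with positions i < j, so that a tuple with two equal
    matroids is counted once. *)
Lemma full_count k : #|[set t in decs rho k | fullb rho t]| =
  #|fullpairs| * #|[set x : 'I_k * 'I_k | x.1 < x.2]|.
Proof.
pose mk (x : (rankfun E * rankfun E) * ('I_k * 'I_k)) : {ffun 'I_k -> rankfun E} :=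
  [ffun l => if l == x.2.1 then x.1.1 else if l == x.2.2 then x.1.2 else mkrk (fun _ => 0)].
have [e eF] := set0Pn _ F0.
have mkE p (i j : 'I_k) : i < j -> [/\ mk (p, (i, j)) i = p.1, mk (p, (i, j)) j = p.2 &
    forall l X, l != i -> l != j -> rkn (mk (p, (i, j)) l) X = 0].
  move=> ij; rewrite !ffunE /= !eqxx; have ji : (j == i) = false by apply/eqP => h; rewrite h ltnn in ij.
  rewrite ji; split=> // l X /negPf li /negPf lj; rewrite ffunE /= li lj mkrkE //.
have mkC p (i j l : 'I_k) : p \in fullpairs -> i < j ->
    conn (rkn (mk (p, (i, j)) l)) F = (l == i) || (l == j).
  move=> /fullpairsP[_ _ c1 c2 _] /(mkE p)[e1 e2 e3].
  have [->|li] := eqVneq l i; first by rewrite e1.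
  have [->|lj] := eqVneq l j; first by rewrite e2.
  by apply/negP => /conn_nonzero/(_ eF); rewrite e3.
rewrite -cardsX -(card_in_imset (f := mk)); last first.
  move=> [p [i j]] [p' [i' j']]; rewrite !in_setX /= => /andP[pQ]; rewrite inE /= => ij.
  move=> /andP[pQ']; rewrite inE /= => ij' eq.
  have h l : ((l == i) || (l == j)) = ((l == i') || (l == j')).
    by rewrite -(mkC p) // -(mkC p') // eq.
  have [hi hj] : i = i' /\ j = j'.
    have := h i; have := h j; rewrite !eqxx orbT => /esym/orP h1 /esym/orP h2.
    by case: h1 h2 => /eqP h1 [] /eqP h2; split; apply/val_inj; move: ij ij'; rewrite ?h1 ?h2; lia.
  subst i' j'; have [a1 a2 _] := mkE p _ _ ij; have [b1 b2 _] := mkE p' _ _ ij'.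
  by rewrite eq in a1 a2; congr (_, _); apply/eqP; rewrite -pair_eqE /pair_eq -a1 -a2 b1 b2 !eqxx.
apply: eq_card => t; rewrite inE; apply/andP/imsetP => [[tD]|[[p [i j]]]].
  case/existsP=> i /existsP[j /and3P[ij ci cj]].
  wlog lij : i j ij ci cj / i < j.
    move=> W; have [|ji|/val_inj h] := ltngtP i j; first exact: W.
      by apply: (W j i) => //; rewrite eq_sym.
    by rewrite h eqxx in ij.
  (* Positions [i] and [j] already use up the bound 2 at every nonloop of [rho]. *)
  have other l X : l != i -> l != j -> rkn (t l) X = 0.
    move=> li lj; apply: rk_loops => [|x _]; first exact: (decs_matroid tD).
    have := two x; rewrite (decs_sum tD) (bigD1 i) //= (bigD1 j) 1?eq_sym //=.
    rewrite (bigD1 l) ?li //=.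
    have [xF|xF] := boolP (x \in F).
      have ari (a b c d : nat) : 0 < a -> 0 < b -> a + (b + (c + d)) <= 2 -> c = 0 by clear; lia.
      by apply: ari; [apply: conn_nonzero ci xF | apply: conn_nonzero cj xF].
    move=> _; apply/eqP; rewrite -leqn0; apply: leq_trans (decs_le tD l _) _.
    by move: xF; rewrite inE; lia.
  have eT : t = mk ((t i, t j), (i, j)).
    have [a1 a2 a3] := mkE (t i, t j) i j lij.
    apply/ffunP => l; have [->|li] := eqVneq l i; first by rewrite a1.
    have [->|lj] := eqVneq l j; first by rewrite a2.
    by apply: rkn_inj => X; rewrite a3 // other.
  exists ((t i, t j), (i, j)); rewrite // in_setX !inE /= lij andbT.
  apply/and5P; split=> //; try exact/matroidP/(decs_matroid tD).
  apply/forallP => X; apply/eqP; rewrite (decs_sum tD) (bigD1 i) //= (bigD1 j) 1?eq_sym //=.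
  by rewrite big1 ?addn0 // => l /andP[li lj]; apply: other.
rewrite in_setX => /andP[pQ]; rewrite inE /= => ij ->.
have [a1 a2 a3] := mkE p i j ij; have /fullpairsP[m1 m2 _ _ sumE] := pQ.
have ji : j != i by apply/eqP => h; rewrite h ltnn in ij.
split; last first.
  by apply/existsP; exists i; apply/existsP; exists j; rewrite !mkC // !eqxx orbT eq_sym ji.
apply/decsP; split.
  move=> l; have [->|li] := eqVneq l i; first by rewrite a1.
  have [->|lj] := eqVneq l j; first by rewrite a2.
  by split=> [|X Y sXY|X Y|x]; rewrite !a3.
move=> X; rewrite (bigD1 i) //= (bigD1 j) //= a1 a2 big1 ?addn0 ?sumE //.
by move=> l /andP[li lj]; apply: a3.
Qed.

End Counts.

(** * Tuples without two full pieces *)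

Section Nonfull.
Variable E : finType.
Implicit Types (F G K S T U V W X Y Z : {set E}).
Implicit Types (a b e f g u v w x y z : E) (r s : {set E} -> nat).
Variable rho : {set E} -> nat.
Hypothesis two : forall e, rho [set e] <= 2.
Local Notation F := (nonloops rho).
Hypothesis F0 : F != set0.
Hypothesis cr : conn rho F.

(** No third support can meet two equal ones, so by connectivity of [rho] they contain all
    nonloops. *)
Lemma twin_full (I : finType) (C : I -> {set E}) (r : I -> {set E} -> nat) i j :
  decomp C r rho -> i != j -> C i = C j -> C i != set0 -> full2 C F.
Proof.
move=> dec ij Cij /set0Pn[e ei]; have eF := subsetP (dec_sub dec i) e ei.
have sF : F \subset C i.
  apply: (dec_closed dec cr _ eF ei) => l.
  have [h|/set0Pn[f]] := eqVneq (C l :&: C i) set0; first by right; rewrite -setI_eq0 h.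
  rewrite inE => /andP[fl fi]; left.
  have fj : f \in C j by rewrite -Cij.
  by case: (dec_two dec two fi fj fl ij) => ->; rewrite // Cij.
have CF : C i = F by apply/eqP; rewrite eqEsubset sF (dec_sub dec).
by exists i, j; rewrite -Cij CF.
Qed.

Variable SS : {set {set E}}.
Hypothesis S0 : set0 \notin SS.
Local Notation J := {A : {set E} | A \in SS}.

Definition adjJ : rel J := fun A B : J => (A != B) && (val A :&: val B != set0).

Definition assigns := [set al : {ffun J -> rankfun E} |
  [&& [forall A : J, matroidb (rkn (al A))], [forall A : J, conn (rkn (al A)) (val A)],
      [forall A : J, forall X : {set E}, rkn (al A) X == rkn (al A) (X :&: val A)]
    & [forall X : {set E}, rho X == \sum_(A : J) rkn (al A) X]]].

Lemma assignsP (al : {ffun J -> rankfun E}) :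
  reflect (decomp (fun A : J => val A) (fun A => rkn (al A)) rho) (al \in assigns).
Proof.
rewrite inE; apply: (iffP and4P) => -[h1 h2 h3 h4]; split.
- by move=> A; apply/matroidP/(forallP h1).
- exact/forallP.
- by move=> A X; apply/eqP; have /forallP := forallP h3 A; apply.
- by move=> X; apply/eqP/(forallP h4).
- by apply/forallP => A; apply/matroidP.
- exact/forallP.
- by apply/forallP => A; apply/forallP => X; apply/eqP.
- by apply/forallP => X; apply/eqP.
Qed.

Section K.
Variable k : nat.

(** Position [i] receives the direct sum of the matroids whose support has colour [i]; properness of
    the colouring makes these supports disjoint. *)
Definition Phi (x : {ffun J -> rankfun E} * {ffun J -> 'I_k}) : {ffun 'I_k -> rankfun E} :=
  [ffun i => mkrk (fun X => \sum_(A : J | x.2 A == i) rkn (x.1 A) X)].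

Section Elem.
Variables (al : {ffun J -> rankfun E}) (c : {ffun J -> 'I_k}).
Hypotheses (alA : al \in assigns) (cC : c \in colset adjJ k).
Let dec := elimT (assignsP al) alA.

Lemma Phi_disj (A B : J) e : c A = c B -> e \in val A -> e \in val B -> A = B.
Proof.
move=> cAB eA eB; apply/eqP; apply: contraT => AB; have /colsetP h := cC.
have /h : adjJ A B by rewrite /adjJ AB; apply/set0Pn; exists e; rewrite inE eA.
by rewrite cAB eqxx.
Qed.

Lemma Phi_matroid i : matroid (fun X => \sum_(A : J | c A == i) rkn (al A) X).
Proof.
apply: (@sum_matroid _ _ _ _ (fun A : J => val A)) => [A _|A e _ eA|A B e /eqP <- /eqP cAB].
- exact: (dec_matroid dec).
- by rewrite (dec_rk1 dec A) (negPf eA).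
- by apply: Phi_disj.
Qed.

Lemma PhiE i X : rkn (Phi (al, c) i) X = \sum_(A : J | c A == i) rkn (al A) X.
Proof. by rewrite ffunE mkrkE //; apply: Phi_matroid. Qed.

Lemma Phi_rkn_matroid i : matroid (rkn (Phi (al, c) i)).
Proof.
have [h1 h2 h3 h4] := Phi_matroid i; split; first by rewrite PhiE.
- by move=> X Y; rewrite !PhiE; apply: h2.
- by move=> X Y; rewrite !PhiE; apply: h3.
- by move=> e; rewrite PhiE.
Qed.

Lemma Phi_decs : Phi (al, c) \in decs rho k.
Proof.
apply/decsP; split=> [|X]; first exact: Phi_rkn_matroid.
rewrite (dec_sum dec) (partition_big (fun A => c A) predT) //=.
by apply: eq_bigr => i _; rewrite PhiE.
Qed.

Lemma Phi_on (A : J) X : X \subset val A -> rkn (Phi (al, c) (c A)) X = rkn (al A) X.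
Proof.
move=> sX; rewrite PhiE (bigD1 A) //= big1 ?addn0 // => B /andP[/eqP cBA BA].
rewrite (dec_cap dec B) (_ : _ :&: _ = set0) ?(rk0 (dec_matroid dec B)) //.
apply/setP => z; rewrite !inE; apply/negP => /andP[zX zB].
by move: BA; rewrite (Phi_disj cBA zB (subsetP sX z zX)) eqxx.
Qed.

Lemma val_neq0 (A : J) : val A != set0.
Proof. by apply: contraNneq S0 => <-; apply: valP. Qed.

Lemma Phi_comp_val (A : J) : is_comp (rkn (Phi (al, c) (c A))) (val A).
Proof.
rewrite /is_comp val_neq0 /=; apply/andP; split.
  apply: (conn_restr (r := rkn (al A))); last exact: (dec_conn dec A).
  by move=> X sX; rewrite Phi_on.
rewrite !PhiE -big_split /=; apply: leq_sum => B /eqP cBA.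
have BM := dec_matroid dec B; have [->|BA] := eqVneq B A.
  rewrite (dec_cap dec A (~: _)) (setIC (~: _)) setICr (rk0 (dec_matroid dec A)) addn0.
  by apply: rk_mono (dec_matroid dec A) _ _ (subsetT _).
rewrite (dec_cap dec B (val A)) (_ : val A :&: _ = set0) ?rk0 //; first exact: rk_mono (subsetT _).
apply/setP => z; rewrite !inE; apply/negP => /andP[zA zB].
by move: BA; rewrite (Phi_disj cBA zB zA) eqxx.
Qed.

Lemma Phi_comp i (B : {set E}) : is_comp (rkn (Phi (al, c) i)) B ->
  exists2 A : J, val A = B & c A = i.
Proof.
move=> cB; have /and3P[/set0Pn[e eB] conB _] := cB.
have := conn_nonzero conB eB; rewrite PhiE lt0n sum_nat_eq0 negb_forall.
case/existsP => A; rewrite negb_imply (dec_rk1 dec A) eqb0 negbK => /andP[/eqP cA eA].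
exists A => //; apply: (comp_eq (Phi_rkn_matroid i)) cB eA eB.
by rewrite -cA; apply: Phi_comp_val.
Qed.

Lemma Phi_nonfull : ~~ fullb rho (Phi (al, c)).
Proof.
apply/negP => /existsP[i /existsP[j /and3P[ij]]].
rewrite -!(decs_comp Phi_decs) // => /Phi_comp[A eA cA] /Phi_comp[B eB cB].
have AB : A = B by apply: val_inj; rewrite eA.
by rewrite -cA -cB AB eqxx in ij.
Qed.

End Elem.

(* A nonfull tuple amounts to a matroid on each support and a position for each support, where intersecting supports need different positions. *)
Lemma nonfull_count :
  (forall t, t \in decs rho k -> ~~ fullb rho t ->
     forall A, (A \in SS) = [exists i, is_comp (rkn (t i)) A]) ->
  #|[set t in decs rho k | ~~ fullb rho t]| = #|assigns| * col adjJ k.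
Proof.
move=> H; rewrite /col -cardsX -(card_in_imset (f := Phi)); last first.
  move=> [al c] [al' c'] /setXP[/= a1 c1] /setXP[/= a2 c2] eq.
  have cc A : c' A = c A.
    have := Phi_comp_val a1 c1 A; rewrite eq => /(Phi_comp a2 c2)[B eB <-].
    by rewrite (val_inj eB).
  have d1 := elimT (assignsP al) a1; have d2 := elimT (assignsP al') a2.
  congr (_, _); last by apply/ffunP => A; rewrite cc.
  apply/ffunP => A; apply: rkn_inj => X.
  rewrite (dec_cap d1 A) (dec_cap d2 A) -(Phi_on a1 c1) ?subsetIr //.
  by rewrite eq -cc (Phi_on a2 c2) ?subsetIr.
apply: eq_card => t; rewrite inE; apply/andP/imsetP => [[tD nf]|[[al c] /setXP[/= a1 c1] ->]]; last first.
  by split; [apply: Phi_decs | apply: Phi_nonfull].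
have HS := H t tD nf; have tM := decs_matroid tD.
have [c0 hc] : exists c : J -> 'I_k, forall A, is_comp (rkn (t (c A))) (val A).
  apply: (@fin_all_exists _ (fun=> 'I_k) (fun A i => is_comp (rkn (t i)) (val A))) => A.
  by apply/existsP; have := valP A; rewrite HS.
(* A set that is a component at two positions would give two equal supports, hence a full tuple by
   [twin_full]. *)
have uniq i j A : is_comp (rkn (t i)) A -> is_comp (rkn (t j)) A -> i = j.
  move=> ci cj; apply/eqP; apply: contraT => ij; case/negP: nf; apply/(fullP tD F0).
  apply: (@twin_full _ _ _ (i, A) (j, A) (tuple_decomp tD)); rewrite /Ct /= ?ci ?cj //.
    by apply: contra ij => /eqP[->].
  by case/and3P: ci.
pose c : {ffun J -> 'I_k} := [ffun A => c0 A].
pose al : {ffun J -> rankfun E} := [ffun A => mkrk (fun X => rkn (t (c0 A)) (X :&: val A))].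
have alE A X : rkn (al A) X = rkn (t (c0 A)) (X :&: val A).
  by rewrite ffunE mkrkE //; apply: restr_matroid.
have sum i X : rkn (t i) X = \sum_(A : J | c A == i) rkn (al A) X.
  rewrite (comp_sum X (tM i)) (reindex_omap val (insub : {set E} -> option J)) /=; last first.
    move=> A cA; have AS : A \in SS by rewrite HS; apply/existsP; exists i.
    by rewrite insubT.
  apply: eq_big => [A|A].
    rewrite valK eqxx andbT ffunE; apply/idP/eqP => [cA|<-]; last exact: hc.
    exact: uniq (hc A) cA.
  rewrite valK eqxx andbT => cA; rewrite alE; congr (rkn (t _) _).
  exact: uniq cA (hc A).
exists (al, c).
  rewrite in_setX /=; apply/andP; split; last first.
    apply/colsetP => A B /andP[AB /set0Pn[e]]; rewrite inE => /andP[eA eB].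
    apply: contra AB; rewrite !ffunE => /eqP cAB; apply/eqP/val_inj.
    by apply: (comp_eq (tM (c0 A))) (hc A) _ eA eB; rewrite cAB.
  apply/assignsP; split.
  - move=> A; have [h1 h2 h3 h4] := restr_matroid (val A) (tM (c0 A)).
    split; first by rewrite alE.
    + by move=> X Y; rewrite !alE; apply: h2.
    + by move=> X Y; rewrite !alE; apply: h3.
    + by move=> e; rewrite alE.
  - move=> A; apply: (conn_restr (r := rkn (t (c0 A)))); last by case/and3P: (hc A).
    by move=> X sX; rewrite alE (setIidPl sX).
  - by move=> A X; rewrite !alE -setIA setIid.
  move=> X; rewrite (decs_sum tD) [RHS](partition_big (fun A => c A) predT) //=.
  by apply: eq_bigr => i _; apply: sum.
apply/ffunP => i; apply: rkn_inj => X; rewrite sum ffunE mkrkE //.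
have [h1 h2 h3 h4] := tM i; split; first by rewrite -sum.
- by move=> Y Z; rewrite -!sum; apply: h2.
- by move=> Y Z; rewrite -!sum; apply: h3.
- by move=> e; rewrite -sum.
Qed.

End K.
End Nonfull.

(** * Chromatic polynomials of small graphs *)

Lemma eq_col (V : finType) (a b : rel V) k : a =2 b -> col a k = col b k.
Proof. by move=> ab; apply: (@col_relabel _ _ _ _ id); first by exists id. Qed.

Definition complete (V : finType) : rel V := fun x y => x != y.
Arguments complete : clear implicits.

Lemma col_complete_option (T : finType) k :
  col (complete (option T)) k = col (complete T) k * (k - #|T|).
Proof.
rewrite col_simplicial /complete; last first.
- by move=> x y _ _; rewrite (inj_eq Some_inj).
- by move=> x y; rewrite eq_sym.
- by move=> x; rewrite eqxx.
congr (_ * (k - _)).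
by rewrite -cardsT; congr #|pred_of_set _|; apply/setP => x; rewrite !inE.
Qed.

Lemma col_complete1 k : col (complete unit) k = k.
Proof.
rewrite /col (_ : colset _ _ = setT); last by apply/setP => c; rewrite in_setT; apply/colsetP => -[] [].
by rewrite cardsT card_ffun card_unit card_ord expn1.
Qed.

Lemma col_complete2 k : col (complete (option unit)) k = k * (k - 1).
Proof. by rewrite col_complete_option col_complete1 card_unit. Qed.

Lemma col_complete3 k : col (complete (option (option unit))) k = k * (k - 1) * (k - 2).
Proof. by rewrite col_complete_option col_complete2 card_option card_unit. Qed.

(** The middle vertex is [Some None]. The path serves twice: as a possible intersection graph of
    supports, and as the graph that answers the triangle case. *)
Definition adj_path : rel (option (option unit)) := fun x y =>
  match x, y with
  | Some u, Some v => u != v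
  | Some None, None | None, Some None => true
  | _, _ => false
  end.

Definition adj_edge_point : rel (option (option unit)) := fun x y =>
  match x, y with Some u, Some v => u != v | _, _ => false end.

Lemma adj_path_simple : irreflexive adj_path /\ symmetric adj_path.
Proof. by split; [case=> [[[]|]|] | case=> [[[]|]|] [[[]|]|]]. Qed.

Lemma adj_edge_point_simple : irreflexive adj_edge_point /\ symmetric adj_edge_point.
Proof. by split; [case=> [[[]|]|] | case=> [[[]|]|] [[[]|]|]]. Qed.

Lemma col_path k : col adj_path k = k * (k - 1) * (k - 1).
Proof.
have [irr sym] := adj_path_simple.
rewrite col_simplicial //; last by move=> [[]|] [[]|] //= _ _; rewrite eqxx.
rewrite (@eq_col _ _ (complete (option unit))) ?col_complete2; last by move=> [[]|] [[]|].
congr (_ * (k - _)); rewrite (_ : finset _ = [set None]) ?cards1 //.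
by apply/setP => -[[]|]; rewrite !inE.
Qed.

Lemma col_edge_point k : col adj_edge_point k = k * (k - 1) * k.
Proof.
have [irr sym] := adj_edge_point_simple.
rewrite col_simplicial //.
rewrite -[col _ _]/(col (complete (option unit)) k) col_complete2.
rewrite (_ : finset _ = set0) ?cards0 ?subn0 //.
Qed.

Lemma three_bij (J : finType) (i j k : J) : i != j -> i != k -> j != k ->
  (forall l, [|| l == i, l == j | l == k]) ->
  bijective (fun o : option (option unit) =>
    match o with None => i | Some None => j | Some (Some _) => k end).
Proof.
move=> ij ik jk all.
exists (fun l => if l == i then None else if l == j then Some None else Some (Some tt)).
  move=> [[[]|]|]; rewrite ?eqxx //; first by rewrite !(eq_sym k) (negPf ik) (negPf jk).
  by rewrite eq_sym (negPf ij).
move=> l; have := all l; have [->//|li] := eqVneq l i; have [->//|lj] := eqVneq l j.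
by move=> /= /eqP ->.
Qed.

Section Final.
Import GRing.Theory Num.Theory.
Local Open Scope ring_scope.

(** Proportionality is stated for the counts at every [k]; polynomials enter only in the final
    theorem. *)
Definition chromatic_multiple (f : nat -> nat) := exists (V : finType) (adj : rel V) (s : rat),
  [/\ irreflexive adj, symmetric adj & forall k, (f k)%:R = s * (col adj k)%:R].

Lemma chromatic_multiple_eq f g : f =1 g -> chromatic_multiple f -> chromatic_multiple g.
Proof.
by move=> fg [V [adj [s [h1 h2 h3]]]]; exists V, adj, s; split=> // k; rewrite -fg.
Qed.

Lemma complete_simple (V : finType) : irreflexive (complete V) /\ symmetric (complete V).
Proof. by split=> [x|x y]; rewrite /complete ?eqxx // eq_sym. Qed.
End Final.

(** * Connected 2-polymatroids *)

Section Connected.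
Variable E : finType.
Implicit Types (e f x : E) (X F : {set E}).
Variable rho : {set E} -> nat.
Hypothesis two : forall e, rho [set e] <= 2.
Local Notation F := (nonloops rho).
Hypothesis F0 : F != set0.
Hypothesis cr : conn rho F.

Lemma decs_split k : #|decs rho k| =
  #|[set t in decs rho k | fullb rho t]| + #|[set t in decs rho k | ~~ fullb rho t]|.
Proof.
rewrite -(cardsID [set t | fullb rho t] (decs rho k)).
by congr (_ + _); apply: eq_card => t; rewrite !inE // andbC.
Qed.

Lemma assigns_nonfull (SS : {set {set E}}) al : al \in assigns rho SS ->
  ~ full2 (fun A : {A : {set E} | A \in SS} => val A) F.
Proof. by move=> _ [A [B [AB eA eB]]]; case/eqP: AB; apply: val_inj; rewrite eA. Qed.

Lemma same_pieces_comps (I : finType) (C : I -> {set E}) k (t : {ffun 'I_k -> rankfun E}) A :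
  t \in decs rho k -> same_pieces C (Ct t) ->
  [exists i, is_comp (rkn (t i)) A] = (A != set0) && [exists i, C i == A].
Proof.
move=> tD [h1 h2]; apply/existsP/andP => [[i cA]|[A0 /existsP[i /eqP CA]]].
  have A0 : A != set0 by case/and3P: cA.
  split=> //; have [|l hl] := h2 (i, A); first by rewrite /Ct /= cA.
  by apply/existsP; exists l; rewrite hl /Ct /= cA.
have [|[j B]] := h1 i; first by rewrite CA.
rewrite /Ct /= CA; case cB: (is_comp _ B) => eB; last by rewrite -eB eqxx in A0.
by exists j; rewrite -eB.
Qed.

Lemma comps_eq k (t : {ffun 'I_k -> rankfun E}) k' (t' : {ffun 'I_k' -> rankfun E}) A :
  t \in decs rho k -> t' \in decs rho k' -> ~~ fullb rho t -> ~~ fullb rho t' ->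
  [exists i, is_comp (rkn (t i)) A] = [exists i, is_comp (rkn (t' i)) A].
Proof.
move=> tD tD' nf nf'.
have nF : ~ full2 (Ct t) F by move/(fullP tD F0); apply/negP.
case: (decomp_compare (tuple_decomp tD) (tuple_decomp tD') two cr F0 nF) => [sp|[]].
  rewrite (same_pieces_comps A tD' sp).
  apply/existsP/andP => [[i cA]|[A0 /existsP[[i B]]]].
    have A0 : A != set0 by case/and3P: cA.
    by split=> //; apply/existsP; exists (i, A); rewrite /Ct /= cA.
  rewrite /Ct /=; case cB: (is_comp _ B) => /eqP eB; last by rewrite -eB eqxx in A0.
  by exists i; rewrite -eB.
by move/(fullP tD' F0) => h; rewrite h in nf'.
Qed.

(** The assignment is itself a decomposition, with which every nonfull tuple is compared. One [SS]
    therefore serves all [k], including those for which no nonfull tuple exists and both sides are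
    0. *)
Lemma nonfull_count_of_assign (SS : {set {set E}}) al k : set0 \notin SS -> al \in assigns rho SS ->
  #|[set t in decs rho k | ~~ fullb rho t]| = #|assigns rho SS| * col (@adjJ E SS) k.
Proof.
move=> S0 alA; apply: nonfull_count => // t tD nf A.
have dec := elimT (assignsP rho al) alA.
case: (decomp_compare dec (tuple_decomp tD) two cr F0 (assigns_nonfull alA)) => [sp|[]]; last first.
  by move/(fullP tD F0) => h; rewrite h in nf.
rewrite (same_pieces_comps A tD sp); apply/idP/andP => [AS|[_ /existsP[B /eqP <-]]]; last exact: valP.
split; first by apply: contraNneq S0 => <-.
by apply/existsP; exists (Sub A AS).
Qed.

(** [SS] consists of the components of [t]; since [t] itself is counted, the factor [assigns] in
    [nonfull_count] is not 0. *)
Lemma assign_of_nonfull k (t : {ffun 'I_k -> rankfun E}) : t \in decs rho k -> ~~ fullb rho t ->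
  exists SS : {set {set E}}, (set0 \notin SS) && (assigns rho SS != set0).
Proof.
move=> tD nf; pose SS := [set A : {set E} | [exists i, is_comp (rkn (t i)) A]].
have S0 : set0 \notin SS by rewrite inE; apply/existsP => -[i /and3P[]]; rewrite eqxx.
exists SS; rewrite S0 /=.
have := @nonfull_count E rho two F0 cr SS S0 k.
have H : forall t', t' \in decs rho k -> ~~ fullb rho t' ->
    forall A, (A \in SS) = [exists i, is_comp (rkn (t' i)) A].
  by move=> t' tD' nf' A; rewrite inE; apply: comps_eq.
move=> /(_ H) h; apply: contraTneq (_ : 0 < #|[set t in decs rho k | ~~ fullb rho t]|) => [e0|].
  by rewrite h e0 cards0.
by apply/card_gt0P; exists t; rewrite inE tD.
Qed.

Section Both.
Variables (SS : {set {set E}}) (al : {ffun {A : {set E} | A \in SS} -> rankfun E}).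
Hypotheses (S0 : set0 \notin SS) (alA : al \in assigns rho SS).
Variable p : rankfun E * rankfun E.
Hypothesis pQ : p \in fullpairs rho.
Local Notation J := {A : {set E} | A \in SS}.
Let dec := elimT (assignsP rho al) alA.
Let fp := elimT (fullpairsP rho p) pQ.

Lemma fullpair_cap (q : rankfun E * rankfun E) X : fullpair (rkn q.1) (rkn q.2) rho ->
  rkn q.1 (X :&: F) = rkn q.1 X /\ rkn q.2 (X :&: F) = rkn q.2 X.
Proof.
move=> [M1M M2M _ _ sumE]; split; apply: rk_capl => // e;
  by rewrite inE sumE -eqn0Ngt addn_eq0 => /andP[/eqP ? /eqP ?].
Qed.

(** A full pair is turned into a decomposition to which [decomp_compare] applies. *)
Lemma bool_decomp : decomp (fun _ : bool => F) (fun b : bool => if b then rkn p.1 else rkn p.2) rho.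
Proof.
have [M1M M2M c1 c2 sumE] := fp; split; try by case.
  by move=> b X; have [h1 h2] := fullpair_cap X fp; case: b.
by move=> X; rewrite sumE big_bool.
Qed.

Lemma assigns_thin : thin (fun A : J => val A) rho.
Proof.
have nf := assigns_nonfull alA.
case: (decomp_compare dec bool_decomp two cr F0 nf) => [sp|[_ //]].
by case: nf; apply: (same_pieces_full two dec bool_decomp F0 sp); exists true, false.
Qed.

Lemma assigns1 : #|assigns rho SS| = 1.
Proof.
rewrite (_ : assigns rho SS = [set al]) ?cards1 //; apply/setP => al'; rewrite in_set1.
apply/idP/eqP => [alA'|->//]; apply/ffunP => A; apply: rkn_inj => X.
have dec' := elimT (assignsP rho al') alA'.
exact: (thin_unique two dec' dec assigns_thin).
Qed.

(** The two elements are the two orders of the unique pair, distinct by [single_neq]. *)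
Lemma fullpairs2 : #|fullpairs rho| = 2.
Proof.
have [i [j [ij /negP T0 nij]]] := thin_pieces dec assigns_thin.
have [b [e [x sp]]] := thin_single two dec assigns_thin.
have ne : p.1 != p.2.
  by apply/eqP => h; apply: (single_neq dec fp sp) => X; rewrite h.
have -> : fullpairs rho = [set p; (p.2, p.1)].
  apply/setP => q; rewrite in_set2; apply/idP/orP => [/fullpairsP fq|[/eqP->//|/eqP->]]; last first.
    by apply/fullpairsP; have [? ? ? ? h] := fp; split=> // X; rewrite h addnC.
  have ext (u v : rankfun E) : (forall X, rkn u (X :&: F) = rkn u X) ->
      (forall X, rkn v (X :&: F) = rkn v X) ->
      (forall X, X \subset F -> rkn u X = rkn v X) -> u = v.
    by move=> hu hv h; apply: rkn_inj => X; rewrite -hu -hv h // subsetIr.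
  have p1 X := proj1 (fullpair_cap X fp); have p2 X := proj2 (fullpair_cap X fp).
  have q1 X := proj1 (fullpair_cap X fq); have q2 X := proj2 (fullpair_cap X fq).
  case: (fullpair_unique dec two ij nij (introN idP T0) fq fp) => h; [left|right].
    rewrite -pair_eqE /pair_eq; apply/andP; split; apply/eqP/ext => // X sX;
      by case: (h X sX).
  rewrite -pair_eqE /pair_eq; apply/andP; split; apply/eqP/ext => // X sX;
    by case: (h X sX).
by rewrite cards2 -pair_eqE /pair_eq /= negb_and ne.
Qed.

Lemma col_adjJ : (forall k, col (@adjJ E SS) k = k * (k - 1) * (k - 2)) \/
  (forall k, col (@adjJ E SS) k = k * (k - 1) * (k - 1)).
Proof.
have n0 (A : J) : val A != set0 by apply: contraNneq S0 => <-; apply: valP.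
have meet (A B : J) e : e \in val A -> e \in val B -> val A :&: val B != set0.
  by move=> eA eB; apply/set0Pn; exists e; rewrite inE eA.
case: assigns_thin => [[i [j [k [[ij ik jk] [[h1 h2 h3 h4] [n1 n2 n3]]]]]]|
           [i [j [k [[ij ik jk] [[h1 h2 h3] [n1 n2 n3]]]]]]]; [left|right] => m.
- have bij := three_bij ij ik jk (fun l => triangle_cover two dec ij ik jk h1 h2 h3 (n0 l)).
  rewrite -col_complete3; symmetry; apply: (col_relabel m bij) => u v.
  rewrite /adjJ /complete (bij_eq bij).
  have [e eij eij'] := triangle_meet h2 h3 n3 (dec_sub dec k).
  have [x xik xik'] := triangle_meet h1 (etrans (setUC (val k) (val j)) h3) n2 (dec_sub dec j).
  have [y yjk yjk'] := triangle_meet (etrans (setUC (val j) (val i)) h1) (etrans (setUC (val k) (val i)) h2) n1 (dec_sub dec i).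
  have [uv|uv] := eqVneq u v; rewrite //=; apply/esym.
  by move: u v uv => [[[]|]|] [[[]|]|] // _; [apply: (meet k j y)|apply: (meet k i x)|apply: (meet j k y)|
   apply: (meet j i e)|apply: (meet i k x)|apply: (meet i j e)].
(* The middle piece [i] must go second, since [three_bij] sends [Some None], the middle vertex of
   [adj_path], to its second argument. *)
have ji : j != i by rewrite eq_sym.
have all (l : J) : [|| l == j, l == i | l == k].
  by have := path_cover two dec ij ik h1 h2 (n0 l); rewrite orbCA.
have bij := three_bij ji jk ik all.
rewrite -col_path; symmetry; apply: (col_relabel m bij) => u v.
have [[e ej] [x xk]] := (set0Pn _ n2, set0Pn _ n3).
have ei : e \in val i by rewrite h1 (subsetP (dec_sub dec j)).
have xi : x \in val i by rewrite h1 (subsetP (dec_sub dec k)).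
have [mij mik] := (meet i j e ei ej, meet i k x xi xk).
rewrite /adjJ (bij_eq bij).
by move: u v => [[[]|]|] [[[]|]|] //=; rewrite ?mij ?mik ?(setIC _ (val i)) ?mij ?mik //
  ?(setIC (val k)) ?h3 ?eqxx.
Qed.

End Both.

Import GRing.Theory Num.Theory.
Local Open Scope ring_scope.

Lemma connected_multiple : chromatic_multiple (fun k => #|decs rho k|).
Proof.
have fullE k := full_count two F0 k.
have [/existsP[SS /andP[S0 /set0Pn[al alA]]]|/existsPn none] :=
    boolP [exists SS : {set {set E}}, (set0 \notin SS) && (assigns rho SS != set0)].
  have nonE k := nonfull_count_of_assign k S0 alA.
  have [Q0|/set0Pn[p pQ]] := eqVneq (fullpairs rho) set0.
    exists {A : {set E} | A \in SS}, (@adjJ E SS), (#|assigns rho SS|%:R); split.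
    - by move=> A; rewrite /adjJ eqxx.
    - by move=> A B; rewrite /adjJ eq_sym setIC.
    by move=> k; rewrite decs_split fullE Q0 cards0 mul0n add0n nonE natrM.
  have L k := card_lt_pairs k.
  case: (col_adjJ S0 alA pQ) => hc.
    have [irr sym] := adj_path_simple.
    exists (option (option unit)), adj_path, 1; split=> // k.
    rewrite mul1r decs_split fullE nonE (assigns1 alA pQ) (fullpairs2 alA pQ) L hc col_path.
    congr (_%:R); case: k => [|[|k]] //.
    by rewrite mul1n !subn1 !subn2 /=; nia.
  have [irr sym] := adj_edge_point_simple.
  exists (option (option unit)), adj_edge_point, 1; split=> // k.
  rewrite mul1r decs_split fullE nonE (assigns1 alA pQ) (fullpairs2 alA pQ) L hc col_edge_point.
  congr (_%:R); case: k => [|k] //.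
  by rewrite mul1n !subn1 /=; nia.
have [irr sym] := complete_simple (option unit).
(* Only full tuples exist. The factor 1/2 arises because the positions i < j are half of the k(k-1)
   colourings of an edge. *)
exists (option unit), (complete (option unit)), (#|fullpairs rho|%:R / 2); split=> // k.
have -> : #|decs rho k| = (#|fullpairs rho| * #|[set x : 'I_k * 'I_k | (x.1 < x.2)%N]|)%N.
  rewrite decs_split fullE [X in (_ + X)%N](_ : _ = 0%N) ?addn0 //; apply/eqP.
  rewrite cards_eq0; apply: contraT => /set0Pn[t]; rewrite inE => /andP[tD nf].
  by have [SS h] := assign_of_nonfull tD nf; have := none SS; rewrite h.
rewrite col_complete2 -card_lt_pairs !natrM -mulrA; congr (_ * _).
by rewrite mulrA mulVf ?mul1r // pnatr_eq0.
Qed.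

End Connected.

(** * Separators and the main theorem *)

Section Product.
Variable E : finType.
Implicit Types (e x : E) (X Y A B G : {set E}).
Variables (rho : {set E} -> nat) (A B : {set E}).
Hypothesis AB : A :&: B = set0.
Hypothesis splitE : forall X, rho X = rho (X :&: A) + rho (X :&: B).

Lemma split0 : rho set0 = 0.
Proof. by have := splitE set0; rewrite !set0I; clear; lia. Qed.

Lemma decs_restr_cap G k (t : {ffun 'I_k -> rankfun E}) i X :
  t \in decs (fun X => rho (X :&: G)) k -> rkn (t i) (X :&: G) = rkn (t i) X.
Proof.
move=> tD; apply: rk_capl; first exact: (decs_matroid tD).
move=> e eG; apply/eqP; rewrite -leqn0; apply: leq_trans (decs_le tD i _) _.
rewrite (_ : _ :&: _ = set0) ?split0 //; apply/setP => z; rewrite !inE.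
by case: eqP => // ->; apply: negPf.
Qed.

(** Restricting each matroid to [A] and to [B] is inverse to taking direct sums position by
    position. *)
Lemma decs_product k : #|decs rho k| =
  #|decs (fun X => rho (X :&: A)) k| * #|decs (fun X => rho (X :&: B)) k|.
Proof.
pose psi (x : {ffun 'I_k -> rankfun E} * {ffun 'I_k -> rankfun E}) : {ffun 'I_k -> rankfun E} :=
  [ffun i => mkrk (fun X => rkn (x.1 i) X + rkn (x.2 i) X)].
have sumM r s : matroid r -> matroid s -> (forall X, r (X :&: A) = r X) ->
    (forall X, s (X :&: B) = s X) -> matroid (fun X => r X + s X).
  move=> rM sM rA sB.
  have out G (q : {set E} -> nat) e : matroid q -> (forall X, q (X :&: G) = q X) -> e \notin G -> q [set e] = 0.
    move=> qM h eG; rewrite -h (_ : _ :&: _ = set0) ?rk0 //.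
    by apply/setP => z; rewrite !inE; case: eqP => // ->; apply: negPf.
  have := @sum_matroid E bool predT (fun b => if b then r else s) (fun b => if b then A else B).
  case; [by case|by case=> e _; apply: out|..].
    move=> i j e _ _; have no : ~~ ((e \in A) && (e \in B)) by rewrite -in_setI AB inE.
    by case: i; case: j => // h1 h2; rewrite h1 h2 in no.
  by move=> h0 h1 h2 h3; split=> [|X Y /h1|X Y|e]; [move: h0|..|move: (h2 X Y)|move: (h3 e)];
    rewrite !big_bool.
have psiE u v i X : u \in decs (fun X => rho (X :&: A)) k -> v \in decs (fun X => rho (X :&: B)) k ->
    rkn (psi (u, v) i) X = rkn (u i) X + rkn (v i) X.
  move=> uD vD; rewrite ffunE mkrkE //; apply: sumM.
  - exact: (decs_matroid uD).
  - exact: (decs_matroid vD).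
  - by move=> Y; apply: decs_restr_cap.
  - by move=> Y; apply: decs_restr_cap.
have zero G H (t : {ffun 'I_k -> rankfun E}) i X : G :&: H = set0 ->
    t \in decs (fun X => rho (X :&: H)) k -> rkn (t i) (X :&: G) = 0.
  move=> GH tD; rewrite -(decs_restr_cap i _ tD) -setIA GH setI0.
  exact: (rk0 (decs_matroid tD i)).
have BA : B :&: A = set0 by rewrite setIC.
rewrite -cardsX -(card_in_imset (f := psi)); last first.
  move=> [u v] [u' v'] /setXP[/= uD vD] /setXP[/= uD' vD'] eq.
  congr (_, _); apply/ffunP => i; apply: rkn_inj => X.
    have := psiE u v i (X :&: A) uD vD; rewrite eq (psiE u' v') //.
    rewrite (zero A B v i X AB vD) (zero A B v' i X AB vD') !addn0.
    by rewrite (decs_restr_cap i X uD) (decs_restr_cap i X uD').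
  have := psiE u v i (X :&: B) uD vD; rewrite eq (psiE u' v') //.
  rewrite (zero B A u i X BA uD) (zero B A u' i X BA uD') !add0n.
  by rewrite (decs_restr_cap i X vD) (decs_restr_cap i X vD').
apply: eq_card => t; apply/idP/imsetP => [tD|[[u v] /setXP[/= uD vD] ->]]; last first.
  apply/decsP; split=> [i|X].
    have M := sumM _ _ (decs_matroid uD i) (decs_matroid vD i)
      (fun X => decs_restr_cap i X uD) (fun X => decs_restr_cap i X vD).
    have [h0 h1 h2 h3] := M; split; first by rewrite psiE.
    - by move=> X Y; rewrite !psiE //; apply: h1.
    - by move=> X Y; rewrite !psiE //; apply: h2.
    - by move=> e; rewrite psiE.
  rewrite splitE (decs_sum uD) (decs_sum vD) -big_split /=.
  by apply: eq_bigr => i _; rewrite psiE.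
have tM i := decs_matroid tD i.
have restrD G : [ffun i => mkrk (fun X => rkn (t i) (X :&: G))] \in decs (fun X => rho (X :&: G)) k.
  have mE i X : rkn ([ffun i => mkrk (fun X => rkn (t i) (X :&: G))] i) X = rkn (t i) (X :&: G).
    by rewrite ffunE mkrkE //; apply: restr_matroid.
  apply/decsP; split=> [i|X]; last by rewrite (decs_sum tD); apply: eq_bigr => i _; rewrite mE.
  have [h0 h1 h2 h3] := restr_matroid G (tM i); split; first by rewrite mE.
  - by move=> X Y; rewrite !mE; apply: h1.
  - by move=> X Y; rewrite !mE; apply: h2.
  - by move=> e; rewrite mE.
exists ([ffun i => mkrk (fun X => rkn (t i) (X :&: A))], [ffun i => mkrk (fun X => rkn (t i) (X :&: B))]).
  by rewrite in_setX !restrD.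
apply/ffunP => i; apply: rkn_inj => X; rewrite psiE ?restrD // !ffunE !mkrkE;
  try exact: restr_matroid.
(* Each position satisfies this inequality, and the sums over all positions are equal by [splitE],
   so equality holds in every position. *)
have le j : rkn (t j) X <= rkn (t j) (X :&: A) + rkn (t j) (X :&: B).
  have hl : rkn (t j) (X :&: (A :|: B)) = rkn (t j) X.
    apply: rk_capl => // e; rewrite inE negb_or => /andP[eA eB]; apply/eqP.
    rewrite -leqn0; apply: leq_trans (decs_le tD j _) _; rewrite splitE.
    have h G : e \notin G -> rho ([set e] :&: G) = 0.
      move=> eG; rewrite (_ : _ :&: _ = set0) ?split0 //; apply/setP => z; rewrite !inE.
      by case: eqP => // ->; apply: negPf.
    by rewrite !h.
  by rewrite -hl setIUr; apply: rk_subadd.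
have := splitE X; rewrite !(decs_sum tD) -big_split /= (bigD1 i) //= [in RHS](bigD1 i) //=.
have : \sum_(j | j != i) rkn (t j) X <= \sum_(j | j != i) (rkn (t j) (X :&: A) + rkn (t j) (X :&: B)).
  by apply: leq_sum.
have := le i; move: (\sum_(j | _) _) (\sum_(j | _) _) => p q.
by move: (rkn _ _) (rkn _ _) (rkn _ _) => *; lia.
Qed.

End Product.

(** Equality of the sums forces the separator to split each matroid of the tuple, hence also
    [rho]. *)
Lemma decs_separated (E : finType) (rho : {set E} -> nat) (A : {set E}) k t :
  A \subset nonloops rho -> rho A + rho (nonloops rho :\: A) <= rho (nonloops rho) ->
  t \in decs rho k ->
  forall X, rho X = rho (X :&: A) + rho (X :&: (nonloops rho :\: A)).
Proof.
set F := nonloops rho => sA hA tD X.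
have tM i := decs_matroid tD i.
have eqF i : rkn (t i) A + rkn (t i) (F :\: A) <= rkn (t i) F.
  have le j : rkn (t j) F <= rkn (t j) A + rkn (t j) (F :\: A).
    by rewrite -{1}(setIidPr sA) -{1}(setID F A); apply: rk_subadd.
  move: hA; rewrite !(decs_sum tD) -big_split /= (bigD1 i) //= [in X in _ <= X](bigD1 i) //=.
  have : \sum_(j | j != i) rkn (t j) F <= \sum_(j | j != i) (rkn (t j) A + rkn (t j) (F :\: A)).
    by apply: leq_sum.
  move: (\sum_(j | _) _) (\sum_(j | _) _) => p q.
  by move: (rkn _ _) (rkn _ _) (rkn _ _) => *; lia.
rewrite !(decs_sum tD) -big_split /=; apply: eq_bigr => i _.
rewrite -(decs_cap tD) (sep_split (tM i) sA (eqF i) (subsetIr _ _)) -/F.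
by congr (_ + _); rewrite -?setIA ?(setIidPr sA) // setIDA.
Qed.

Section Assembly.
Import GRing.Theory Num.Theory.
Local Open Scope ring_scope.
Variable E : finType.
Implicit Types (e x : E) (X Y A B G : {set E}) (rho : {set E} -> nat).

Lemma chromatic_multiple0 f : (forall k, f k = 0%N) -> chromatic_multiple f.
Proof.
move=> f0; have [irr sym] := complete_simple unit.
by exists unit, (complete unit), 0; split=> // k; rewrite f0 mul0r.
Qed.

Lemma chromatic_multiple1 f : (forall k, f k = 1%N) -> chromatic_multiple f.
Proof.
move=> f1; have [irr sym] := complete_simple void.
exists void, (complete void), 1; split=> // k; rewrite f1 mul1r /col (_ : colset _ _ = setT).
  by rewrite cardsT card_ffun card_void expn0.
by apply/setP => c; rewrite in_setT; apply/colsetP => -[].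
Qed.

Lemma chromatic_multipleM f g : chromatic_multiple f -> chromatic_multiple g ->
  chromatic_multiple (fun k => (f k * g k)%N).
Proof.
move=> [V [a [s [irr sym fE]]]] [W [b [s' [irr' sym' gE]]]].
exists (V + W)%type, (adj_sum a b), (s * s'); split.
- by move=> [x|x] /=; rewrite ?irr ?irr'.
- by move=> [x|x] [y|y] //=; rewrite ?(sym x) ?(sym' x).
by move=> k; rewrite natrM fE gE col_sum natrM mulrACA.
Qed.

Lemma decs_multiple rho : (forall e, (rho [set e] <= 2)%N) ->
  chromatic_multiple (fun k => #|decs rho k|).
Proof.
have [n] := ubnP #|nonloops rho|; elim: n => // n IH in rho * => hn two.
have [F0|F0] := eqVneq (nonloops rho) set0.
  have z k (t : {ffun 'I_k -> rankfun E}) i X : t \in decs rho k -> rkn (t i) X = 0%N.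
    by move=> tD; rewrite -(decs_cap tD) F0 setI0 (rk0 (decs_matroid tD i)).
  have [/forallP r0|/forallPn[X r0]] := boolP [forall X : {set E}, rho X == 0%N].
    apply: chromatic_multiple1 => k.
    have z0 : [ffun=> mkrk (fun=> 0%N)] \in decs rho k.
      apply/decsP; split=> [i|X]; last first.
        by rewrite (eqP (r0 X)) big1 // => i _; rewrite ffunE mkrkE.
      by split=> [|X Y _|X Y|e]; rewrite !ffunE !mkrkE.
    rewrite (_ : decs rho k = [set [ffun=> mkrk (fun=> 0%N)]]) ?cards1 //.
    apply/setP => t; rewrite in_set1; apply/idP/eqP => [tD|->//].
    by apply/ffunP => i; apply: rkn_inj => X; rewrite (z _ _ _ _ tD) (z _ _ _ _ z0).
  apply: chromatic_multiple0 => k; apply/eqP; rewrite cards_eq0.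
  apply: contraT => /set0Pn[t tD]; case/negP: r0.
  by rewrite (decs_sum tD) big1 // => i _; apply: z.
have [cr|] := boolP (conn rho (nonloops rho)); first exact: connected_multiple.
rewrite negb_and => /orP[/forall_inPn[e]|/forallPn[A]]; first by rewrite inE => ->.
rewrite negb_imply -leqNgt => /andP[/and3P[sA A0 AF] hA].
set B := nonloops rho :\: A in hA.
(* If [rho] does not split along the separator, [decs_separated] shows that there are no tuples at
   all, and the scalar 0 is used. *)
have [/forallP sp|nsp] := boolP [forall X : {set E}, rho X == (rho (X :&: A) + rho (X :&: B))%N]; last first.
  apply: chromatic_multiple0 => k; apply/eqP; rewrite cards_eq0.
  apply: contraT => /set0Pn[t tD]; case/negP: nsp; apply/forallP => X; apply/eqP.
  exact: (decs_separated sA hA tD).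
have spE X : rho X = (rho (X :&: A) + rho (X :&: B))%N by apply/eqP.
have r0 := split0 spE.
have AB : A :&: B = set0 by rewrite /B; apply/setP => z; rewrite !inE; case: (z \in A).
apply: chromatic_multiple_eq (fun k => esym (decs_product AB spE k)) _.
have small G : G \proper nonloops rho -> chromatic_multiple (fun k => #|decs (fun X => rho (X :&: G)) k|).
  move=> pG; have out e : e \notin G -> [set e] :&: G = set0.
    by move=> eG; apply/setP => z; rewrite !inE; case: eqP => // ->; apply: negPf.
  apply: IH => [|e].
    apply: leq_ltn_trans (leq_trans (proper_card pG) (hn : (_ <= n)%N)).
    apply/subset_leq_card/subsetP => e; rewrite inE; apply: contraTT => eG.
    by rewrite out // r0.
  have [eG|eG] := boolP (e \in G); last by rewrite out // r0.
  by rewrite (setIidPl _) // sub1set.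
apply: chromatic_multipleM; apply: small; first by rewrite properEneq AF.
rewrite properE subsetDl; apply: contra A0 => /subsetP h.
have [//|[z zA]] := set_0Vmem A; first by move->.
by have := h z (subsetP sA z zA); rewrite inE zA.
Qed.

Lemma matroid_rankE (f : rankfun E) : is_matroid_rank (rk f) = matroidb (rkn f).
Proof.
apply/andP/matroidP => [[/andP[/eqP h0 /forallP h] /forallP hc]|M].
  have h' X Y := andP (forallP (h X) Y).
  split.
  - by case: h0.
  - by move=> X Y sXY; have [/implyP/(_ sXY) + _] := h' X Y.
  - by move=> X Y; have [_] := h' X Y; rewrite /rk -!PoszD lez_nat.
  - by move=> e; have := hc [set e]; rewrite cards1.
split; last by apply/forallP => X; apply: rk_card M.
apply/andP; split; first by rewrite /rk; have := rk0 M; rewrite /rkn => ->.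
apply/forallP => X; apply/forallP => Y; apply/andP; split.
  by apply/implyP => sXY; rewrite lez_nat; apply: rk_mono M _ _ sXY.
by rewrite /rk -!PoszD lez_nat; apply: rk_submod M _ _.
Qed.

Lemma decomp_countE (rho : {set E} -> int) k : (forall X, 0 <= rho X) ->
  matroid_decomp_count rho k = #|decs (fun X => `|rho X|%N) k|.
Proof.
move=> h; apply: eq_card => t; rewrite !inE; congr (_ && _).
  by apply: eq_forallb => i; rewrite matroid_rankE.
apply: eq_forallb => X; rewrite -{1}(gez0_abs (h X)).
rewrite (_ : \sum_(i < k) rk (t i) X = (\sum_i rkn (t i) X)%N%:Z) ?eqz_nat //.
by rewrite -natz natr_sum; apply: eq_bigr => i _; rewrite natz.
Qed.

End Assembly.

Import GRing.Theory Num.Theory.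
Local Open Scope ring_scope.

Theorem theorem3p3 (E : finType) (rho : {set E} -> int) :
  is_2polymatroid rho ->
  exists (chi_rho : {poly rat}) (n : nat) (adj : rel 'I_n)
         (chi_G : {poly rat}) (s : rat),
    [/\ poly_counts chi_rho (matroid_decomp_count rho),
        simple_graph adj,
        poly_counts chi_G (proper_colourings_count adj) &
        chi_rho = s *: chi_G].
Proof.
move=> /andP[/andP[/eqP r0 /forallP rP] /forallP two].
have pos X : 0 <= rho X.
  by have /forallP/(_ X)/andP[/implyP + _] := rP set0; rewrite r0 sub0set; apply.
have two' e : (`|rho [set e]| <= 2)%N by rewrite -lez_nat gez0_abs.
have [V [adj [s [irr sym cE]]]] := @decs_multiple E (fun X => `|rho X|%N) two'.
pose adj' : rel 'I_#|V| := fun u v => adj (enum_val u) (enum_val v).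
have colE k : col adj' k = col adj k by apply: (@col_relabel _ _ adj' adj enum_val k (enum_val_bij V)).
have [p pE] := col_poly adj'.
(* The values at positive integers determine a polynomial, so [s *: p] is the chromatic polynomial
   of [rho]. *)
exists (s *: p), #|V|, adj', p, s; split=> //.
- by move=> k _; rewrite hornerZ pE colE -cE decomp_countE.
- by split=> [u|u v]; rewrite /adj' ?irr // sym.
Qed.
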